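(* Let $u$ be in class $\mathcal{K}^+$ on $[y_1,y_2]$ and $\alpha>0$. Then $$m_\beta\le\sharp\big(\sigma_d(\mathcal{R}_{\alpha,\beta})\cap(-\infty,u_{\min})\big)<\infty\quad\text{for }0<\beta\le\tfrac98\kappa_+;$$ $$m_\beta\le\sharp\big(\sigma_d(\mathcal{R}_{\alpha,\beta})\cap(u_{\max},\infty)\big)<\infty\quad\text{for }\tfrac98\kappa_-\le\beta<0;$$ and $\sharp(\sigma_d(\mathcal{R}_{\alpha,\beta})\cap\mathbf{R})=\infty$ for $\beta\notin[\frac98\kappa_-,\frac98\kappa_+]$.
   Context: $y_1<y_2$; $u$ is real-valued; $u_{\min}=\min_{[y_1,y_2]}u$, $u_{\max}=\max_{[y_1,y_2]}u$. $u$ is in class $\mathcal{K}^+$ if $u\in H^4(y_1,y_2)$ is not a constant function and for any $\beta\in\mathrm{Ran}(u'')$ there exists $u_\beta\in\mathrm{Ran}(u)$ such that $K_\beta=(\beta-u'')/(u-u_\beta)$ is positive and bounded on $[y_1,y_2]$, i.e. $\beta-u''=K_\beta\,(u-u_\beta)$ on $[y_1,y_2]$ with $K_\beta$ positive and bounded. $\kappa_+=\min\{u''(y): y\in[y_1,y_2],\,u'(y)=0,\,u(y)=u_{\min}\}$ if $\{u'=0\}\cap\{u=u_{\min}\}\ne\emptyset$ and $\kappa_+=\infty$ otherwise; $\kappa_-=\max\{u''(y): y\in[y_1,y_2],\,u'(y)=0,\,u(y)=u_{\max}\}$ if $\{u'=0\}\cap\{u=u_{\max}\}\ne\emptyset$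 and $\kappa_-=-\infty$ otherwise. (Infinite endpoints mean that the corresponding bound on the real number $\beta$ is void.) $m_\beta=\sharp\{a\in(y_1,y_2): u(a)=u_{\min},\,u''(a)-\beta<0\}$ if $0<\beta\le\frac98\kappa_+$, and $m_\beta=\sharp\{a\in(y_1,y_2): u(a)=u_{\max},\,u''(a)-\beta>0\}$ if $\frac98\kappa_-\le\beta<0$. $\mathcal{R}_{\alpha,\beta}=-(\partial_y^2-\alpha^2)^{-1}\big((u''-\beta)-u(\partial_y^2-\alpha^2)\big)$ acts on functions of $y\in[y_1,y_2]$ with Dirichlet conditions; its essential spectrum is $\mathrm{Ran}(u)$, $\sigma_d$ is its discrete spectrum, and a real $c\notin\mathrm{Ran}(u)$ is in $\sigma_d(\mathcal{R}_{\alpha,\beta})$ if and only if $-\phi''+\frac{u''-\beta}{u-c}\phi=-\alpha^2\phi$ has a nonzero solution $\phi\in H_0^1\cap H^2(y_1,y_2)$. *)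

(* Defs.v *)
From HB Require Import structures.
From mathcomp Require Import all_boot all_order all_algebra.
From mathcomp Require Import all_classical all_reals all_analysis.
From mathcomp Require Import complex.

Set Implicit Arguments.
Unset Strict Implicit.
Unset Printing Implicit Defensive.
Import Order.TTheory GRing.Theory Num.Theory.
Import numFieldNormedType.Exports.
Local Open Scope classical_set_scope.
Local Open Scope ring_scope.
Local Open Scope complex_scope.

Section Sobolev.
Context {R : realType}.
Variables a b : R.
Let mu := @lebesgue_measure R.
Implicit Types f g : R -> R.

Definition L2 f : Prop :=
  measurable_fun `[a, b] f /\ mu.-integrable `[a, b] (EFin \o (fun x => f x ^+ 2)).

Definition primitive_of f g : Prop :=
  forall x, x \in `[a, b] -> f x = f a + \int[mu]_(t in `[a, x]) g t.

(* One-dimensional Sobolev spaces: f is in H^k(a, b) if it is a k-fold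
   primitive of an L^2 function g, which is then its k-th weak derivative.
   For k > 0, this is a condition on the continuous representative; f is
   unconstrained outside of [a, b]. *)
Fixpoint weak_derivative k f g : Prop :=
  if k is k'.+1 then exists p, primitive_of f p /\ weak_derivative k' p g
  else L2 f /\ f = g.

Definition sobolev k f : Prop := exists g, weak_derivative k f g.

(* An arbitrary representative of the k-th weak derivative, which is unique
   only up to a null set. *)
Definition wderiv k f : R -> R := xget (fun=> 0) [set g | weak_derivative k f g].

(* Pointwise derivative on [a, b], one-sided at the endpoints. *)
Definition cderiv f (x : R) : R :=
  lim ((fun y => (f y - f x) / (y - x)) @ within `[a, b] x^').

Definition cwderiv k (phi : R -> R[i]) (y : R) : R[i] :=
  wderiv k (fun t => complex.Re (phi t)) y +i* wderiv k (fun t => complex.Im (phi t)) y.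

(* H^2(a, b) `&` H^1_0(a, b), complex-valued. Its elements are extended by 0,
   so that they are equal as functions iff they are equal on [a, b]; the
   Dirichlet conditions at a and b are part of the last clause. *)
Definition dirichlet_H2 : set (R -> R[i]) :=
  [set phi | [/\ sobolev 2 (fun t => complex.Re (phi t)),
                 sobolev 2 (fun t => complex.Im (phi t)) &
                 forall y, y \notin `]a, b[ -> phi y = 0]].

Definition H2norm (phi : R -> R[i]) : R :=
  Num.sqrt (\sum_(k < 3) \int[mu]_(y in `[a, b])
              (complex.Re (cwderiv k phi y) ^+ 2 + complex.Im (cwderiv k phi y) ^+ 2)).

(* (d^2/dy^2 - alpha^2)^-1 with Dirichlet conditions. *)
Definition inv_helmholtz (alpha : R) (f : R -> R[i]) : R -> R[i] :=
  xget (fun=> 0) [set psi | dirichlet_H2 psi /\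
    {ae mu, forall y, y \in `]a, b[ ->
      cwderiv 2 psi y - (alpha ^+ 2)%:C * psi y = f y}].

Definition rayleigh_kuo (u : R -> R) (alpha beta : R) (phi : R -> R[i]) :
    R -> R[i] :=
  - inv_helmholtz alpha (fun y =>
      (cderiv (cderiv u) y - beta)%:C * phi y
      - (u y)%:C * (cwderiv 2 phi y - (alpha ^+ 2)%:C * phi y)).

End Sobolev.

Section DiscreteSpectrum.
Context {R : realType} {V : lmodType R[i]}.
Variables (X : set V) (nrm : V -> R) (T : V -> V).

Definition linear_subspace (N : set V) : Prop :=
  [/\ N `<=` X, N 0 & forall (c : R[i]) v w, N v -> N w -> N (c *: v + w)].

Definition root_space (z : R[i]) : set V :=
  [set v | X v /\ exists n, iter n (fun w => T w - z *: w) v = 0].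

Definition finite_dim (M : set V) : Prop :=
  exists n (e : 'I_n -> V), forall v, M v ->
    exists c : 'I_n -> R[i], v = \sum_(i < n) c i *: e i.

(* Discrete spectrum of a bounded operator T on the Hilbert space (X, nrm):
   the eigenvalues z of finite algebraic multiplicity such that X is the
   direct sum of the root space of z and of an invariant subspace N on which
   T - z has a bounded inverse (the ranges of the Riesz projection at z and of
   its complement; such a z is isolated in the spectrum). *)
Definition discrete_spectrum : set R[i] :=
  [set z | [/\ exists v, [/\ X v, v <> 0 & T v = z *: v],
    finite_dim (root_space z) &
    exists N : set V, [/\ linear_subspace N,
      forall v, N v -> N (T v),
      forall v, X v -> exists m n, [/\ root_space z m, N n & v = m + n],
      root_space z `&` N `<=` [set 0] &
      (forall w, N w -> exists2 v, N v & T v - z *: v = w) /\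
      exists C : R, forall v, N v -> nrm v <= C * nrm (T v - z *: v)]]].

End DiscreteSpectrum.

Section Flow.
Context {R : realType}.
Variables (y1 y2 : R) (u : R -> R).
Local Notation du := (cderiv y1 y2 u).
Local Notation d2u := (cderiv y1 y2 du).

Definition Ran (f : R -> R) : set R := f @` `[y1, y2].

Definition umin : R := inf (Ran u).
Definition umax : R := sup (Ran u).

Definition class_Kplus : Prop :=
  [/\ sobolev y1 y2 4 u,
      ~ (exists c, forall y, y \in `[y1, y2] -> u y = c) &
      forall beta, Ran d2u beta ->
        exists2 ubeta, Ran u ubeta &
        exists K : R -> R,
          [/\ forall y, y \in `[y1, y2] -> 0 < K y,
              exists M, forall y, y \in `[y1, y2] -> K y <= M &
              forall y, y \in `[y1, y2] ->
                beta - d2u y = K y * (u y - ubeta)]].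

(* ereal_inf set0 = +oo and ereal_sup set0 = -oo. *)
Definition kappa_plus : \bar R :=
  ereal_inf [set (d2u y)%:E | y in
    [set y | [/\ y \in `[y1, y2], du y = 0 & u y = umin]]].
Definition kappa_minus : \bar R :=
  ereal_sup [set (d2u y)%:E | y in
    [set y | [/\ y \in `[y1, y2], du y = 0 & u y = umax]]].

(* m_beta is the cardinality of m_set_pos for beta > 0, of m_set_neg for
   beta < 0. *)
Definition m_set_pos (beta : R) : set R :=
  [set a | [/\ a \in `]y1, y2[, u a = umin & d2u a - beta < 0]].
Definition m_set_neg (beta : R) : set R :=
  [set a | [/\ a \in `]y1, y2[, u a = umax & d2u a - beta > 0]].

Definition real_sigma_d (alpha beta : R) : set R :=
  [set c | discrete_spectrum (dirichlet_H2 y1 y2) (H2norm y1 y2)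
             (rayleigh_kuo y1 y2 u alpha beta) c%:C].

End Flow.

(* Main.v *)
Require Import Defs.
From mathcomp Require Import all_boot all_order all_algebra.
From mathcomp Require Import all_classical all_reals all_analysis.
From mathcomp Require Import measurable_realfun complex ring lra.

(** A real [c] outside of the range of [u] is an eigenvalue when the Rayleigh
    equation [phi'' = (alpha^2 - (beta - u'') / (u - c)) phi] has a nonzero
    solution vanishing at both ends. Reflecting [u], [beta] and [c] leaves the
    equation unchanged and exchanges the maxima of [u] with its minima, so only
    [c] below [m = min u] matters. Three situations arise.

    If [beta] is below [u''] everywhere, the potential is positive and there is
    no eigenvalue.

    If [beta] is a value of [u''], the defining property of the class gives a
    value [ub] of [u] with [beta - u'' = K (u - ub)], [K] positive and bounded.
    In particular [u'' >= beta] wherever [u] is minimal, so there is nothing to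
    count, and only finiteness is at stake. With [psi = phi / (u - c)],
    eigenfunctions of different eigenvalues are orthogonal for the indefinite
    pairing [int (beta - u'') psi_1 psi_2]. On the span of the eigenfunctions of
    nonnegative square, [int phi'^2] is at most [M int phi^2], so that there are
    finitely many of them ([nonneg_pairing_bound]). The others cross
    transversally in a fixed direction: as [c] increases past such an
    eigenvalue, a zero of the solution shot from the left end leaves the
    interval. Between the exceptional eigenvalues the number of zeros is thus
    nonincreasing and drops at each eigenvalue, which leaves finitely many of
    them ([crossing], [eigenvalues_finite]).

    If [beta] is above [u''] everywhere, the pairing is positive definite. Far
    below [m] solutions have no zeros, so a solution with [n] zeros at some
    [c0 < m] forces [n] eigenvalues up to [c0] ([eigenvalues_from_zeros]). At an
    interior minimum where [u'' < beta] the potential has, as [c] tends to [m],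
    a well that is deep enough for one zero ([zero_near_minimum]); this gives
    the lower bound. At a critical minimum [p] the potential tends to
    [- 2 (beta / u''(p) - 1) / (x - p)^2], up to lower order terms (it is more
    singular if [u''(p) = 0]), and this is beyond Hardy's constant [1/4] exactly
    when [beta > 9/8 u''(p)]. Beyond it, solutions oscillate infinitely often
    ([inverse_square_oscillation]), and there are infinitely many eigenvalues.
    Otherwise Hardy's inequality, in a
    form that absorbs the lower order terms ([hardy_right]), makes the form
    [int phi'^2 + V phi^2] nonnegative on functions vanishing on a finite grid,
    whereas it is negative on the span of the eigenfunctions; their number is
    at most that of the points of the grid ([pos_pairing_bound]). The third
    claim is always in this situation, as a critical minimum satisfies
    [u'' >= 0].

    It remains to compare these eigenvalues with the discrete spectrum of the
    operator [T]. An eigenvector of [T] is a solution of the equation. In the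
    other direction, let [S] be the solution shot from the left end at an
    eigenvalue [c]. The functional
    [f |-> int (f'' - alpha^2 f) S / (u - c)] vanishes on the range of [T - c]
    and takes on the eigenfunction the value [- int (beta - u'') (S / (u - c))^2],
    which is nonzero in the last situation. Hence [c] is algebraically simple, the
    kernel of the functional is an invariant complement of the eigenspace, and
    variation of constants inverts [T - c] on it with a bound
    ([discrete_spectrum_of_shot]). *)

Set Implicit Arguments.
Unset Strict Implicit.
Unset Printing Implicit Defensive.
Import Order.TTheory GRing.Theory Num.Theory.
Import numFieldNormedType.Exports.
Local Open Scope classical_set_scope.
Local Open Scope ring_scope.

(** * Calculus on the line *)

Section Calculus.
Context {R : realType}.
Implicit Types (f g h F G : R -> R) (a b c x y : R).

Lemma der_eq f x l l' : is_derive x 1 f l -> l = l' -> is_derive x 1 f l'.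
Proof. by move=> + <-. Qed.

Lemma derC c x : is_derive x 1 (fun _ : R => c) 0.
Proof. exact: is_derive_cst. Qed.

Lemma derI x : is_derive x 1 (fun y : R => y) 1.
Proof. exact: is_derive_id. Qed.

Lemma derN f x l : is_derive x 1 f l -> is_derive x 1 (fun y => - f y) (- l).
Proof. exact: is_deriveN. Qed.

Lemma derD f g x l k : is_derive x 1 f l -> is_derive x 1 g k ->
  is_derive x 1 (fun y => f y + g y) (l + k).
Proof. exact: is_deriveD. Qed.

Lemma derM f g x l k : is_derive x 1 f l -> is_derive x 1 g k ->
  is_derive x 1 (fun y => f y * g y) (l * g x + f x * k).
Proof.
move=> fx gx; apply: (@der_eq (f * g) x (f x *: k + g x *: l)).
by rewrite /GRing.scale/= addrC (mulrC (g x)).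
Qed.

Lemma derX2 f x l : is_derive x 1 f l ->
  is_derive x 1 (fun y => f y ^+ 2) (2 * f x * l).
Proof.
move=> fx; rewrite [X in is_derive _ _ X](_ : _ = (fun y => f y * f y)).
  by apply: (der_eq (derM fx fx)); ring.
by apply/funext => y; rewrite expr2.
Qed.

Lemma derV f x l : is_derive x 1 f l -> f x != 0 ->
  is_derive x 1 (fun y => (f y)^-1) (- l / f x ^+ 2).
Proof.
move=> [fx fl] fx0; apply: DeriveDef; first exact: derivableV.
by rewrite deriveV// fl /GRing.scale/= !mulNr mulrC.
Qed.

Lemma derComp f g x l k : is_derive x 1 f l -> is_derive (f x) 1 g k ->
  is_derive x 1 (fun y => g (f y)) (l * k).
Proof. by move=> fx gx; have := is_derive1_comp gx fx; rewrite mulrC. Qed.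

Lemma der_cont f x l : is_derive x 1 f l -> {for x, continuous f}.
Proof. by move=> [fx _]; apply/differentiable_continuous/derivable1_diffP. Qed.

(** [g] is the derivative of [f] on the whole line; working with globally
    defined primitives avoids one-sided derivatives at end points. *)
Definition Dv f g := forall x, is_derive x 1 f (g x).

Lemma Dv_cont f g : Dv f g -> continuous f.
Proof. by move=> fg x; exact: der_cont (fg x). Qed.

Lemma ctC c : continuous (fun _ : R => c).
Proof. by move=> x; exact: cvg_cst. Qed.
Lemma ctI : continuous (fun x : R => x).
Proof. by move=> x; exact: cvg_id. Qed.
Lemma ctD f g : continuous f -> continuous g -> continuous (fun x => f x + g x).
Proof. by move=> cf cg x; apply: cvgD; [exact: cf|exact: cg]. Qed.
Lemma ctN f : continuous f -> continuous (fun x => - f x).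
Proof. by move=> cf x; apply: cvgN; exact: cf. Qed.
Lemma ctM f g : continuous f -> continuous g -> continuous (fun x => f x * g x).
Proof. by move=> cf cg x; apply: cvgM; [exact: cf|exact: cg]. Qed.
Lemma ctX f n : continuous f -> continuous (fun x => f x ^+ n).
Proof.
move=> cf; elim: n => [|n IH]; first by rewrite (_ : (fun _ => _) = fun=> 1)//; exact: ctC.
rewrite (_ : (fun _ => _) = fun x => f x * f x ^+ n); last first.
  by apply/funext => x; rewrite exprS.
exact: ctM.
Qed.
Lemma ctV f : continuous f -> (forall x, f x != 0) ->
  continuous (fun x => (f x)^-1).
Proof. by move=> cf f0 x; apply: cvgV => //; exact: cf. Qed.
Lemma ctComp f g : continuous f -> continuous g -> continuous (fun x => g (f x)).
Proof. by move=> cf cg x; exact: (@continuous_comp _ _ _ f g x (cf x) (cg (f x))). Qed.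
Lemma ctAbs f : continuous f -> continuous (fun x => `|f x|).
Proof. by move=> cf x; apply: cvg_norm; exact: cf. Qed.

Lemma ct_within f a b : continuous f -> {within `[a, b], continuous f}.
Proof. exact: continuous_subspaceT. Qed.

Lemma der_mvt F f a b : a < b -> (forall x, a < x < b -> is_derive x 1 F (f x)) ->
  {within `[a, b], continuous F} ->
  exists2 c, a < c < b & F b - F a = f c * (b - a).
Proof.
move=> ab dF cF; have dF' x : x \in `]a, b[ -> is_derive x 1 F (f x) by rewrite in_itv; exact: dF.
have [c + E] := @MVT R F f a b ab dF' cF.
by rewrite in_itv => /= cab; exists c.
Qed.

Lemma der_le F f a b : a <= b -> (forall x, a < x < b -> is_derive x 1 F (f x)) ->
  {within `[a, b], continuous F} -> (forall x, a < x < b -> 0 <= f x) -> F a <= F b.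
Proof.
rewrite le_eqVlt => /predU1P[->//|ab] dF cF f0.
have [c cab E] := der_mvt ab dF cF.
by rewrite -subr_ge0 E mulr_ge0 ?f0// subr_ge0 ltW.
Qed.

Lemma Dv_mvt F f a b : a < b -> Dv F f ->
  exists2 c, a < c < b & F b - F a = f c * (b - a).
Proof. by move=> ab dF; apply: der_mvt => //; exact/ct_within/Dv_cont/dF. Qed.

Lemma Dv_le F f a b : a <= b -> Dv F f -> (forall x, a < x < b -> 0 <= f x) ->
  F a <= F b.
Proof. by move=> ab dF; apply: der_le => //; exact/ct_within/Dv_cont/dF. Qed.

Lemma Dv_le2 F f G g a b : a <= b -> Dv F f -> Dv G g ->
  (forall x, a < x < b -> f x <= g x) -> F b - F a <= G b - G a.
Proof.
move=> ab dF dG fg.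
have D : Dv (fun x => G x - F x) (fun x => g x - f x).
  by move=> x; apply: derD => //; apply: derN.
have : 0 <= (G b - F b) - (G a - F a).
  rewrite subr_ge0; apply: (Dv_le ab D) => x /fg; rewrite subr_ge0//.
by lra.
Qed.

Lemma Dv_const F a x : Dv F (fun=> 0) -> F x = F a.
Proof.
move=> dF; have H u v : u <= v -> F v - F u = 0.
  move=> uv; apply/eqP; rewrite eq_le.
  have := Dv_le2 uv dF (fun x => derC 0 x) (fun _ _ => lexx 0).
  have := Dv_le2 uv (fun x => derC 0 x) dF (fun _ _ => lexx 0).
  by rewrite subrr => -> ->.
by case: (leP a x) => [/H|/ltW/H]; lra.
Qed.

Lemma Dv_uniq F G f a x : Dv F f -> Dv G f -> F x - F a = G x - G a.
Proof.
move=> dF dG.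
have D : Dv (fun x => F x - G x) (fun=> 0).
  by move=> y; apply: (der_eq (derD (dF y) (derN (dG y)))); rewrite subrr.
by have := Dv_const a x D; lra.
Qed.

End Calculus.
Arguments ctC {R} c.
Arguments ctM {R f g}.
Arguments ctD {R f g}.
Arguments ctN {R f}.
Arguments derC {R} c x.

(** * Primitives *)

Section Primitive.
Context {R : realType}.
Implicit Types (f g h F G : R -> R) (a b c x y : R).

Local Notation mu := (@lebesgue_measure R).

Lemma cont_integrable f a b : continuous f ->
  mu.-integrable `[a, b] (EFin \o f).
Proof.
move=> cf; apply: continuous_compact_integrable; first exact: segment_compact.
exact: ct_within.
Qed.

Lemma Rint_split f a b c : mu.-integrable `[a, c] (EFin \o f) ->
  a <= b -> b <= c ->
  \int[mu]_(t in `[a, c]) f t =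
  \int[mu]_(t in `[a, b]) f t + \int[mu]_(t in `[b, c]) f t.
Proof.
move=> fi ab bc; have := @Rintegral_itvB _ f (BLeft a) (BRight c) b fi.
rewrite !bnd_simp => /(_ ab bc) E.
rewrite -[X in _ + X](@Rintegral_itv_obnd_cbnd _ b (BRight c)).
  by rewrite -E addrC subrK.
by apply: integrableS fi => //; apply: subset_itvr; rewrite bnd_simp.
Qed.

(** The primitive of [f] vanishing at [a]; the base point of the integrals lies
    to the left of both [a] and [x], so that no orientation is needed. *)
Definition prim a f x : R :=
  let m := Num.min a x - 1 in
  \int[mu]_(t in `[m, x]) f t - \int[mu]_(t in `[m, a]) f t.

Lemma primE m a f x : continuous f -> m <= a -> m <= x ->
  prim a f x = \int[mu]_(t in `[m, x]) f t - \int[mu]_(t in `[m, a]) f t.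
Proof.
move=> cf ma mx; rewrite /prim; set n := Num.min a x - 1.
have na : n <= a by rewrite lerBlDr ge_min lerDl ler01.
have nx : n <= x by rewrite lerBlDr ge_min; apply/orP; right; rewrite lerDl ler01.
have I p q : mu.-integrable `[p, q] (EFin \o f) by exact: cont_integrable.
case: (leP m n) => [mn|/ltW nm].
  by rewrite (Rint_split (I m x) mn nx) (Rint_split (I m a) mn na); ring.
by rewrite (Rint_split (I n x) nm mx) (Rint_split (I n a) nm ma); ring.
Qed.

Lemma prim_Rint a f x : continuous f -> a <= x ->
  prim a f x = \int[mu]_(t in `[a, x]) f t.
Proof.
move=> cf ax; rewrite (@primE a)// set_itv1 Rintegral_set1 subr0//.
Qed.

Lemma prim0 a f : prim a f a = 0.
Proof. by rewrite /prim subrr. Qed.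

Lemma prim_Dv a f : continuous f -> Dv (prim a f) f.
Proof.
move=> cf x; pose m := Num.min a x - 1.
have ma : m <= a by rewrite lerBlDr ge_min lerDl ler01.
have mx : m < x by rewrite ltrBlDr gt_min; apply/orP; right; rewrite ltrDl ltr01.
apply: (@near_eq_is_derive _ _ _
  (fun y => \int[mu]_(t in `[m, y]) f t - \int[mu]_(t in `[m, a]) f t)).
  near=> y; rewrite (@primE m)//.
  by apply: ltW; near: y; exact: lt_nbhsr.
have x1 : x < x + 1 by rewrite ltrDl.
have [|d1 d2] := continuous_FTC1 x1 (@cont_integrable f m (x + 1) cf) _ (cf x).
  by rewrite /= lte_fin.
have dF : is_derive x 1 (fun y => \int[mu]_(t in `[m, y]) f t) (f x).
  by apply: (DeriveDef d1); rewrite -derive1E; exact: d2.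
by apply: (der_eq (derD dF (derN (derC _ x)))); rewrite subr0.
Unshelve. all: by end_near. Qed.

Lemma prim_cont a f : continuous f -> continuous (prim a f).
Proof. by move=> /(prim_Dv a)/Dv_cont. Qed.

Lemma prim_uniq F f a x : continuous f -> Dv F f -> prim a f x = F x - F a.
Proof.
by move=> /(prim_Dv a) dP dF; rewrite -(Dv_uniq a x dP dF) prim0 subr0.
Qed.

Lemma primD a f g x : continuous f -> continuous g ->
  prim a (fun t => f t + g t) x = prim a f x + prim a g x.
Proof.
move=> cf cg; rewrite (@prim_uniq (fun x => prim a f x + prim a g x)).
- by rewrite !prim0 addr0 subr0.
- exact: ctD.
- by move=> y; apply: derD; exact: prim_Dv.
Qed.

Lemma primZ a c f x : continuous f ->
  prim a (fun t => c * f t) x = c * prim a f x.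
Proof.
move=> cf; rewrite (@prim_uniq (fun x => c * prim a f x)).
- by rewrite !prim0 mulr0 subr0.
- by apply: ctM => //; exact: ctC.
- move=> y; apply: (der_eq (derM (derC c y) (prim_Dv a cf y))); ring.
Qed.

Lemma primN a f x : continuous f -> prim a (fun t => - f t) x = - prim a f x.
Proof.
move=> cf; rewrite -mulN1r -primZ//; congr (prim _ _ _).
by apply/funext => t; rewrite mulN1r.
Qed.

Lemma primB a f g x : continuous f -> continuous g ->
  prim a (fun t => f t - g t) x = prim a f x - prim a g x.
Proof. by move=> cf cg; rewrite primD ?primN//; exact: ctN. Qed.

Lemma ct_sum (I : Type) (s : seq I) (f : I -> R -> R) :
  (forall i, continuous (f i)) -> continuous (fun x => \sum_(i <- s) f i x).
Proof.
move=> cf; elim: s => [|i s IH].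
  by rewrite (_ : (fun _ => _) = fun=> 0); [exact: ctC|apply/funext => x; rewrite big_nil].
rewrite (_ : (fun _ => _) = fun x => f i x + \sum_(j <- s) f j x).
  exact: ctD.
by apply/funext => x; rewrite big_cons.
Qed.

Lemma prim_sum (I : Type) (s : seq I) a (f : I -> R -> R) x :
  (forall i, continuous (f i)) ->
  prim a (fun t => \sum_(i <- s) f i t) x = \sum_(i <- s) prim a (f i) x.
Proof.
move=> cf; elim: s => [|i s IH].
  rewrite big_nil (_ : (fun _ => _) = fun=> 0 * 0).
    by rewrite primZ ?mul0r//; exact: ctC.
  by apply/funext => t; rewrite big_nil mul0r.
rewrite big_cons -IH -primD//; last exact: ct_sum.
by congr (prim _ _ _); apply/funext => t; rewrite big_cons.
Qed.

Lemma eq_prim a f g x : a <= x -> continuous f -> continuous g ->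
  (forall t, a < t < x -> f t = g t) -> prim a f x = prim a g x.
Proof.
move=> ax cf cg fg; apply/eqP; rewrite eq_le; apply/andP; split.
  have := Dv_le2 ax (prim_Dv a cf) (prim_Dv a cg) _; rewrite !prim0 !subr0; apply.
  by move=> t /fg ->.
have := Dv_le2 ax (prim_Dv a cg) (prim_Dv a cf) _; rewrite !prim0 !subr0; apply.
by move=> t /fg ->.
Qed.

Lemma le_prim a f g x : a <= x -> continuous f -> continuous g ->
  (forall t, a < t < x -> f t <= g t) -> prim a f x <= prim a g x.
Proof.
move=> ax cf cg fg.
by have := Dv_le2 ax (prim_Dv a cf) (prim_Dv a cg) fg; rewrite !prim0 !subr0.
Qed.

Lemma prim_ge0 a f x : a <= x -> continuous f ->
  (forall t, a < t < x -> 0 <= f t) -> 0 <= prim a f x.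
Proof.
by move=> ax cf f0; have := Dv_le ax (prim_Dv a cf) f0; rewrite prim0.
Qed.

Lemma cont_pos_near f x : continuous f -> 0 < f x ->
  exists2 e : R, 0 < e & forall y, `|y - x| < e -> 0 < f y.
Proof.
move=> cf fx; have /cvgrPdist_lt/(_ _ fx) := cf x.
move=> /nbhs_ballP[e /= e0 He]; exists e => // y yx.
have := He y; rewrite /ball/= distrC => /(_ yx); rewrite ltr_norml => /andP[_].
by lra.
Qed.

Lemma prim_gt0 a b f x : a <= x <= b -> a < b -> continuous f ->
  (forall t, a <= t <= b -> 0 <= f t) -> 0 < f x -> 0 < prim a f b.
Proof.
move=> /andP[ax xb] ab cf f0 fx.
have [e e0 He] := cont_pos_near cf fx.
pose l := Num.max a (x - e / 2); pose r := Num.min b (x + e / 2).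
have [al xl] : a <= l /\ x - e / 2 <= l by rewrite !le_max !lexx orbT.
have [rb rx] : r <= b /\ r <= x + e / 2 by rewrite !ge_min !lexx orbT.
have lr : l < r by rewrite gt_max !lt_min; apply/andP; split; apply/andP; split; lra.
have P := prim_Dv a cf.
have h1 : prim a f a <= prim a f l by apply: (Dv_le al P) => t ?; apply: f0; lra.
have h3 : prim a f r <= prim a f b by apply: (Dv_le rb P) => t ?; apply: f0; lra.
have [c clr E] := Dv_mvt lr P.
have fc : 0 < f c by clear h1 h3 E P; apply: He; rewrite ltr_norml; apply/andP; split; lra.
have : 0 < f c * (r - l) by rewrite mulr_gt0// subr_gt0.
rewrite -E; rewrite prim0 in h1.
by move: h1 h3; move: (prim a f l) (prim a f r) (prim a f b) => *; lra.
Qed.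

Lemma prim_eq0 a b f x : a < b -> continuous f ->
  (forall t, a <= t <= b -> 0 <= f t) -> prim a f b <= 0 -> a <= x <= b -> f x = 0.
Proof.
move=> ab cf f0 p0 xab; apply/eqP; rewrite eq_le f0// andbT leNgt.
by apply/negP => /(prim_gt0 xab ab cf f0); rewrite ltNge p0.
Qed.

Lemma prim_norm a f C x : a <= x -> continuous f ->
  (forall t, a < t < x -> `|f t| <= C) -> `|prim a f x| <= C * (x - a).
Proof.
move=> ax cf fC.
have dC : Dv (fun t => C * t) (fun=> C).
  by move=> y; apply: (der_eq (derM (derC C y) (derI y))); ring.
have dN : Dv (fun t => - (C * t)) (fun=> - C) by move=> y; apply: derN; exact: dC.
rewrite ler_norml; apply/andP; split.
  have := Dv_le2 ax dN (prim_Dv a cf) _; rewrite prim0 subr0 => H.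
  have /H: forall t, a < t < x -> - C <= f t by move=> t /fC; rewrite ler_norml => /andP[].
  by lra.
have := Dv_le2 ax (prim_Dv a cf) dC _; rewrite prim0 subr0 => H.
have /H: forall t, a < t < x -> f t <= C by move=> t /fC; rewrite ler_norml => /andP[].
by lra.
Qed.

Lemma cont_bounded f a b : continuous f ->
  exists2 C : R, 0 < C & forall x, a <= x <= b -> `|f x| <= C.
Proof.
move=> cf; case: (leP a b) => [ab|ba]; last first.
  by exists 1 => // x /andP[ax xb]; have := lt_le_trans ba (le_trans ax xb); rewrite ltxx.
have [c _ Hc] := EVT_max ab (ct_within (a := a) (b := b) (ctAbs cf)).
exists (`|f c| + 1); first by rewrite ltr_wpDl.
by move=> x xab; rewrite ler_wpDr// Hc// in_itv.
Qed.

End Primitive.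
Arguments prim_cont {R} a {f}.
Arguments prim_Dv {R} a {f}.

(** * Linear Volterra equations of the second order *)

Lemma half_powers_small {R : realType} (c e : R) : 0 < e -> exists n, c / 2 ^+ n < e.
Proof.
move=> e0.
have K2 : (c / 2 ^+ n) @[n --> \oo] --> (0 : R).
  rewrite -(mulr0 c); apply: cvgMr.
  rewrite (_ : (fun n => _) = (fun n => (2^-1) ^+ n)); last first.
    by apply/funext => n; rewrite exprVn.
  by apply: cvg_expr; rewrite ger0_norm// invf_lt1// ltr1n.
move/cvgrPdist_lt: K2 => /(_ _ e0)[N _ /(_ N (leqnn _))].
by rewrite sub0r normrN => HN; exists N; apply: le_lt_trans HN; exact: ler_norm.
Qed.

Section Volterra.
Context {R : realType}.
Variables (a b : R).
Hypothesis ab : a < b.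
Implicit Types (f g h V W : R -> R) (x y C D M : R).

(** Retraction onto [a, b]: coefficients composed with it are globally
    continuous, so that solutions are smooth across the end points. *)
Definition clamp x := Num.max a (Num.min x b).

Lemma clamp_id x : a <= x <= b -> clamp x = x.
Proof. by move=> /andP[ax xb]; rewrite /clamp (min_idPl xb) (max_idPr ax). Qed.

Lemma clamp_itv x : a <= clamp x <= b.
Proof. by rewrite /clamp le_max lexx/= ge_max (ltW ab) ge_min lexx orbT. Qed.

Lemma ct_clamp : continuous clamp.
Proof.
move=> x; apply: (@continuous_max _ _ (fun=> a) (fun x => Num.min x b)).
  exact: cvg_cst.
by apply: (@continuous_min _ _ (fun x => x) (fun=> b)); [exact: cvg_id|exact: cvg_cst].
Qed.

Lemma ct_clampC f : continuous f -> continuous (fun x => f (clamp x)).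
Proof. by move=> cf; apply: ctComp => //; exact: ct_clamp. Qed.

(** [S = f0 + volt V S] is the integrated form of [S'' = f0'' + V S]. *)
Definition volt V g x := prim a (prim a (fun t => V t * g (clamp t))) x.

Lemma ct_kernel V g : continuous V -> continuous g ->
  continuous (fun t => V t * g (clamp t)).
Proof. by move=> cV cg; apply: ctM => //; exact: ct_clampC. Qed.

Lemma ct_volt V g : continuous V -> continuous g -> continuous (volt V g).
Proof. by move=> cV cg; apply/prim_cont/prim_cont/ct_kernel. Qed.

Lemma voltB V f g x : continuous V -> continuous f -> continuous g ->
  volt V (fun t => f t - g t) x = volt V f x - volt V g x.
Proof.
move=> cV cf cg; rewrite /volt -primB; try exact/prim_cont/ct_kernel.
congr (prim _ _ _); apply/funext => t.
rewrite -primB; try exact: ct_kernel.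
by congr (prim _ _ _); apply/funext => s; rewrite mulrBr.
Qed.

Lemma voltD V f g x : continuous V -> continuous f -> continuous g ->
  volt V (fun t => f t + g t) x = volt V f x + volt V g x.
Proof.
move=> cV cf cg; rewrite /volt -primD; try exact/prim_cont/ct_kernel.
congr (prim _ _ _); apply/funext => t.
rewrite -primD; try exact: ct_kernel.
by congr (prim _ _ _); apply/funext => s; rewrite mulrDr.
Qed.

Lemma eq_volt V f g x : (forall y, a <= y <= b -> f y = g y) -> volt V f x = volt V g x.
Proof.
move=> fg; rewrite /volt.
have -> : (fun t => V t * f (clamp t)) = (fun t => V t * g (clamp t)).
  by apply/funext => t; rewrite fg// clamp_itv.
by [].
Qed.

Section Bounds.
Variables (V : R -> R) (M : R).
Hypotheses (cV : continuous V) (VM : forall x, a <= x <= b -> `|V x| <= M).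

(** Bielecki weight: integrating it twice gains the factor [(2 M + 1)^-2], which
    beats the size [M] of the coefficient. *)
Definition weight x := expR ((2 * M + 1) * (x - a)).

Let M0 : 0 <= M.
Proof. by apply: le_trans (VM (x := a) _) => //; rewrite lexx ltW. Qed.

Lemma der_weight x : is_derive x 1 weight ((2 * M + 1) * weight x).
Proof.
have D : is_derive x 1 (fun y : R => (2 * M + 1) * (y - a)) (2 * M + 1).
  apply: (der_eq (derM (derC _ x) (derD (derI x) (derN (derC a x))))); ring.
exact: derComp D (is_derive_expR _).
Qed.

Lemma weight_ge1 x : a <= x -> 1 <= weight x.
Proof.
move=> ax; rewrite -expR0 ler_expR mulr_ge0 ?subr_ge0//.
by rewrite addr_ge0// mulr_ge0.
Qed.

Lemma weight_le x : x <= b -> weight x <= weight b.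
Proof.
by move=> xb; rewrite ler_expR ler_wpM2l ?lerD2r// addr_ge0// mulr_ge0.
Qed.

Lemma prim_weight D h x : 0 <= D -> continuous h ->
  (forall t, a <= t <= b -> `|h t| <= D * weight t) -> a <= x <= b ->
  `|prim a h x| <= D / (2 * M + 1) * weight x.
Proof.
move=> D0 ch hD /andP[ax xb]; have l0 : 0 < 2 * M + 1 by rewrite ltr_wpDl// mulr_ge0.
set E := fun t => D / (2 * M + 1) * weight t.
have dE : Dv E (fun t => D * weight t).
  move=> t; apply: (der_eq (derM (derC _ t) (der_weight t))); field; lra.
have dN : Dv (fun t => - E t) (fun t => - (D * weight t)) by move=> t; exact: derN.
have E0 : 0 <= E a by rewrite /E mulr_ge0// ?divr_ge0 ?expR_ge0// ltW.
rewrite ler_norml; apply/andP; split.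
  have := Dv_le2 ax dN (prim_Dv a ch) _; rewrite prim0 subr0 => H.
  have /H: forall t, a < t < x -> - (D * weight t) <= h t.
    move=> t /andP[t1 t2]; have: `|h t| <= D * weight t by apply: hD; lra.
    by rewrite ler_norml => /andP[].
  by rewrite -/(E x); lra.
have := Dv_le2 ax (prim_Dv a ch) dE _; rewrite prim0 subr0 => H.
have /H: forall t, a < t < x -> h t <= D * weight t.
  move=> t /andP[t1 t2]; have: `|h t| <= D * weight t by apply: hD; lra.
  by rewrite ler_norml => /andP[].
by rewrite -/(E x); lra.
Qed.

Lemma volt_bound g C x : 0 <= C -> continuous g ->
  (forall t, a <= t <= b -> `|g t| <= C * weight t) -> a <= x <= b ->
  `|volt V g x| <= C / 2 * weight x.
Proof.
move=> C0 cg gC xab; have l0 : 0 < 2 * M + 1 by rewrite ltr_wpDl// mulr_ge0.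
apply: (@le_trans _ _ (M * C / (2 * M + 1) / (2 * M + 1) * weight x)).
  have MC : 0 <= M * C by exact: mulr_ge0.
  apply: prim_weight => //; last 1 first.
  - move=> t tab; apply: prim_weight => //; first exact: ct_kernel.
    move=> s sab; rewrite normrM clamp_id// -mulrA ler_pM//; first exact: VM.
    exact: gC.
  - by rewrite divr_ge0// ltW.
  - exact/prim_cont/ct_kernel.
rewrite ler_wpM2r ?expR_ge0// -mulrA -invfM ler_pdivrMr ?mulr_gt0// mulrAC ler_pdivlMr//.
nra.
Qed.

(** [volt] halves the weighted norm, so [1 - volt] is invertible with an
    inverse of norm at most 2. *)
Lemma volterra_bound W C x : continuous W ->
  (forall t, a <= t <= b -> `|W t - volt V W t| <= C) -> a <= x <= b ->
  `|W x| <= 2 * C * weight b.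
Proof.
move=> cW WC xab; pose q t := `|W t| / weight t.
have wt0 t : 0 < weight t by exact: expR_gt0.
have cw : continuous weight by move=> t; exact: der_cont (der_weight t).
have cq : continuous q.
  by apply: ctM; [exact: ctAbs|apply: ctV => // t; rewrite gt_eqF].
have [x0 + Hx0] := EVT_max (ltW ab) (ct_within (a := a) (b := b) cq).
rewrite in_itv/= => x0ab.
have q0 : 0 <= q x0 by rewrite /q divr_ge0// ltW.
have Wq t : a <= t <= b -> `|W t| <= q x0 * weight t.
  by move=> tab; rewrite -ler_pdivrMr//; apply: Hx0; rewrite in_itv.
have h1 := volt_bound q0 cW Wq x0ab.
have h2 := WC _ x0ab.
have e0 : `|W x0| = q x0 * weight x0 by rewrite /q divfK// gt_eqF.
have h3 : `|W x0| <= `|W x0 - volt V W x0| + `|volt V W x0|.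
  by rewrite -{1}(subrK (volt V W x0) (W x0)) ler_normD.
have w1 : 1 <= weight x0 by apply: weight_ge1; case/andP: x0ab.
have C0 : 0 <= C by exact: le_trans (normr_ge0 _) h2.
have q2 : q x0 <= 2 * C.
  rewrite -[X in X <= _]mulr1.
  have : q x0 / 2 * weight x0 <= C by rewrite e0 in h3; lra.
  have : 0 <= q x0 * (weight x0 - 1) by rewrite mulr_ge0// subr_ge0.
  lra.
apply: le_trans (Wq _ xab) _.
apply: (le_trans (ler_wpM2r (expR_ge0 _) q2)).
rewrite ler_wpM2l ?mulr_ge0//; apply: weight_le; by case/andP: xab.
Qed.

End Bounds.

(** The Neumann series converges geometrically, as [volt] halves the weighted
    norm. *)
Lemma volterra_solution V f0 : continuous V -> continuous f0 ->
  exists F, continuous F /\ forall x, F x = f0 x + volt V F x.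
Proof.
move=> cV cf.
have [M M0 VM] := cont_bounded a b cV; have [C C0 fC] := cont_bounded a b cf.
pose g := fix g n := if n is m.+1 then volt V (g m) else f0.
have cg n : continuous (g n) by elim: n => //= n IH; exact: ct_volt.
pose w := weight M; have w1 x : a <= x -> 1 <= w x by exact: (weight_ge1 VM).
have gb n x : a <= x <= b -> `|g n x| <= C / 2 ^+ n * w x.
  elim: n x => [|n IH] x xab.
    rewrite expr0 divr1; apply: (le_trans (fC x xab)).
    by rewrite ler_peMr ?(ltW C0)// w1//; case/andP: xab.
  have := @volt_bound V M cV VM (g n) (C / 2 ^+ n) x _ (cg n) IH xab.
  rewrite exprS invfM (mulrC 2^-1) !mulrA; apply.
  by rewrite divr_ge0 ?ltW// exprn_gt0.
pose K := C * w b; have K0 : 0 < K by rewrite mulr_gt0// expR_gt0.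
have z0 n : 0 <= 2 * K / 2 ^+ n.
  by rewrite divr_ge0 ?exprn_ge0// mulr_ge0 ?(ltW K0).
have gK n x : `|g n (clamp x)| <= K / 2 ^+ n.
  apply: le_trans (gb n _ (clamp_itv x)) _.
  rewrite /K mulrAC ler_wpM2r ?invr_ge0 ?exprn_ge0//.
  rewrite ler_wpM2l ?(ltW C0)//; apply: (weight_le VM); by case/andP: (clamp_itv x).
pose S n x := \sum_(k < n) g k x.
have cS n : continuous (S n) by exact: ct_sum.
have SS n x : S n.+1 x = S n x + g n x by rewrite /S big_ord_recr.
have S0 x : S 0%N x = 0 by rewrite /S big_ord0.
have gS n : g n.+1 = volt V (g n) by [].
have g0 : g 0%N = f0 by [].
clearbody S g.
have tail x n k : `|S (n + k)%N (clamp x) - S n (clamp x)| <= 2 * K / 2 ^+ n.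
  suff: `|S (n + k)%N (clamp x) - S n (clamp x)| <= 2 * K / 2 ^+ n * (1 - 1 / 2 ^+ k).
    move/le_trans; apply; rewrite -[leRHS]mulr1; apply: ler_wpM2l; first exact: z0.
    have : 0 <= 1 / 2 ^+ k :> R by rewrite divr_ge0 ?exprn_ge0.
    lra.
  elim: k => [|k IH]; first by rewrite addn0 subrr normr0 expr0 divr1 subrr mulr0.
  rewrite addnS SS addrAC; apply: le_trans (ler_normD _ _) _.
  apply: le_trans (lerD IH (gK _ _)) _.
  rewrite exprD exprS le_eqVlt; apply/orP; left; apply/eqP.
  by field; rewrite !expf_neq0.
have cvS x : cvgn (fun n => S n (clamp x)).
  apply/cauchy_cvgP/cauchy_exP => e e0.
  have [N HN] := half_powers_small (2 * K) e0.
  exists (S N (clamp x)); exists N => // m /= Nm.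
  rewrite /ball/= distrC -(subnKC Nm); apply: le_lt_trans (tail _ _ _) _.
  exact: HN.
pose G x := limn (fun n => S n (clamp x)).
have GS n x : `|G x - S n (clamp x)| <= 2 * K / 2 ^+ n.
  apply/ler_addgt0Pr => e e0; have /cvgrPdist_lt/(_ _ e0)[N _ HN] := cvS x.
  have {}HN := HN (n + N)%N (leq_addl _ _).
  have -> : G x - S n (clamp x) = (G x - S (n + N)%N (clamp x)) + (S (n + N)%N (clamp x) - S n (clamp x)) by ring.
  apply: le_trans (ler_normD _ _) _; rewrite addrC; apply: lerD (tail _ _ _) (ltW HN).
clearbody G.
have small (e : R) : 0 < e -> exists n, 2 * K / 2 ^+ n < e by exact: half_powers_small.
have cG : continuous G.
  move=> x; apply/cvgrPdist_lt => e e0.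
  have e3 : 0 < e / 3 by rewrite divr_gt0.
  have [n Hn] := small _ e3.
  have := @ct_clampC (S n) (cS n) x; move/cvgrPdist_lt => /(_ _ e3); apply: filterS => y Hy.
  have -> : G x - G y = (G x - S n (clamp x)) + (S n (clamp x) - S n (clamp y)) - (G y - S n (clamp y)) by ring.
  have := ler_normB (G x - S n (clamp x) + (S n (clamp x) - S n (clamp y))) (G y - S n (clamp y)).
  have := ler_normD (G x - S n (clamp x)) (S n (clamp x) - S n (clamp y)).
  have := GS n x; have := GS n y; lra.
exists (fun x => f0 x + volt V G x); split.
  by apply: ctD => //; exact: ct_volt.
suff H y : a <= y <= b -> f0 y + volt V G y = G y.
  by move=> x; rewrite (eq_volt V x H).
move=> yab; apply/eqP; rewrite -subr_eq0 -normr_le0; apply/ler_addgt0Pr => e e0.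
rewrite add0r.
have e2 : 0 < e / (1 + w b) by rewrite divr_gt0// ltr_wpDr// expR_ge0.
have [n Hn] := small _ e2.
have SE m x : S m.+1 x = f0 x + volt V (S m) x.
  elim: m x => [|m IH] x.
    rewrite SS S0 g0 add0r (@eq_volt V (S 0%N) (fun t => f0 t - f0 t)) => [|z _].
      by rewrite voltB// subrr addr0.
    by rewrite S0 subrr.
  rewrite SS IH gS (@eq_volt V (S m.+1) (fun t => S m t + g m t)) => [|z _]; last by rewrite SS.
  by rewrite voltD// -addrA.
have d1 : `|G y - S n.+1 y| <= 2 * K / 2 ^+ n.
  have := GS n.+1 y; rewrite clamp_id//; move/le_trans; apply.
  apply: ler_wpM2l; first by rewrite mulr_ge0// ltW.
  rewrite lef_pV2 ?posrE ?exprn_gt0//.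
  by rewrite exprS ler_peMl ?exprn_ge0// ler1n.
have d2 : `|volt V (fun t => G t - S n t) y| <= 2 * K / 2 ^+ n * w b.
  apply: le_trans (@volt_bound V M cV VM _ (2 * K / 2 ^+ n) y (z0 n) _ _ yab) _.
  - by apply: ctD => //; apply: ctN.
  - move=> t tab; have := GS n t; rewrite clamp_id// => /le_trans; apply.
    by rewrite ler_peMr// w1//; case/andP: tab.
  - have wy : w y <= w b by apply: (weight_le VM); case/andP: yab.
    apply: ler_pM => //; [by rewrite divr_ge0|exact: expR_ge0|].
    by rewrite ler_pdivrMr// ler_peMr// ler1n.
rewrite voltB// in d2.
have -> : f0 y + volt V G y - G y = (volt V G y - volt V (S n) y) - (G y - S n.+1 y).
  by rewrite SE; move: (f0 y) (volt V G y) (volt V (S n) y) (G y) => *; ring.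
apply: le_trans (ler_normB _ _) _.
apply: le_trans (lerD d2 d1) _.
move: Hn; rewrite ltr_pdivlMr ?mulrDr; last by rewrite ltr_wpDr// expR_ge0.
by lra.
Qed.

End Volterra.

(** * Induction along intervals and counting of zeros *)

Section RealLine.
Context {R : realType}.
Implicit Types (f g : R -> R) (a b x y t : R).

(** Induction along an interval: the least counterexample is excluded either
    by what holds before it or by what it propagates to its right. *)
Lemma real_induction a b (P : R -> Prop) :
  (forall t, a <= t <= b -> (forall s, a <= s < t -> P s) -> P t) ->
  (forall t, a <= t < b -> P t ->
     exists2 e : R, 0 < e & forall s, t < s < t + e -> s <= b -> P s) ->
  forall t, a <= t <= b -> P t.
Proof.
move=> Pl Pr t tab; apply: contrapT => nPt.
pose X := [set s | a <= s <= b /\ ~ P s].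
have Xt : X t by [].
have hX : has_inf X by split; [exists t|exists a => s [/andP[]]].
have Xlb s : X s -> inf X <= s by move=> Xs; apply: ge_inf => //; case: hX.
have t0a : a <= inf X by apply: lb_le_inf; [exists t|move=> s [/andP[]]].
have t0b : inf X <= b by apply: le_trans (Xlb _ Xt) _; case/andP: tab.
have Plt s : a <= s < inf X -> P s.
  move=> /andP[sa sX]; apply: contrapT => nPs.
  have /Xlb : X s by split=> //; rewrite sa (le_trans (ltW sX)).
  by rewrite leNgt sX.
have PX : P (inf X) by apply: Pl => //; rewrite t0a.
have Xb : inf X < b.
  rewrite lt_neqAle t0b andbT; apply/eqP => Xb; apply: nPt.
  have := Xlb _ Xt; rewrite Xb; case/andP: tab => _ tb bt.
  by rewrite (_ : t = inf X)// Xb; apply/eqP; rewrite eq_le tb.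
have [|e e0 He] := Pr (inf X) _ PX; first by rewrite t0a.
have [x [/andP[xa xb] nPx] xe] := inf_adherent e0 hX.
have Xx : X x by split=> //; rewrite xa.
apply: nPx; apply: He => //; rewrite xe andbT lt_neqAle Xlb// andbT.
by apply/eqP => E; case: Xx => _; rewrite -E.
Qed.

Lemma IVT_zero f x y : x < y -> continuous f -> f x * f y < 0 ->
  exists2 z, x < z < y & f z = 0.
Proof.
move=> xy cf fxy.
have [||z + fz0] := @IVT R f x y 0 (ltW xy).
- exact: ct_within.
- rewrite ge_min le_max; case: (ltgtP (f x) 0) fxy => [fx|fx|->]; last by rewrite mul0r ltxx.
    by rewrite nmulr_rlt0// => /ltW ->; rewrite orbT.
  by rewrite pmulr_rlt0// => /ltW ->; rewrite orbT.
rewrite in_itv/= => /andP[xz zy]; exists z => //.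
rewrite !lt_neqAle xz zy !andbT; apply/andP; split; apply/eqP => E; move: fxy.
  by rewrite E fz0 mul0r ltxx.
by rewrite -E fz0 mulr0 ltxx.
Qed.

Lemma deriv_sign (f f1 : R -> R) z (e : R) : Dv f f1 -> continuous f1 ->
  f z = 0 -> f1 z != 0 -> 0 < e ->
  exists2 h : R, 0 < h < e & 0 < f (z + h) * f1 z /\ f (z - h) * f1 z < 0.
Proof.
move=> df cf1 fz f1z e0.
have p0 : 0 < f1 z * f1 z by rewrite -expr2 exprn_even_gt0.
have [d d0 Hd] := cont_pos_near (ctM cf1 (ctC (f1 z))) p0.
pose h := Num.min (e / 2) (d / 2).
have [he hd] : h <= e / 2 /\ h <= d / 2 by rewrite !ge_min !lexx orbT.
have h0 : 0 < h by rewrite lt_min !divr_gt0.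
exists h; first by lra.
have zh : z < z + h by lra.
have hz : z - h < z by lra.
split.
  have [x zx] := Dv_mvt zh df; rewrite fz subr0 => ->.
  rewrite mulrAC mulr_gt0//; last lra.
  by apply: Hd; rewrite ltr_norml; lra.
have [x zx] := Dv_mvt hz df; rewrite fz sub0r => E.
have {E}-> : f (z - h) = - (f1 x * (z - (z - h))) by lra.
rewrite mulNr oppr_lt0 mulrAC mulr_gt0//; last lra.
by apply: Hd; rewrite ltr_norml; lra.
Qed.

Lemma finite_bounded_lists (A : set R) n :
  (forall s : seq R, uniq s -> (forall x, x \in s -> A x) -> (size s <= n)%N) ->
  finite_set A.
Proof.
move=> H; apply: contrapT => /(@infinite_set_fset _ _ n.+1)[B BA nB].
have := H (finmap.enum_fset B) (finmap.fset_uniq B) BA.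
by rewrite leqNgt nB.
Qed.

Lemma finite_set_gap (A : set R) t : finite_set A ->
  exists2 e : R, 0 < e & forall x, A x -> x != t -> e <= `|x - t|.
Proof.
move=> /finite_seqP[s ->]; elim: s => [|y s [e e0 He]]; first by exists 1.
case: (eqVneq y t) => [yt|yt].
  exists e => // x /=; rewrite inE => /orP[/eqP->|]; last exact: He.
  by rewrite yt eqxx.
exists (Num.min e `|y - t|); first by rewrite lt_min e0 normr_gt0 subr_eq0.
move=> x /=; rewrite inE => /orP[/eqP-> _|xs xt]; first by rewrite ge_min lexx orbT.
by rewrite ge_min He.
Qed.

Lemma nbhs_dist (P : R -> Prop) t : (\forall x \near t, P x) ->
  exists2 e : R, 0 < e & forall x, `|x - t| < e -> P x.
Proof.
move=> /nbhs_ballP[e /= e0 He]; exists e => // x xt.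
by apply: He; rewrite /ball/= distrC.
Qed.

Lemma near_dist (P : R -> Prop) t (e : R) : 0 < e ->
  (forall x, `|x - t| < e -> P x) -> \forall x \near t, P x.
Proof.
move=> e0 He; apply/nbhs_ballP; exists e => //= x; rewrite /ball/= distrC; exact: He.
Qed.

Lemma punctured_point (a b p e : R) : a < b -> a <= p <= b -> 0 < e ->
  exists x, [/\ a <= x <= b, x - p != 0 & `|x - p| < e].
Proof.
move=> ab pab e0; have [ap pb] := andP pab; case: (ltP p b) => pb'.
  pose d := Num.min (e / 2) (b - p).
  have [d1 d2] : d <= e / 2 /\ d <= b - p by rewrite !ge_min !lexx orbT.
  have d0 : 0 < d by rewrite lt_min; lra.
  exists (p + d); rewrite addrC addrK gtr0_norm// gt_eqF//; split=> //; lra.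
pose d := Num.min (e / 2) (p - a).
have [d1 d2] : d <= e / 2 /\ d <= p - a by rewrite !ge_min !lexx orbT.
have d0 : 0 < d by rewrite lt_min; lra.
exists (p - d); rewrite (_ : p - d - p = - d); last by ring.
rewrite normrN gtr0_norm// oppr_eq0 gt_eqF//; split=> //; lra.
Qed.

(** Lists of distinct zeros, used to count zeros without assuming that there are
    finitely many of them. *)
Definition zeros f (i : interval R) (s : seq R) :=
  uniq s /\ forall z, z \in s -> z \in i /\ f z = 0.

Definition zeros_ge f i n := exists2 s, zeros f i s & (n <= size s)%N.
Definition zeros_le f i n := forall s, zeros f i s -> (size s <= n)%N.

Lemma zeros_sub f (i j : interval R) s : {subset i <= j} -> zeros f i s -> zeros f j s.
Proof. by move=> ij [us zs]; split=> // z /zs[/ij]. Qed.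

Lemma zeros_filter f (i j : interval R) s (p : pred R) : zeros f i s ->
  (forall z, z \in i -> p z -> z \in j) -> zeros f j [seq z <- s | p z].
Proof.
move=> [us zs] ij; split; first exact: filter_uniq.
by move=> z; rewrite mem_filter => /andP[pz /zs[zi fz]]; split=> //; exact: ij.
Qed.

Lemma zeros_split f (i j k : interval R) m n (p : pred R) :
  (forall z, z \in i -> p z -> z \in j) -> (forall z, z \in i -> ~~ p z -> z \in k) ->
  zeros_le f j m -> zeros_le f k n -> zeros_le f i (m + n).
Proof.
move=> ij ik fm fn s zs; rewrite -(count_predC p s) -!size_filter.
by apply: leq_add; [apply: fm; exact: zeros_filter zs ij|apply: fn; exact: zeros_filter zs ik].
Qed.

Lemma zeros_ge_le f i m n : zeros_ge f i m -> zeros_le f i n -> (m <= n)%N.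
Proof. by move=> [s zs ms] /(_ s zs); exact: leq_trans. Qed.

Lemma zeros_ge_sub f (i j : interval R) n : {subset i <= j} -> zeros_ge f i n -> zeros_ge f j n.
Proof. by move=> ij [s zs sn]; exists s => //; exact: zeros_sub zs. Qed.

Lemma zeros_le_sub f (i j : interval R) n : {subset i <= j} -> zeros_le f j n -> zeros_le f i n.
Proof. by move=> ij H s /(zeros_sub ij); exact: H. Qed.

Lemma zeros_ge_cons f (i j : interval R) n x : {subset j <= i} -> zeros_ge f j n ->
  x \in i -> x \notin j -> f x = 0 -> zeros_ge f i n.+1.
Proof.
move=> ji [s [us zs] sn] xi xj fx; exists (x :: s) => //=.
split=> /=.
  by rewrite us andbT; apply/negP => /zs[xj' _]; rewrite xj' in xj.
by move=> z; rewrite inE => /orP[/eqP->//|/zs[/ji]].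
Qed.

End RealLine.

(** * Families of solutions: zeros and eigenvalues *)

(** Outside of the finite set [Em] the counting function [N] is nonincreasing,
    and it drops at each point of [E]; it is bounded on each gap of [Em], even near
    the left end of the gap, so each gap contains finitely many points of [E]. *)
Lemma finite_of_drops (R : realType) (m c0 : R) (N : R -> nat) (E Em : set R) :
  finite_set Em -> (forall c, E c -> c0 < c < m) ->
  (forall c, c < m -> \forall c' \near c, (N c <= N c')%N) ->
  (forall c, c < m -> \forall c' \near c, (N c' <= (N c).+1)%N) ->
  (forall c, c < m -> ~ E c -> \forall c' \near c, (N c' <= N c)%N) ->
  (forall c, E c -> ~ Em c -> \forall c' \near c, c' < c -> (N c < N c')%N) ->
  (forall c, E c -> ~ Em c -> \forall c' \near c, c < c' -> (N c' <= N c)%N) ->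
  finite_set E.
Proof.
move=> fEm base lower upper stay left right.
have mono p q : q <= m -> (forall c, p < c < q -> ~ Em c) ->
    forall x y, p < x -> x <= y -> y < q -> (N y <= N x)%N.
  move=> qm gap x y px xy yq.
  have near_mono t : p < t < q -> exists2 e : R, 0 < e & forall s, `|s - t| < e ->
      (s < t -> (N t <= N s)%N) /\ (t < s -> (N s <= N t)%N).
    move=> ptq; have tm : t < m by lra.
    have nE := gap _ ptq; apply: nbhs_dist.
    have [Et|nEt] := pselect (E t).
      by apply: filterS2 (lower _ tm) (right _ Et nE) => s Hs Hs'; split.
    by apply: filterS2 (lower _ tm) (stay _ tm nEt) => s Hs Hs'; split.
  suff: forall t, x <= t <= y -> (N t <= N x)%N by apply; rewrite xy lexx.
  apply: real_induction => [t xty IH|t xty Nt].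
    case: (eqVneq t x) => [->//|tx].
    have {}tx : x < t by rewrite lt_neqAle eq_sym tx; case/andP: xty.
    have [|e e0 He] := near_mono t; first lra.
    pose s := Num.max x (t - e / 2).
    have [xs ts] : x <= s /\ t - e / 2 <= s by rewrite !le_max !lexx orbT.
    have st : s < t by rewrite gt_max tx/=; lra.
    have [|H _] := He s; first by rewrite ltr_norml; lra.
    by apply: leq_trans (H st) _; apply: IH; rewrite xs.
  have [|e e0 He] := near_mono t; first lra.
  exists e => // s tse sy; have [|_ H] := He s; first by rewrite ltr_norml; lra.
  by apply: leq_trans Nt; apply: H; case/andP: tse.
have drop p q : q <= m -> (forall c, p < c < q -> ~ Em c) ->
    forall x y, p < x -> x < y -> y < q -> E y -> (N y < N x)%N.
  move=> qm gap x y px xy yq Ey.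
  have [|e e0 He] := nbhs_dist (left _ Ey (gap _ _)); first lra.
  pose s := Num.max ((x + y) / 2) (y - e / 2).
  have [xs ts] : (x + y) / 2 <= s /\ y - e / 2 <= s by rewrite !le_max !lexx orbT.
  have st : s < y by rewrite gt_max; lra.
  apply: leq_trans (mono _ _ qm gap x s _ _ _); [|lra..].
  by apply: He => //; rewrite ltr_norml; lra.
have gap_finite p q : p < q -> q <= m -> (forall c, p < c < q -> ~ Em c) ->
    finite_set (E `&` [set c | p < c < q]).
  move=> pq qm gap.
  have [K HK] : exists K, forall x, p < x < q -> (N x <= K)%N.
    have pm : p < m by exact: lt_le_trans qm.
    have [e e0 He] := nbhs_dist (upper _ pm).
    exists (N p).+1 => x /andP[px xq].
    pose s := Num.min ((x + p) / 2) (p + e / 2).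
    have [xs ts] : s <= (x + p) / 2 /\ s <= p + e / 2 by rewrite !ge_min !lexx orbT.
    have st : p < s by rewrite lt_min; lra.
    apply: leq_trans (mono _ _ qm gap s x _ _ _) _; [lra..|].
    by apply: He; rewrite ltr_norml; lra.
  apply: (@finite_bounded_lists _ _ K.+1) => s us Hs.
  rewrite -(size_map N) -(size_iota 0 K.+1); apply: uniq_leq_size.
    rewrite map_inj_in_uniq// => x y /Hs[Ex /andP[px xq]] /Hs[Ey /andP[py yq]] Nxy.
    case: (ltgtP x y) => // [xy|yx].
      by have := drop _ _ qm gap x y px xy yq Ey; rewrite Nxy ltnn.
    by have := drop _ _ qm gap y x py yx xq Ex; rewrite Nxy ltnn.
  move=> k /mapP[x /Hs[_ pxq] ->]; rewrite mem_iota add0n ltnS; exact: HK.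
case: (leP m c0) => [mc0|c0m].
  rewrite (_ : E = set0)//; apply/seteqP; split=> // c /base; lra.
suff: forall t, c0 <= t <= m -> finite_set (E `&` [set c | c < t]).
  move=> /(_ m); rewrite lexx ltW//= => /(_ isT); apply: sub_finite_set => c Ec.
  by split=> //; case/andP: (base c Ec).
apply: real_induction => [t c0tm IH|t c0tm ft].
  have [e e0 He] := finite_set_gap t fEm.
  case: (eqVneq t c0) => [->|tc0].
    rewrite (_ : E `&` _ = set0)//; apply/seteqP; split=> // c [/base/andP[c0c _]/=]; lra.
  have {}tc0 : c0 < t by rewrite lt_neqAle eq_sym tc0; case/andP: c0tm.
  pose s := Num.max c0 (t - e / 2).
  have [xs ts] : c0 <= s /\ t - e / 2 <= s by rewrite !le_max !lexx orbT.
  have st : s < t by rewrite gt_max tc0/=; lra.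
  have tm : t <= m by case/andP: c0tm.
  have g1 : finite_set (E `&` [set c | s < c < t]).
    apply: gap_finite => // c sct Ec.
    have := He c Ec; rewrite lt_eqF; last by case/andP: sct.
    by move=> /(_ isT); rewrite ltr0_norm; lra.
  have g2 : finite_set (E `&` [set c | c < s]) by apply: IH; rewrite xs.
  apply: sub_finite_set (_ : finite_set ((E `&` [set c | c < s]) `|` [set s] `|` (E `&` [set c | s < c < t]))).
    move=> c [Ec /= ct]; case: (ltgtP c s) => [cs|sc|->].
    - by left; left.
    - by right; split=> //=; rewrite sc.
    - by left; right.
  by rewrite !finite_setU; split=> //; split=> //; exact: finite_set1.
have [e e0 He] := finite_set_gap t fEm.
pose s := Num.min m (t + e).
have [xs ts] : s <= m /\ s <= t + e by rewrite !ge_min !lexx orbT.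
have st : t < s by rewrite lt_min; lra.
have g1 : finite_set (E `&` [set c | t < c < s]).
  apply: gap_finite => // c sct Ec.
  have := He c Ec; rewrite gt_eqF; last by case/andP: sct.
  by move=> /(_ isT); rewrite gtr0_norm; lra.
exists e => // r tre rm.
apply: sub_finite_set (_ : finite_set ((E `&` [set c | c < t]) `|` [set t] `|` (E `&` [set c | t < c < s]))).
  move=> c [Ec /= ct]; case: (ltgtP c t) => [cs|sc|->].
  - by left; left.
  - have tcs : t < c < s by have /andP[_ cm] := base c Ec; apply/andP; split; rewrite // lt_min cm/=; lra.
    by right; split=> //; case/andP: tcs => _ ->.
  - by left; right.
by rewrite !finite_setU; split=> //; split=> //; exact: finite_set1.
Qed.

Section ShootingFamily.
Context {R : realType}.
Variables (a b B m : R) (S S1 : R -> R -> R).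
Hypotheses (ab : a < b) (bB : b < B).
Hypothesis dS : forall c, Dv (S c) (S1 c).
Hypothesis cS1 : forall c, continuous (S1 c).
Hypothesis Sa : forall c, c < m -> S c a = 0.
Hypothesis simple_zeros : forall c x, c < m -> a <= x <= B -> S c x = 0 -> S1 c x != 0.
Hypothesis depends_cont : forall c (e : R), c < m -> 0 < e ->
  \forall c' \near c, forall x, a <= x <= B ->
    `|S c' x - S c x| < e /\ `|S1 c' x - S1 c x| < e.

Let cS c : continuous (S c).
Proof. exact: Dv_cont (dS c). Qed.

Lemma sign_stable c x : c < m -> a <= x <= B -> S c x != 0 ->
  \forall c' \near c, 0 < S c' x * S c x.
Proof.
move=> cm xB Sx; have e0 : 0 < `|S c x| by rewrite normr_gt0.
apply: filterS (depends_cont cm e0) => c' /(_ x xB)[+ _].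
rewrite ltr_norml; case: (ltP 0 (S c x)) => [p|n].
  by rewrite ger0_norm ?ltW// => H; rewrite mulr_gt0//; lra.
have {}n : S c x < 0 by rewrite lt_neqAle Sx.
by rewrite ltr0_norm// => H; rewrite nmulr_lgt0//; lra.
Qed.

(** Near a zero of [S c] the derivative keeps its sign under small changes of
    [c], and Rolle's theorem excludes two zeros; elsewhere [S c] keeps its sign. *)
Lemma local_zeros c p : c < m -> a <= p <= b ->
  exists2 d : R, 0 < d & p + d <= B /\
    \forall c' \near c, zeros_le (S c') `[Num.max a (p - d), p + d] (S c p == 0).
Proof.
have ab' := ab; have bB' := bB.
move=> cm pab.
have key (g : R -> R) : continuous g -> g p != 0 ->
    exists2 d : R, 0 < d & p + d <= B /\
      forall x, x \in `[Num.max a (p - d), p + d] -> a <= x <= B /\ `|g p| / 2 <= `|g x|.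
  move=> cg gp; have e0 : 0 < `|g p| / 2 by rewrite divr_gt0 ?normr_gt0.
  have /cvgrPdist_lt/(_ _ e0) := cg p; move/nbhs_dist => [d d0 Hd].
  pose d' := Num.min (d / 2) (B - p).
  have [d1 d2] : d' <= d / 2 /\ d' <= B - p by rewrite !ge_min !lexx orbT.
  have d'0 : 0 < d'.
    have pB : 0 < B - p by lra.
    by rewrite lt_min divr_gt0.
  exists d' => //; split; first lra.
  move=> x; rewrite in_itv/= ge_max => /andP[/andP[x1 x2] x3]; split; first lra.
  have := Hd x; rewrite ltr_norml => H.
  have {}H : `|g p - g x| < `|g p| / 2 by apply: H; lra.
  have := ler_normD (g p - g x) (g x); rewrite subrK; lra.
case: (eqVneq (S c p) 0) => [Sp|Sp].
  have S1p : S1 c p != 0 by apply: simple_zeros => //; lra.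
  have [d d0 [dB Hd]] := key _ (@cS1 c) S1p.
  exists d => //; split=> //.
  have e0 : 0 < `|S1 c p| / 2 by rewrite divr_gt0 ?normr_gt0.
  apply: filterS (depends_cont cm e0) => c' Hc' s [us zs].
  case: s us zs => [//|x [//|y s]] us zs.
  have [xi Sx] := zs x (mem_head _ _).
  have [yi Sy] : y \in `[Num.max a (p - d), p + d] /\ S c' y = 0.
    by apply: zs; rewrite !inE eqxx orbT.
  have xy : x != y by move: us => /= /andP[+ _]; rewrite inE negb_or => /andP[].
  exfalso; wlog : x y xi yi Sx Sy xy {us zs} / x < y.
    by move=> H; move: (xy); rewrite neq_lt => /orP[/H|/H]; apply=> //; rewrite eq_sym.
  move=> lxy; have [z xzy] := Dv_mvt lxy (dS c').
  rewrite Sx Sy subrr => /esym/eqP; rewrite mulf_eq0 (gt_eqF (x := y - x)) ?subr_gt0// orbF => /eqP S1z.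
  have zi : z \in `[Num.max a (p - d), p + d].
    by move: xi yi; rewrite !in_itv/= => /andP[? ?] /andP[? ?]; lra.
  have [zB Hz] := Hd _ zi; have [_] := Hc' z zB.
  by rewrite S1z sub0r normrN; lra.
have [d d0 [dB Hd]] := key _ (@cS c) Sp.
exists d => //; split=> //.
have e0 : 0 < `|S c p| / 2 by rewrite divr_gt0 ?normr_gt0.
apply: filterS (depends_cont cm e0) => c' Hc' s [us zs].
case: s us zs => [//|x s] us zs; exfalso.
have [xi Sx] := zs x (mem_head _ _).
have [xB Hx] := Hd _ xi; have [+ _] := Hc' x xB.
by rewrite Sx sub0r normrN; lra.
Qed.

(** The local bounds add up by induction along the interval; [b] is
    overstepped in order to control zeros that enter or leave through it. *)
Lemma zeros_upper_semicont c : c < m ->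
  exists n (e : R), [/\ 0 < e, b + e <= B, zeros_ge (S c) `]a, b] n &
    \forall c' \near c, zeros_le (S c') `]a, b + e] n].
Proof.
have ab' := ab; have bB' := bB.
move=> cm.
suff: forall t, a <= t <= b -> exists n (e : R), [/\ 0 < e, t + e <= B,
    zeros_ge (S c) `]a, t] n & \forall c' \near c, zeros_le (S c') `]a, t + e] n].
  by apply; rewrite ltW//=.
apply: real_induction => [t tab IH|t tab [n [e [e0 eB zn zc]]]]; last first.
  exists e => // s tse sb; exists n, (t + e - s).
  have E : s + (t + e - s) = t + e by ring.
  split; rewrite ?E//; first by lra.
  by apply: zeros_ge_sub zn => x; rewrite !in_itv/=; lra.
have [d d0 [dB Hd]] := local_zeros cm tab.
case: (eqVneq t a) => [ta|ta].
  exists 0%N, d; split=> //; first by exists [::].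
  have nm : \forall c' \near c, c' < m by apply: lt_nbhsl.
  apply: filterS2 Hd nm => c' Hc' c'm s [us zs].
  have := Hc' (a :: s); rewrite ta Sa// eqxx/= => H.
  suff: ((size s).+1 <= 1)%N by [].
  apply: H; split=> /=.
    by rewrite us andbT; apply/negP => /zs[]; rewrite in_itv/= ltxx.
  move=> z; rewrite inE => /orP[/eqP->|/zs[]].
    rewrite Sa//; split=> //; rewrite in_itv/= ge_max lexx/=; lra.
  by rewrite !in_itv/= ge_max -ta => zi ->; split=> //; lra.
pose s := Num.max a (t - d / 2).
have [as_ ts] : a <= s /\ t - d / 2 <= s by rewrite !le_max !lexx orbT.
have at_ : a < t by rewrite lt_neqAle eq_sym ta; case/andP: tab.
have st : s < t by rewrite gt_max at_/=; lra.
have [|n [e [e0 eB zn zc]]] := IH s; first by rewrite as_.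
exists (n + (S c t == 0%R))%N, d; split=> //.
  case: eqP => [St|_]; last first.
    by rewrite addn0; apply: zeros_ge_sub zn => x; rewrite !in_itv/=; lra.
  rewrite addn1; apply: zeros_ge_cons zn _ _ St.
  - by move=> x; rewrite !in_itv/=; lra.
  - by rewrite in_itv/= at_ lexx.
  - by rewrite in_itv/= at_/= -ltNge.
apply: filterS2 zc Hd => c' H1 H2.
apply: (zeros_split (p := fun z => z <= s)) H1 H2 => z; rewrite !in_itv/=.
  by move=> zi zs; lra.
by rewrite -ltNge ge_max => zi zs; lra.
Qed.

Lemma seq_max_elt (s : seq R) : s != [::] ->
  exists2 z, z \in s & forall w, w \in s -> w <= z.
Proof.
elim: s => // x [|y s] IH _.
  by exists x => [|w]; rewrite inE// => /eqP->.
have [//|z zs Hz] := IH; case: (leP x z) => xz.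
  exists z; first by rewrite inE zs orbT.
  by move=> w; rewrite inE => /orP[/eqP->//|/Hz].
exists x; first exact: mem_head.
by move=> w; rewrite inE => /orP[/eqP->//|/Hz/le_trans]; apply; exact: ltW.
Qed.

(** Simple zeros are sign changes, which persist. *)
Lemma zeros_lower_semicont c t n : c < m -> t <= B -> zeros_ge (S c) `]a, t[ n ->
  \forall c' \near c, zeros_ge (S c') `]a, t[ n.
Proof.
have ab' := ab; have bB' := bB.
move=> cm; elim: n t => [|n IH] t tB zn.
  by near=> c'; exists [::].
have [s [us zs] sn] := zn.
have [|z zin Hz] := @seq_max_elt s; first by case: (s) sn.
have [zt Sz] := zs z zin; move: zt; rewrite in_itv/= => /andP[az zt].
have [e0 e00 He0] := @finite_set_gap _ [set` s] z (finite_seq s).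
pose e := Num.min e0 (Num.min (z - a) (t - z)).
have [ee0 [ea et]] : e <= e0 /\ e <= z - a /\ e <= t - z.
  by rewrite !ge_min !lexx !orbT.
have e_gt0 : 0 < e by rewrite !lt_min e00/=; lra.
have S1z : S1 c z != 0 by apply: simple_zeros => //; lra.
have e2 : 0 < e / 2 by rewrite divr_gt0.
have [h he [hp hn]] := deriv_sign (dS c) (@cS1 c) Sz S1z e2.
have zn' : zeros_ge (S c) `]a, z - e / 2[ n.
  exists (rem z s); last by rewrite size_rem// -ltnS; case: (s) zin sn.
  split; first exact: rem_uniq.
  move=> w; rewrite mem_rem_uniq// inE => /andP[wz ws].
  have [wi Sw] := zs _ ws; split=> //; move: wi; rewrite !in_itv/= => /andP[-> _]/=.
  have := He0 w ws wz; rewrite ler0_norm; last by rewrite subr_le0 Hz.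
  lra.
have IH' : \forall c' \near c, zeros_ge (S c') `]a, z - e / 2[ n by apply: IH => //; lra.
have p1 : S c (z + h) != 0 by apply/eqP => E; rewrite E mul0r ltxx in hp.
have p2 : S c (z - h) != 0 by apply/eqP => E; rewrite E mul0r ltxx in hn.
have s1 : \forall c' \near c, 0 < S c' (z + h) * S c (z + h).
  by apply: sign_stable => //; lra.
have s2 : \forall c' \near c, 0 < S c' (z - h) * S c (z - h).
  by apply: sign_stable => //; lra.
apply: filterS3 IH' s1 s2 => c' zc' s1' s2'.
have neg : S c' (z - h) * S c' (z + h) < 0.
  have q1 : S c (z - h) * S c (z + h) < 0.
    have q : (S c (z - h) * S1 c z) * (S c (z + h) * S1 c z) < 0 by rewrite nmulr_rlt0.
    have := mulrACA (S c (z - h)) (S1 c z) (S c (z + h)) (S1 c z).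
    move=> E; rewrite E in q; rewrite pmulr_llt0// in q.
    by rewrite -expr2 exprn_even_gt0.
  have q2 : 0 < (S c' (z - h) * S c (z - h)) * (S c' (z + h) * S c (z + h)) by rewrite mulr_gt0.
  by rewrite mulrACA in q2; rewrite nmulr_lgt0 in q2.
have hlt : z - h < z + h by lra.
have [w zw Sw] := IVT_zero hlt (@cS c') neg.
apply: zeros_ge_cons zc' _ _ Sw => [x||]; rewrite !in_itv/=; lra.
Unshelve. all: by end_near. Qed.

(** The infimum of the parameters with at least [k] zeros is an eigenvalue whose
    solution has exactly [k - 1] interior zeros, so different [k] give different
    eigenvalues. *)
Lemma eigenvalues_from_zeros c0 c1 n : c0 < m ->
  (forall c, c <= c1 -> zeros_le (S c) `]a, b] 0) ->
  zeros_ge (S c0) `]a, b[ n ->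
  exists s : seq R, [/\ uniq s, size s = n & forall c, c \in s -> c <= c0 /\ S c b = 0].
Proof.
have ab' := ab; have bB' := bB.
move=> c0m Hc1 zn.
have oc : {subset `]a, b[ <= `]a, b]} by move=> x; rewrite !in_itv/=; lra.
have key k : (0 < k <= n)%N -> exists c, [/\ c <= c0, S c b = 0,
    zeros_ge (S c) `]a, b[ k.-1 & ~ zeros_ge (S c) `]a, b[ k].
  move=> /andP[k0 kn]; pose A := [set c | c <= c0 /\ zeros_ge (S c) `]a, b[ k].
  have Ac0 : A c0 by split=> //; case: zn => s zs sn; exists s => //; exact: leq_trans sn.
  have Alb x : A x -> c1 <= x.
    move=> [_ [s zs ks]]; rewrite leNgt; apply/negP => /ltW/Hc1/(_ s (zeros_sub oc zs)).
    by rewrite leqNgt (leq_trans k0 ks).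
  have hA : has_inf A by split; [exists c0|exists c1].
  have ic0 : inf A <= c0 by apply: ge_inf => //; case: hA.
  have im : inf A < m by exact: le_lt_trans c0m.
  have nk : ~ zeros_ge (S (inf A)) `]a, b[ k.
    move=> /(zeros_lower_semicont im (ltW bB)) /nbhs_dist[e e0 He].
    have : A (inf A - e / 2).
      split; first lra.
      by apply: He; rewrite ltr_norml; lra.
    have [_ lA] := hA.
    by move=> /(ge_inf lA); lra.
  have [j [e [e0 eB zj]]] := zeros_upper_semicont im.
  move=> /nbhs_dist[d d0 Hd].
  have [x [xc0 zx] xd] := inf_adherent d0 hA.
  have [_ lA] := hA.
  have xA : inf A <= x by apply: ge_inf.
  have kj : (k <= j)%N.
    apply: zeros_ge_le (Hd x _); last by rewrite ltr_norml; lra.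
    by apply: zeros_ge_sub zx => y; rewrite !in_itv/=; lra.
  have [s [us zs] js] := zj.
  have bs : b \in s.
    apply: contra_notT nk => bs; exists s; last exact: leq_trans js.
    split=> // z zs'; have [zi Sz] := zs z zs'; split=> //.
    move: zi; rewrite !in_itv/= => /andP[-> zb]; rewrite lt_neqAle zb andbT.
    by apply/eqP => zb'; rewrite -zb' zs' in bs.
  exists (inf A); split=> //; first by have [] := zs b bs.
  exists (rem b s); last first.
    by rewrite size_rem// -ltnS prednK// (leq_trans kj)// (leq_trans js)// leqSpred.
  split; first exact: rem_uniq.
  move=> z; rewrite mem_rem_uniq// inE => /andP[zb /zs[zi Sz]]; split=> //.
  by move: zi; rewrite !in_itv/= => /andP[-> zb']; rewrite lt_neqAle zb.
elim: n key {zn} => [_|n IH key]; first by exists [::].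
have key' k : (0 < k <= n)%N -> exists c, [/\ c <= c0, S c b = 0,
    zeros_ge (S c) `]a, b[ k.-1 & ~ zeros_ge (S c) `]a, b[ k].
  by move=> /andP[k0 kn]; apply: key; rewrite k0 leqW.
suff [s [us sn Hs]] : exists s : seq R, [/\ uniq s, size s = n &
    forall c, c \in s -> [/\ c <= c0, S c b = 0 & ~ zeros_ge (S c) `]a, b[ n]].
  have [c [cc0 Sc zc nc]] := key n.+1 (leqnn _); exists (c :: s); split=> /=.
  - by rewrite us andbT; apply/negP => /Hs[].
  - by rewrite sn.
  - by move=> x; rewrite inE => /orP[/eqP->//|/Hs[]].
elim: n key' {IH key} => [_|n IH key]; first by exists [::].
have [k /andP[k0 kn]|s [us sn Hs]] := IH; first by apply: key; rewrite k0 leqW.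
have [c [cc0 Sc zc nc]] := key n.+1 (leqnn _); exists (c :: s); split=> /=.
- by rewrite us andbT; apply/negP => /Hs[].
- by rewrite sn.
- move=> x; rewrite inE => /orP[/eqP->//|/Hs[xc Sx nx]]; split=> //.
  by move=> [l zl nl]; apply: nx; exists l => //; exact: ltnW.
Qed.


Lemma zeros_exact c : c < m ->
  exists n, zeros_ge (S c) `]a, b[ n /\ zeros_le (S c) `]a, b[ n.
Proof.
have ab' := ab; have bB' := bB.
move=> cm; have [n [e [e0 eB zn /nbhs_singleton zc]]] := zeros_upper_semicont cm.
have oc : {subset `]a, b[ <= `]a, b + e]} by move=> x; rewrite !in_itv/=; lra.
have {}zc := zeros_le_sub oc zc.
have [k kP kmax] := @ex_maxnP (fun k => `[< zeros_ge (S c) `]a, b[ k >]) n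
  (ex_intro _ 0%N (asboolT (ex_intro2 _ _ [::] (conj isT (fun _ => (fun H => match notF H with end))) isT)))
  (fun k => fun H => zeros_ge_le (asboolW H) zc).
exists k; split; first exact: asboolW.
by move=> s zs; apply: kmax; apply/asboolP; exists s.
Qed.

(** Under the sign condition on [S c' b], as [c] increases past an eigenvalue
    outside of [Em] the zero at [b] leaves the interval, while the number of
    interior zeros is locally constant elsewhere. *)
Lemma eigenvalues_finite c0 (Em : set R) : finite_set Em ->
  (forall c, c <= c0 -> zeros_le (S c) `]a, b] 0) ->
  (forall c, c < m -> S c b = 0 -> ~ Em c -> \forall c' \near c,
     (c' < c -> 0 < S c' b * S1 c b) /\ (c < c' -> S c' b * S1 c b < 0)) ->
  finite_set [set c | c < m /\ S c b = 0].
Proof.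
have ab' := ab; have bB' := bB.
move=> fEm Hc0 cross.
pose E := [set c | c < m /\ S c b = 0].
have /choice[N HN] : forall c, exists n, c < m ->
    zeros_ge (S c) `]a, b[ n /\ zeros_le (S c) `]a, b[ n.
  move=> c; case: (ltP c m) => [/zeros_exact[n Hn]|_]; first by exists n.
  by exists 0%N.
have bab : b \in `]a, b] by rewrite in_itv/= ab lexx.
have bnab : b \notin `]a, b[ by rewrite in_itv/= ltxx andbF.
have oc : {subset `]a, b[ <= `]a, b]} by move=> x; rewrite !in_itv/=; lra.
have ltm c : c < m -> \forall c' \near c, c' < m by exact: lt_nbhsl.
(* number of zeros including the end point *)
have closed c n : c < m -> zeros_ge (S c) `]a, b] n -> (n <= N c + (S c b == 0%R))%N.
  move=> cm zn; have [_ zl] := HN _ cm; apply: zeros_ge_le zn _.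
  apply: (@zeros_split _ (S c) `]a, b] `]a, b[ `[b, b] _ _ (fun z => z < b)).
  - by move=> z; rewrite !in_itv/= => /andP[-> _].
  - by move=> z; rewrite !in_itv/= => /andP[_ ->]; rewrite -leNgt => ->.
  - exact: zl.
  - move=> s [us zs]; case: eqP => [Sb|Sb].
      apply: (@uniq_leq_size _ s [:: b]) => // z /zs[].
      by rewrite in_itv/= andbC -eq_le => zb _; rewrite inE.
    case: s us zs => // z s us zs; exfalso; apply: Sb.
    have [+ Sz] := zs z (mem_head _ _); rewrite in_itv/= andbC -eq_le => /eqP E'.
    by rewrite -E'.
have lower c : c < m -> \forall c' \near c, (N c <= N c')%N.
  move=> cm; have [zg _] := HN _ cm.
  apply: filterS2 (zeros_lower_semicont cm (ltW bB) zg) (ltm _ cm) => c' zc' c'm.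
  by have [_ zl] := HN _ c'm; exact: zeros_ge_le zc' zl.
have upper c : c < m -> \forall c' \near c, (N c' <= N c + (S c b == 0%R))%N.
  move=> cm; have [n [e [e0 eB zn zc]]] := zeros_upper_semicont cm.
  apply: filterS2 zc (ltm _ cm) => c' zc' c'm.
  apply: leq_trans (closed _ _ cm zn); have [zg _] := HN _ c'm.
  apply: zeros_ge_le (zeros_le_sub _ zc'); first exact: zg.
  by move=> x; rewrite !in_itv/=; lra.
have left c : E c -> ~ Em c -> \forall c' \near c, c' < c -> (N c < N c')%N.
  move=> [cm Scb] nc; have [[s [us zs] ns] _] := HN _ cm.
  have S1b : S1 c b != 0 by apply: simple_zeros => //; lra.
  have [e0 e00 He0] := @finite_set_gap _ [set` s] b (finite_seq s).
  pose e := Num.min e0 (b - a).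
  have [ee0 eb] : e <= e0 /\ e <= b - a by rewrite !ge_min !lexx !orbT.
  have e_gt0 : 0 < e by rewrite lt_min e00/= subr_gt0.
  have [h he [hp hn]] := deriv_sign (dS c) (@cS1 c) Scb S1b e_gt0.
  have zt : zeros_ge (S c) `]a, b - h[ (N c).
    exists s => //; split=> // z zs'; have [zi Sz] := zs _ zs'; split=> //.
    move: zi; rewrite !in_itv/= => /andP[-> zb]/=.
    have := He0 z zs' (negbT (lt_eqF zb)); rewrite ler0_norm ?subr_le0 ?(ltW zb)//; lra.
  have Sh : S c (b - h) != 0 by apply/eqP => E0; rewrite E0 mul0r ltxx in hn.
  have s1 : \forall c' \near c, 0 < S c' (b - h) * S c (b - h).
    by apply: sign_stable => //; lra.
  have zt' := zeros_lower_semicont cm (_ : b - h <= B) zt.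
  have /zt' {}zt' : b - h <= B by lra.
  near=> c' => c'c; have [_ zl] := HN c' (lt_trans c'c cm).
  suff: zeros_ge (S c') `]a, b[ (N c).+1 by move/zeros_ge_le; apply.
  have q0 : 0 < S c' b * S1 c b.
    by have [+ _] : (c' < c -> 0 < S c' b * S1 c b) /\ (c < c' -> S c' b * S1 c b < 0);
      [near: c'; exact: cross|apply].
  have q1 : 0 < S c' (b - h) * S c (b - h) by near: c'.
  have z1 : zeros_ge (S c') `]a, b - h[ (N c) by near: c'.
  have neg : S c' (b - h) * S c' b < 0.
    have q2 : 0 < (S c' b * S1 c b) * (S c' (b - h) * S c (b - h)) by rewrite mulr_gt0.
    have E' : (S c' b * S1 c b) * (S c' (b - h) * S c (b - h)) =
       (S c' (b - h) * S c' b) * (S c (b - h) * S1 c b) by ring.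
    by rewrite E' nmulr_lgt0 in q2.
  have hlt : b - h < b by lra.
  have [w zw Sw] := IVT_zero hlt (@cS c') neg.
  apply: zeros_ge_cons z1 _ _ Sw => [x||]; rewrite !in_itv/=; lra.
have right c : E c -> ~ Em c -> \forall c' \near c, c < c' -> (N c' <= N c)%N.
  move=> [cm Scb] nc.
  have S1b : S1 c b != 0 by apply: simple_zeros => //; lra.
  have [n [e [e0 eB zn zc]]] := zeros_upper_semicont cm.
  have nN : (n <= (N c).+1)%N by have := closed _ _ cm zn; rewrite Scb eqxx addn1.
  have [h he [hp hn]] := deriv_sign (dS c) (@cS1 c) Scb S1b e0.
  have Sh : S c (b + h) != 0 by apply/eqP => E0; rewrite E0 mul0r ltxx in hp.
  have s1 : \forall c' \near c, 0 < S c' (b + h) * S c (b + h).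
    by apply: sign_stable => //; lra.
  near=> c' => cc'; have c'm : c' < m by near: c'; exact: ltm.
  have [zg _] := HN c' c'm.
  have q0 : S c' b * S1 c b < 0.
    by have [_] : (c' < c -> 0 < S c' b * S1 c b) /\ (c < c' -> S c' b * S1 c b < 0);
      [near: c'; exact: cross|apply].
  have q1 : 0 < S c' (b + h) * S c (b + h) by near: c'.
  have neg : S c' b * S c' (b + h) < 0.
    have q2 : (S c' b * S1 c b) * (S c' (b + h) * S c (b + h)) < 0 by rewrite pmulr_llt0.
    have E' : (S c' b * S1 c b) * (S c' (b + h) * S c (b + h)) =
       (S c' b * S c' (b + h)) * (S c (b + h) * S1 c b) by ring.
    by rewrite E' pmulr_llt0 in q2.
  have hlt : b < b + h by lra.
  have [w zw Sw] := IVT_zero hlt (@cS c') neg.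
  have zg' : zeros_ge (S c') `]a, b + e] (N c').+1.
    by apply: zeros_ge_cons zg _ _ Sw => [x||]; rewrite !in_itv/=; lra.
  have zc' : zeros_le (S c') `]a, b + e] n by near: c'.
  by rewrite -ltnS; exact: leq_trans (zeros_ge_le zg' zc') nN.
apply: (finite_of_drops (N := N) (c0 := c0) fEm _ lower _ _ left right).
- move=> c [cm Sc]; rewrite cm andbT ltNge; apply/negP => /Hc0/(_ [:: b]) H.
  suff: (1 <= 0)%N by [].
  by apply: H; split=> // z; rewrite inE => /eqP->.
- move=> c cm; apply: filterS (upper c cm) => c' /leq_trans; apply.
  by rewrite -addn1 leq_add2l leq_b1.
- move=> c cm nE; apply: filterS (upper c cm) => c'.
  by rewrite (_ : (S c b == 0) = false) ?addn0//; apply/negP => /eqP Sb; exact: nE.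
Unshelve. all: by end_near. Qed.

End ShootingFamily.

(** * Initial value problems *)

Section InitialValueProblem.
Context {R : realType}.
Variables (a B : R).
Hypothesis aB : a < B.
Implicit Types (V W r S : R -> R) (x M rho : R).
Local Notation cl := (clamp a B).

(** The equation is [S'' = V S] on the interval; clamping turns it into an
    equation on the whole line. *)
Definition solves V S (S1 : R -> R) := Dv S S1 /\ Dv S1 (fun x => V x * S (cl x)).

Lemma ivp V s0 s1 : continuous V ->
  exists S S1, [/\ solves V S S1, S a = s0 & S1 a = s1].
Proof.
move=> cV; pose f0 x := s0 + s1 * (x - a).
have df0 x : is_derive x 1 f0 s1.
  have D := derM (derC s1 x) (derD (derI x) (derN (derC a x))).
  by apply: (der_eq (derD (derC s0 x) D)); ring.
have cf0 : continuous f0 by move=> x; exact: der_cont (df0 x).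
have [S [cS SE]] := volterra_solution aB cV cf0.
have cK := @ct_kernel _ a B _ _ cV cS.
exists S, (fun x => s1 + prim a (fun t => V t * S (cl t)) x); split.
- split=> x.
    have D := derD (df0 x) (prim_Dv a (prim_cont a cK) x).
    have ES : S = (fun x => f0 x + volt a B V S x) by apply/funext.
    by rewrite -ES in D.
  by apply: (der_eq (derD (derC s1 x) (prim_Dv a cK x))); rewrite add0r.
- by rewrite SE /volt prim0 /f0 subrr mulr0 !addr0.
- by rewrite prim0 addr0.
Qed.

(** Integrating the equation twice turns the bound for Volterra equations into
    one for [W]; the equation itself then bounds [W1]. *)
Lemma ivp_bound M : 0 <= M -> exists2 C : R, 0 < C &
  forall V W (W1 : R -> R) r rho, continuous V -> continuous r -> 0 <= rho ->
    (forall x, a <= x <= B -> `|V x| <= M) ->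
    (forall x, a <= x <= B -> `|r x| <= rho) ->
    Dv W W1 -> Dv W1 (fun x => V x * W (cl x) + r x) -> W a = 0 -> W1 a = 0 ->
    forall x, a <= x <= B -> `|W x| <= C * rho /\ `|W1 x| <= C * rho.
Proof.
move=> M0; pose L := B - a; pose w := weight a M B.
have L0 : 0 < L by rewrite subr_gt0.
have w0 : 0 < w by exact: expR_gt0.
pose K := 2 * L ^+ 2 * w.
have K0 : 0 < K by rewrite !mulr_gt0// exprn_gt0.
exists (K + (M * K + 1) * L).
  by rewrite addr_gt0// mulr_gt0// ltr_wpDl// mulr_ge0// ltW.
move=> V W W1 r rho cV cr r0 VM rrho dW dW1 W0 W10.
have cW := Dv_cont dW.
have cK := @ct_kernel _ a B _ _ cV cW.
have W1E x : W1 x = prim a (fun t => V t * W (cl t)) x + prim a r x.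
  by rewrite -primD// (prim_uniq _ _ (ctD cK cr) dW1) W10 subr0.
have WE x : W x = volt a B V W x + prim a (prim a r) x.
  rewrite -primD//; try exact: prim_cont.
  rewrite (_ : (fun t => _) = W1); last by apply/funext => t; rewrite W1E.
  by rewrite (prim_uniq _ _ (Dv_cont dW1) dW) W0 subr0.
have b1 x : a <= x <= B -> `|prim a r x| <= rho * L.
  move=> /andP[ax xB]; apply: le_trans (prim_norm ax cr _) _.
    by move=> t /andP[t1 t2]; apply: rrho; rewrite !ltW//= (lt_le_trans t2).
  by rewrite ler_wpM2l// lerD2r.
have b2 x : a <= x <= B -> `|prim a (prim a r) x| <= rho * L ^+ 2.
  move=> /andP[ax xB]; apply: le_trans (prim_norm ax (prim_cont a cr) _) _.
    by move=> t /andP[t1 t2]; apply: b1; rewrite !ltW//= (lt_le_trans t2).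
  by rewrite expr2 mulrA ler_wpM2l ?lerD2r// mulr_ge0// ltW.
have bW x : a <= x <= B -> `|W x| <= K * rho.
  move=> xab; have -> : K * rho = 2 * (rho * L ^+ 2) * w by rewrite /K; ring.
  apply: (volterra_bound aB cV VM cW) xab => t tab.
  by rewrite [W t]WE addrC addKr; exact: b2.
move=> x xab; split.
  apply: (le_trans (bW x xab)); rewrite ler_wpM2r// lerDl mulr_ge0 ?(ltW L0)//.
  by rewrite addr_ge0// mulr_ge0// ltW.
have [ax xB] := andP xab.
have b3 : `|prim a (fun t => V t * W (cl t)) x| <= M * (K * rho) * L.
  apply: le_trans (prim_norm (C := M * (K * rho)) ax cK _) _.
    move=> t /andP[t1 t2]; have tab : a <= t <= B by rewrite !ltW//= (lt_le_trans t2).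
    by rewrite normrM clamp_id// ler_pM//; [exact: VM|exact: bW].
  by rewrite ler_wpM2l ?lerD2r// !mulr_ge0// ltW.
rewrite W1E; apply: le_trans (ler_normD _ _) _; apply: le_trans (lerD b3 (b1 x xab)) _.
have -> : (K + (M * K + 1) * L) * rho = K * rho + (M * (K * rho) * L + rho * L) by ring.
by rewrite lerDr mulr_ge0// ltW.
Qed.

(** Zeros of a nontrivial solution are simple: [S^2 + S'^2] grows at most
    exponentially to the left. *)
Lemma solution_simple_zero V S S1 x : continuous V -> solves V S S1 ->
  a <= x <= B -> S x = 0 -> S1 x = 0 -> S a = 0 /\ S1 a = 0.
Proof.
move=> cV [dS dS1] /andP[ax xB] Sx S1x.
have [M M0 VM] := cont_bounded a B cV.
pose K := 1 + M.
pose e t := S t ^+ 2 + S1 t ^+ 2.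
pose ex t := expR (K * t).
have dex (t : R) : is_derive t 1 ex (K * ex t).
  have D := derComp (derM (derC K t) (derI t)) (is_derive_expR _).
  by apply: (der_eq D); rewrite /ex; ring.
have dg (t : R) : is_derive t 1 (fun t => e t * ex t)
    ((2 * S t * S1 t + 2 * S1 t * (V t * S (cl t)) + K * e t) * ex t).
  apply: (der_eq (derM (derD (derX2 (dS t)) (derX2 (dS1 t))) (dex t))).
  by rewrite /e; ring.
have ea : e a * ex a <= 0.
  have -> : 0 = e x * ex x by rewrite /e Sx S1x expr0n/= addr0 mul0r.
  apply: (Dv_le ax dg) => t /andP[t1 t2]; rewrite mulr_ge0 ?expR_ge0//.
  have tab : a <= t <= B by rewrite !ltW//= (lt_le_trans t2).
  rewrite clamp_id//; have := VM t tab; rewrite ler_norml => /andP[V1 V2].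
  rewrite /e /K.
  have -> : 2 * S t * S1 t + 2 * S1 t * (V t * S t) + (1 + M) * (S t ^+ 2 + S1 t ^+ 2) =
    (2 + M + V t) / 2 * (S t + S1 t) ^+ 2 + (M - V t) / 2 * (S t - S1 t) ^+ 2 by field.
  by rewrite addr_ge0// mulr_ge0 ?sqr_ge0//; lra.
have {}ea : e a <= 0 by move: ea; rewrite pmulr_lle0// expR_gt0.
have : 0 <= S a ^+ 2 by exact: sqr_ge0.
have : 0 <= S1 a ^+ 2 by exact: sqr_ge0.
rewrite /e in ea => h1 h2; split; apply/eqP; rewrite -sqrf_eq0; apply/eqP; lra.
Qed.

(** With a nonnegative potential, [S S'] and hence [S^2] is nondecreasing. *)
Lemma solution_nonosc V S S1 x : solves V S S1 ->
  (forall t, a <= t <= B -> 0 <= V t) -> S a = 0 -> S1 a = 1 -> a < x <= B -> S x != 0.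
Proof.
move=> [dS dS1] V0 Sa S1a /andP[ax xB]; apply/eqP => Sx.
have dP (t : R) : is_derive t 1 (fun t => S t * S1 t) (S1 t ^+ 2 + S t * (V t * S (cl t))).
  by apply: (der_eq (derM (dS t) (dS1 t))); ring.
have P0 t : a <= t <= B -> 0 <= S t * S1 t.
  move=> /andP[at_ tB]; have -> : 0 = S a * S1 a by rewrite Sa mul0r.
  apply: (Dv_le at_ dP) => s /andP[s1 s2]; have sab : a <= s <= B by lra.
  rewrite clamp_id// addr_ge0 ?sqr_ge0// mulrCA mulr_ge0 ?V0//.
  by rewrite -expr2 sqr_ge0.
have cS1 := Dv_cont dS1.
have S1a0 : S1 a != 0 by rewrite S1a oner_neq0.
have x0 : 0 < x - a by lra.
have [h hx [hp _]] := deriv_sign dS cS1 Sa S1a0 x0.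
have : S (a + h) ^+ 2 <= S x ^+ 2.
  have ahx : a + h <= x by lra.
  apply: (Dv_le ahx (fun t => derX2 (dS t))) => s s12; rewrite -mulrA mulr_ge0// P0//; lra.
rewrite Sx expr0n/= => le0.
have : S (a + h) ^+ 2 = 0 by apply/eqP; rewrite eq_le le0 sqr_ge0.
by move/eqP; rewrite sqrf_eq0 => /eqP E; rewrite E mul0r ltxx in hp.
Qed.

Section Family.
Variables (m : R) (V : R -> R -> R).
Hypothesis cV : forall c, continuous (V c).
Hypothesis HV : forall c (e : R), c < m -> 0 < e ->
  \forall c' \near c, forall x, a <= x <= B -> `|V c' x - V c x| < e.

(** The difference of two solutions has zero data and solves the equation with
    a small right-hand side. *)
Lemma solutions_depend_continuously (S S1 : R -> R -> R) :
  (forall c, [/\ solves (V c) (S c) (S1 c), S c a = 0 & S1 c a = 1]) ->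
  forall c (e : R), c < m -> 0 < e ->
  \forall c' \near c, forall x, a <= x <= B ->
    `|S c' x - S c x| < e /\ `|S1 c' x - S1 c x| < e.
Proof.
move=> HS c e cm e0.
have [M M0 VM] := cont_bounded a B (@cV c).
have M1 : 0 <= M + 1 by rewrite addr_ge0// ltW.
have [C C0 HC] := ivp_bound M1.
have [[dS dS1] Sa S1a] := HS c.
have [D D0 SD] := cont_bounded a B (Dv_cont dS).
pose d := Num.min 1 (e / (2 * C * D)).
have [d1 de] : d <= 1 /\ d <= e / (2 * C * D) by rewrite !ge_min !lexx orbT.
have d0 : 0 < d by rewrite lt_min ltr01 divr_gt0// !mulr_gt0.
apply: filterS (HV cm d0) => c' Hc' x xab.
have [[dS' dS1'] Sa' S1a'] := HS c'.
pose r t := (V c' t - V c t) * S c (cl t).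
have cr : continuous r.
  by apply: ctM; [apply: ctD => //; exact: ctN|apply: ct_clampC => //; exact: Dv_cont dS].
have VM' t : a <= t <= B -> `|V c' t| <= M + 1.
  move=> tab; rewrite -(subrK (V c t) (V c' t)) addrC.
  apply: le_trans (ler_normD _ _) _; apply: lerD; first exact: VM.
  by apply: ltW; apply: lt_le_trans (Hc' t tab) d1.
have rr t : a <= t <= B -> `|r t| <= d * D.
  move=> tab; rewrite normrM clamp_id// ler_pM//; first exact/ltW/Hc'.
  exact: SD.
have dW (t : R) : is_derive t 1 (fun t => S c' t - S c t) (S1 c' t - S1 c t).
  by apply: derD => //; exact: derN.
have dW1 (t : R) : is_derive t 1 (fun t => S1 c' t - S1 c t)
    (V c' t * (S c' (cl t) - S c (cl t)) + r t).
  by apply: (der_eq (derD (dS1' t) (derN (dS1 t)))); rewrite /r; ring.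
have dD0 : 0 <= d * D by rewrite mulr_ge0// ltW.
have Wa : S c' a - S c a = 0 by rewrite Sa' Sa subrr.
have W1a : S1 c' a - S1 c a = 0 by rewrite S1a' S1a subrr.
have [h1 h2] := HC _ _ _ _ _ (@cV c') cr dD0 VM' rr dW dW1 Wa W1a x xab.
have : C * (d * D) < e.
  move: de; rewrite ler_pdivlMr; last by rewrite !mulr_gt0.
  have : 0 < d * D * C by rewrite !mulr_gt0.
  by lra.
by move=> h3; split; [exact: le_lt_trans h1 h3|exact: le_lt_trans h2 h3].
Qed.

End Family.

End InitialValueProblem.

(** * Hardy's inequality and quadratic forms *)

Section QuadraticForm.
Context {R : realType}.
Implicit Types (V f : R -> R) (a b p t x C : R).

Lemma der_le_cc (F f : R -> R) a b : a <= b ->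
  (forall x, a <= x <= b -> is_derive x 1 F (f x)) ->
  (forall x, a <= x <= b -> 0 <= f x) -> F a <= F b.
Proof.
move=> ab dF f0; apply: (@der_le _ F f) => //.
- by move=> x /andP[ax xb]; apply: dF; rewrite !ltW.
- apply: continuous_in_subspaceT => x; rewrite inE/= in_itv/= => xab.
  exact: der_cont (dF x xab).
- by move=> x /andP[ax xb]; apply: f0; rewrite !ltW.
Qed.

(** Integrand of the quadratic form of [- phi'' + V phi]. *)
Definition energy V (phi phi1 : R -> R) x := phi1 x ^+ 2 + V x * phi x ^+ 2.

Lemma ct_energy V phi phi1 : continuous V -> continuous phi -> continuous phi1 ->
  continuous (energy V phi phi1).
Proof.
move=> cV cp cp1; apply: ctD; first exact: ctX.
by apply: ctM => //; exact: ctX.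
Qed.

(** Hardy's inequality with the sharp constant [1/4] and a subcritical
    perturbation [C / x]: [x^(1/2) (1 - C x)] is a positive supersolution, and
    its logarithmic derivative [w] completes the square. *)
Lemma hardy_right V phi (phi1 : R -> R) p t C : 0 <= C -> p < t -> 3 * C * (t - p) <= 1 ->
  continuous V -> Dv phi phi1 -> continuous phi1 -> phi p = 0 ->
  (forall x, p < x <= t -> - (4 * (x - p) ^+ 2)^-1 - C / (x - p) <= V x) ->
  0 <= prim p (energy V phi phi1) t.
Proof.
move=> C0 pt Ct cV dphi cphi1 phip HV.
have cphi := Dv_cont dphi.
have cq := ct_energy cV cphi cphi1.
pose w x := (2 * (x - p))^-1 - C / (1 - C * (x - p)).
pose H x := prim p (energy V phi phi1) x - phi x ^+ 2 * w x.
have Cx x : p < x <= t -> 0 < 1 - C * (x - p).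
  move=> /andP[px xt]; have : C * (x - p) <= C * (t - p) by rewrite ler_wpM2l// lerD2r.
  lra.
have dx (x : R) : is_derive x 1 (fun x => x - p) 1.
  by apply: (der_eq (derD (derI x) (derN (derC p x)))); rewrite subr0.
have dw (x : R) : p < x <= t ->
    is_derive x 1 w (- (2 * (x - p) ^+ 2)^-1 - C ^+ 2 / (1 - C * (x - p)) ^+ 2).
  move=> pxt; have xp : x - p != 0 by case/andP: pxt => px _; rewrite subr_eq0 gt_eqF.
  have cx : 1 - C * (x - p) != 0 by rewrite gt_eqF// Cx.
  have d1 := derV (derM (derC 2 x) (dx x)).
  have d2 := derV (derD (derC 1 x) (derN (derM (derC C x) (dx x)))).
  have xp2 : 2 * (x - p) != 0 by rewrite mulf_neq0.
  have := derD (d1 xp2) (derN (derM (derC C x) (d2 cx))).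
  by move/der_eq; apply; field; rewrite xp cx.
have dH (x : R) : p < x <= t -> is_derive x 1 H (energy V phi phi1 x -
    (2 * phi x * phi1 x * w x + phi x ^+ 2 * (- (2 * (x - p) ^+ 2)^-1 - C ^+ 2 / (1 - C * (x - p)) ^+ 2))).
  move=> pxt; have := derD (prim_Dv p cq x) (derN (derM (derX2 (dphi x)) (dw x pxt))).
  by [].
have H'0 x : p < x <= t -> 0 <= energy V phi phi1 x -
    (2 * phi x * phi1 x * w x + phi x ^+ 2 * (- (2 * (x - p) ^+ 2)^-1 - C ^+ 2 / (1 - C * (x - p)) ^+ 2)).
  move=> pxt; have xp : 0 < x - p by case/andP: pxt => px _; rewrite subr_gt0.
  have cx := Cx x pxt.
  pose v := - (4 * (x - p) ^+ 2)^-1 - C / ((x - p) * (1 - C * (x - p))).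
  have vV : v <= V x.
    apply: le_trans (HV x pxt); rewrite lerD2l lerN2 invfM mulrA.
    rewrite ler_peMr ?divr_ge0 ?(ltW xp)// invf_ge1//.
    by rewrite gerDl oppr_le0 mulr_ge0// ltW.
  have -> : energy V phi phi1 x -
    (2 * phi x * phi1 x * w x + phi x ^+ 2 * (- (2 * (x - p) ^+ 2)^-1 - C ^+ 2 / (1 - C * (x - p)) ^+ 2))
    = (phi1 x - w x * phi x) ^+ 2 + (V x - v) * phi x ^+ 2.
    by rewrite /energy /w /v; field; rewrite !gt_eqF.
  by rewrite addr_ge0 ?sqr_ge0// mulr_ge0 ?sqr_ge0// subr_ge0.
have wt : 0 <= w t.
  have tt : p < t <= t by rewrite pt/=.
  have ct := Cx t tt; have tp : 0 < t - p by rewrite subr_gt0.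
  by rewrite subr_ge0 ler_pdivrMr// mulrC ler_pdivlMr ?mulr_gt0//; lra.
have [D D0 HD] := cont_bounded p t cphi1.
have [K K0 HK] := cont_bounded p t cq.
suff : 0 <= H t by rewrite subr_ge0 => /(le_trans _); apply; rewrite mulr_ge0 ?sqr_ge0.
rewrite -oppr_le0; apply/ler_addgt0Pr => e e0; rewrite add0r.
pose h := Num.min (t - p) (e / (K + D ^+ 2)).
have [ht he] : h <= t - p /\ h <= e / (K + D ^+ 2) by rewrite !ge_min !lexx orbT.
have KD : 0 < K + D ^+ 2 by rewrite addr_gt0// exprn_gt0.
have h0 : 0 < h by rewrite lt_min subr_gt0 pt divr_gt0.
have pht : p < p + h <= t by lra.
have Hle : H (p + h) <= H t.
  apply: der_le_cc; first by lra.
    by move=> x xh; apply: dH; lra.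
  by move=> x xh; apply: H'0; lra.
have b1 : `|prim p (energy V phi phi1) (p + h)| <= K * h.
  have := @prim_norm _ p _ K (p + h) _ cq _; rewrite [p + h - p]addrC addKr; apply; first lra.
  by move=> s sp; apply: HK; lra.
have b2 : phi (p + h) ^+ 2 <= D ^+ 2 * h ^+ 2.
  have ph : p < p + h by lra.
  have [x px] := Dv_mvt ph dphi; rewrite phip subr0 [p + h - p]addrC addKr => ->.
  rewrite exprMn ler_wpM2r ?sqr_ge0// -ler_sqrt ?sqr_ge0// !sqrtr_sqr.
  by rewrite (gtr0_norm D0); apply: HD; lra.
have wh : w (p + h) <= h^-1.
  rewrite /w [p + h - p]addrC addKr.
  have := Cx _ pht; rewrite [p + h - p]addrC addKr => ch.
  have : 0 <= C / (1 - C * h) by rewrite divr_ge0// ltW.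
  have : (2 * h)^-1 <= h^-1 by rewrite lef_pV2 ?posrE ?mulr_gt0// ler_peMl ?(ltW h0)// ler1n.
  lra.
have b3 : phi (p + h) ^+ 2 * w (p + h) <= D ^+ 2 * h.
  apply: (@le_trans _ _ (phi (p + h) ^+ 2 * h^-1)); first by rewrite ler_wpM2l// sqr_ge0.
  by rewrite ler_pdivrMr// -mulrA -expr2.
move: b1; rewrite ler_norml => /andP[b1 _].
have : (K + D ^+ 2) * h <= e by rewrite mulrC -ler_pdivlMr.
rewrite /H in Hle *.
lra.
Qed.

Lemma hardy_left V phi (phi1 : R -> R) p t C : 0 <= C -> t < p -> 3 * C * (p - t) <= 1 ->
  continuous V -> Dv phi phi1 -> continuous phi1 -> phi p = 0 ->
  (forall x, t <= x < p -> - (4 * (x - p) ^+ 2)^-1 - C / (p - x) <= V x) ->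
  0 <= prim t (energy V phi phi1) p.
Proof.
move=> C0 tp Ct cV dphi cphi1 phip HV.
have cphi := Dv_cont dphi.
have dneg (x : R) : is_derive x 1 (fun x : R => - x) (-1) by exact: derN (derI x).
have cneg : continuous (fun x : R => - x) by exact: ctN ctI.
have dphi' : Dv (fun x => phi (- x)) (fun x => - phi1 (- x)).
  by move=> x; apply: (der_eq (derComp (dneg x) (dphi (- x)))); rewrite mulN1r.
have := @hardy_right (fun x => V (- x)) _ _ (- p) (- t) C C0 _ _ (ctComp cneg cV) dphi' _ _ _.
have cq := ct_energy cV cphi cphi1.
have cq' : continuous (energy (fun x => V (- x)) (fun x => phi (- x)) (fun x => - phi1 (- x))).
  by apply: ct_energy; [exact: ctComp|exact: ctComp|apply: ctN; exact: ctComp].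
rewrite (@prim_uniq _ (fun x => - prim t (energy V phi phi1) (- x)) _ (- p) (- t) cq').
  rewrite !opprK prim0 oppr0 add0r; apply.
  - by rewrite ltrN2.
  - by rewrite addrC.
  - by apply: ctN; exact: ctComp.
  - by [].
  - move=> x xpt; have := HV (- x).
    have -> : (- x - p) ^+ 2 = (x + p) ^+ 2 by ring.
    rewrite opprK.
    by rewrite [p + x]addrC; apply; lra.
move=> x; apply: (der_eq (derN (derComp (dneg x) (prim_Dv t cq (- x))))).
by rewrite /energy mulN1r opprK sqrrN.
Qed.

(** Near each point the potentials of the family are at worst critical, so by
    compactness finitely many vanishing conditions make all the quadratic forms
    nonnegative. *)
Lemma interpolation_grid a b (fam : (R -> R) -> Prop) : a < b ->
  (forall p, a <= p <= b -> exists d C : R, [/\ 0 < d, 0 <= C &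
     forall V x, fam V -> a <= x <= b -> x != p -> `|x - p| < d ->
       - (4 * (x - p) ^+ 2)^-1 - C / `|x - p| <= V x]) ->
  exists s : seq R, forall V phi (phi1 : R -> R), fam V -> continuous V -> Dv phi phi1 ->
    continuous phi1 -> (forall p, p \in s -> phi p = 0) ->
    0 <= prim a (energy V phi phi1) b.
Proof.
move=> ab loc.
have split_prim f x y : continuous f -> prim a f y = prim a f x + prim x f y.
  move=> cf; rewrite (prim_uniq x y cf (prim_Dv a cf)); ring.
suff: forall t, a <= t <= b -> exists s : seq R, forall V phi (phi1 : R -> R),
    fam V -> continuous V -> Dv phi phi1 -> continuous phi1 ->
    (forall p, p \in s -> phi p = 0) -> 0 <= prim a (energy V phi phi1) t.
  by apply; rewrite lexx ltW.
apply: real_induction => [t tab IH|t tab [s Hs]].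
  case: (eqVneq t a) => [->|ta].
    by exists [::] => V phi phi1 *; rewrite prim0.
  have {}ta : a < t by rewrite lt_neqAle eq_sym ta; case/andP: tab.
  have [d [C [d0 C0 Hd]]] := loc t tab.
  pose h := Num.min (d / 2) (3 * C + 1)^-1.
  have [hd hC] : h <= d / 2 /\ h <= (3 * C + 1)^-1 by rewrite !ge_min !lexx orbT.
  have C1 : 0 < 3 * C + 1 by lra.
  have h0 : 0 < h by rewrite lt_min divr_gt0//= invr_gt0.
  have hC1 : 3 * C * h <= 1.
    have : h * (3 * C + 1) <= 1 by rewrite -ler_pdivlMr// mul1r.
    have := h0; lra.
  pose s0 := Num.max a (t - h).
  have [as0 ts0] : a <= s0 /\ t - h <= s0 by rewrite !le_max !lexx orbT.
  have s0t : s0 < t by rewrite gt_max ta/=; lra.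
  have [|s Hs] := IH s0; first by rewrite as0.
  exists (t :: s) => V phi phi1 fV cV dphi cphi1 phis.
  have cq := ct_energy cV (Dv_cont dphi) cphi1.
  rewrite (split_prim _ s0)// addr_ge0//.
    by apply: Hs => // p ps; apply: phis; rewrite inE ps orbT.
  apply: (@hardy_left _ _ _ _ _ C) => //.
  - apply: le_trans hC1; rewrite ler_wpM2l ?mulr_ge0//; lra.
  - by apply: phis; exact: mem_head.
  - move=> x /andP[x1 x2]; have xp : x - t < 0 by lra.
    have := Hd V x fV; rewrite ltr0_norm// opprB; apply; first by lra.
      by rewrite lt_eqF.
    lra.
have tab' : a <= t <= b by lra.
have [d [C [d0 C0 Hd]]] := loc t tab'.
pose h := Num.min (d / 2) (3 * C + 1)^-1.
have [hd hC] : h <= d / 2 /\ h <= (3 * C + 1)^-1 by rewrite !ge_min !lexx orbT.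
have C1 : 0 < 3 * C + 1 by lra.
have h0 : 0 < h by rewrite lt_min divr_gt0//= invr_gt0.
have hC1 : 3 * C * h <= 1.
  have : h * (3 * C + 1) <= 1 by rewrite -ler_pdivlMr// mul1r.
  have := h0; lra.
exists h => // r tr rb; exists (t :: s) => V phi phi1 fV cV dphi cphi1 phis.
have cq := ct_energy cV (Dv_cont dphi) cphi1.
rewrite (split_prim _ t)// addr_ge0//.
  by apply: Hs => // p ps; apply: phis; rewrite inE ps orbT.
apply: (@hardy_right _ _ _ _ _ C) => //.
- by case/andP: tr.
- apply: le_trans hC1; rewrite ler_wpM2l ?mulr_ge0//; lra.
- by apply: phis; exact: mem_head.
- move=> x /andP[x1 x2]; have xp : 0 < x - t by lra.
  have := Hd V x fV; rewrite gtr0_norm//; apply; first by lra.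
    by rewrite gt_eqF.
  lra.
Qed.

(** A homogeneous linear system with more unknowns than equations. *)
Lemma vanishing_combination n (f : 'I_n -> R -> R) (s : seq R) : (size s < n)%N ->
  exists2 k : 'I_n -> R, (exists i, k i != 0) &
    forall p, p \in s -> \sum_i k i * f i p = 0.
Proof.
move=> sn; pose A := \matrix_(i < n, j < size s) f i (nth 0 s j).
have kA : kermx A != 0.
  rewrite -mxrank_eq0 mxrank_ker -lt0n subn_gt0.
  by apply: leq_ltn_trans sn; exact: rank_leq_col.
have /rowV0Pn[v /sub_kermxP vA v0] := kA.
exists (fun i => v 0 i); first by have /rV0Pn[i vi] := v0; exists i.
move=> p ps; have ips : (index p s < size s)%N by rewrite index_mem.
have := congr1 (fun M : 'rV_(size s) => M 0 (Ordinal ips)) vA; rewrite !mxE => E.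
rewrite -[RHS]E; apply: eq_bigr => j _; by rewrite mxE /= nth_index.
Qed.

End QuadraticForm.

(** * Eigenfunctions of the Rayleigh equation and their pairing *)

Section Eigenfunctions.
Context {R : realType}.
Variables (a b B m alpha : R) (U P : R -> R).
Hypotheses (ab : a < b) (bB : b < B) (alpha0 : 0 < alpha).
Hypotheses (cU : continuous U) (cP : continuous P) (mU : forall x, m <= U x).
Implicit Types (c d x y : R) (F G : R -> R).

(** Potential of the Rayleigh equation [phi'' = pot c phi] for the profile [U] with
    [P = beta - u'']. *)
Definition pot c x := alpha ^+ 2 - P x / (U x - c).

Definition shot c F (F1 : R -> R) := [/\ solves a B (pot c) F F1, F a = 0 & F1 a = 1].

Lemma Uc_gt0 c x : c < m -> 0 < U x - c.
Proof. by move=> cm; rewrite subr_gt0; exact: lt_le_trans (mU x). Qed.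

Lemma Uc_neq0 c x : c < m -> U x - c != 0.
Proof. by move=> cm; rewrite gt_eqF// Uc_gt0. Qed.

Lemma ct_Uc c : continuous (fun x => U x - c).
Proof. by apply: ctD => //; apply: ctN; exact: ctC. Qed.

Lemma ct_invUc c : c < m -> continuous (fun x => (U x - c)^-1).
Proof. by move=> cm; apply: ctV => [|x]; [exact: ct_Uc|exact: Uc_neq0]. Qed.

Lemma ct_pot c : c < m -> continuous (pot c).
Proof.
move=> cm; apply: ctD; first exact: ctC.
by apply: ctN; apply: ctM => //; exact: ct_invUc.
Qed.

Definition psi c F x := F x / (U x - c).

Lemma ct_psi c F : c < m -> continuous F -> continuous (psi c F).
Proof. by move=> cm cF; apply: ctM => //; exact: ct_invUc. Qed.

Definition pairing F G := prim a (fun x => P x * (F x * G x)) b.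

Lemma ct_pair F G : continuous F -> continuous G -> continuous (fun x => P x * (F x * G x)).
Proof. by move=> cF cG; apply: ctM => //; exact: ctM. Qed.

Lemma shot_cont c F F1 : shot c F F1 -> continuous F /\ continuous F1.
Proof. by move=> [[/Dv_cont ? /Dv_cont ?] _ _]. Qed.

(** [F1 G - F G1] has derivative [(pot c - pot d) F G], and
    [(U - c)^-1 - (U - d)^-1] is a multiple of the product of these inverses. *)
Lemma wronskian c d F (F1 : R -> R) G (G1 : R -> R) : c < m -> d < m ->
  shot c F F1 -> shot d G G1 ->
  (d - c) * pairing (psi c F) (psi d G) = F1 b * G b - F b * G1 b.
Proof.
move=> cm dm sF sG; have [cF cF1] := shot_cont sF; have [cG cG1] := shot_cont sG.
have [[dF dF1] Fa _] := sF; have [[dG dG1] Ga _] := sG.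
have ab' := ab; have bB' := bB.
pose w x := (pot c x * F (clamp a B x)) * G x - F x * (pot d x * G (clamp a B x)).
have dW : Dv (fun x => F1 x * G x - F x * G1 x) w.
  move=> x; have := derD (derM (dF1 x) (dG x)) (derN (derM (dF x) (dG1 x))).
  by move/der_eq; apply; rewrite /w; ring.
have cpF : continuous (fun x => pot c x * F (clamp a B x)).
  by apply: ct_kernel => //; exact: ct_pot.
have cpG : continuous (fun x => pot d x * G (clamp a B x)).
  by apply: ct_kernel => //; exact: ct_pot.
have cw : continuous w.
  by apply: ctD; [exact: ctM|apply: ctN; exact: ctM].
have := prim_uniq a b cw dW; rewrite Fa Ga !(mul0r, mulr0) !subr0 => <-.
rewrite /pairing -primZ; last by apply: ct_pair; exact: ct_psi.
apply: eq_prim => //; first exact: ltW.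
  by apply: ctM; [exact: ctC|apply: ct_pair; exact: ct_psi].
move=> x xab; rewrite /w clamp_id; last by lra.
by rewrite /pot /psi; field; rewrite !Uc_neq0.
Qed.

Lemma eigen_orthogonal c d F (F1 : R -> R) G (G1 : R -> R) : c < m -> d < m -> c != d ->
  shot c F F1 -> shot d G G1 -> F b = 0 -> G b = 0 -> pairing (psi c F) (psi d G) = 0.
Proof.
move=> cm dm cd sF sG Fb Gb; have := wronskian cm dm sF sG.
rewrite Fb Gb mulr0 mul0r subrr => /eqP; rewrite mulf_eq0 subr_eq0 eq_sym (negbTE cd).
by move/eqP.
Qed.

Lemma Dv_sum n (k : 'I_n -> R) (f g : 'I_n -> R -> R) : (forall i, Dv (f i) (g i)) ->
  Dv (fun x => \sum_i k i * f i x) (fun x => \sum_i k i * g i x).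
Proof.
move=> fg x; elim: (index_enum _) => [|i s IH].
  rewrite (_ : (fun _ => _) = fun=> 0); last by apply/funext => y; rewrite big_nil.
  by rewrite big_nil; exact: derC.
rewrite (_ : (fun _ => _) = fun y => k i * f i y + \sum_(j <- s) k j * f j y); last first.
  by apply/funext => y; rewrite big_cons.
rewrite big_cons.
by apply: (der_eq (derD (derM (derC (k i) x) (fg i x)) IH)); rewrite mul0r add0r.
Qed.

Section Family.
Variables (n : nat) (c : 'I_n -> R) (F F1 : 'I_n -> R -> R).
Hypotheses (cm : forall i, c i < m) (cinj : injective c).
Hypotheses (sF : forall i, shot (c i) (F i) (F1 i)) (Fb : forall i, F i b = 0).
Implicit Types k l : 'I_n -> R.

Definition comb k (f : 'I_n -> R -> R) x := \sum_i k i * f i x.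
Local Notation psis := (fun i => psi (c i) (F i)).

Let cF i : continuous (F i). Proof. by have [] := shot_cont (sF i). Qed.
Let cF1 i : continuous (F1 i). Proof. by have [] := shot_cont (sF i). Qed.
Let cpsi i : continuous (psis i). Proof. exact: ct_psi. Qed.

Lemma ct_comb k f : (forall i, continuous (f i)) -> continuous (comb k f).
Proof. by move=> cf; apply: ct_sum => i; apply: ctM => //; exact: ctC. Qed.

Lemma pairing_comb k l :
  pairing (comb k psis) (comb l psis) = \sum_i k i * l i * pairing (psis i) (psis i).
Proof.
rewrite /pairing.
have -> : (fun x => P x * (comb k psis x * comb l psis x)) =
    fun x => \sum_i \sum_j (k i * l j) * (P x * (psis i x * psis j x)).
  apply/funext => x; rewrite /comb mulr_suml mulr_sumr; apply: eq_bigr => i _.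
  rewrite mulr_sumr mulr_sumr; apply: eq_bigr => j _; ring.
have ci i j : continuous (fun x => k i * l j * (P x * (psis i x * psis j x))).
  by apply: ctM; [exact: ctC|exact: ct_pair].
rewrite (prim_sum _ _ _ (f := fun i x => \sum_j k i * l j * (P x * (psis i x * psis j x)))); last first.
  by move=> i; apply: ct_sum.
apply: eq_bigr => i _.
rewrite (prim_sum _ _ _ (f := fun j x => k i * l j * (P x * (psis i x * psis j x)))); last by [].
rewrite (bigD1 i)//= primZ; last exact: ct_pair.
rewrite big1 ?addr0// => j ji; rewrite primZ; last exact: ct_pair.
have -> : prim a (fun x => P x * (psis i x * psis j x)) b = 0.
  apply: eigen_orthogonal (cm i) (cm j) _ (sF i) (sF j) (Fb i) (Fb j).
  by rewrite (inj_eq cinj) eq_sym.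
by rewrite mulr0.
Qed.

Lemma Dv_comb k : Dv (comb k F) (comb k F1).
Proof. by apply: Dv_sum => i; have [[]] := sF i. Qed.

Lemma comb_a k : comb k F a = 0.
Proof. by rewrite /comb big1// => i _; have [_ -> _] := sF i; rewrite mulr0. Qed.
Lemma comb_b k : comb k F b = 0.
Proof. by rewrite /comb big1// => i _; rewrite Fb mulr0. Qed.

(** The second derivative of [comb k F]. *)
Definition comb2 k x := \sum_i k i * (pot (c i) x * F i (clamp a B x)).

Lemma Dv_comb1 k : Dv (comb k F1) (comb2 k).
Proof.
apply: (@Dv_sum _ k F1 (fun i x => pot (c i) x * F i (clamp a B x))) => i.
by have [[]] := sF i.
Qed.

Lemma ct_comb2 k : continuous (comb2 k).
Proof.
apply: ct_sum => i; apply: ctM; first exact: ctC.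
by apply: ct_kernel => //; exact: ct_pot.
Qed.

Lemma comb2E k x : a <= x <= b ->
  comb2 k x = alpha ^+ 2 * comb k F x - P x * comb k psis x.
Proof.
have bB' := bB; move=> xab; rewrite /comb2 /comb !mulr_sumr -sumrB; apply: eq_bigr => i _.
by rewrite clamp_id; [rewrite /pot /psi; ring|lra].
Qed.

(** Integration by parts, by which the form of a combination of eigenfunctions
    becomes a pairing. *)
Lemma energy_comb k : prim a (energy (fun=> alpha ^+ 2) (comb k F) (comb k F1)) b =
  pairing (comb k psis) (comb k F).
Proof.
have ab' := ab.
have cc := @ct_comb k F cF; have cc1 := @ct_comb k F1 cF1.
have ce : continuous (energy (fun=> alpha ^+ 2) (comb k F) (comb k F1)).
  by apply: ct_energy => //; exact: ctC.
have cp : continuous (fun x => P x * (comb k psis x * comb k F x)).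
  by apply: ct_pair => //; exact: ct_comb.
apply/eqP; rewrite -subr_eq0 -primB//; apply/eqP.
have cr : continuous (fun x => comb k F1 x * comb k F1 x + comb k F x * comb2 k x).
  by apply: ctD; apply: ctM => //; exact: ct_comb2.
rewrite -[RHS](_ : prim a (fun x => comb k F1 x * comb k F1 x + comb k F x * comb2 k x) b = 0).
  apply: eq_prim => //; [exact: ltW|by apply: ctD => //; exact: ctN|].
  by move=> x xab; rewrite comb2E; [rewrite /energy; ring|lra].
rewrite (prim_uniq _ _ cr (_ : Dv (fun x => comb k F x * comb k F1 x) _)).
  by rewrite comb_a comb_b !mul0r subrr.
by move=> x; exact: derM (Dv_comb k x) (Dv_comb1 k x).
Qed.

Lemma deriv_flat (f f1 : R -> R) : Dv f f1 -> (forall x, a < x < b -> f x = 0) ->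
  forall x, a < x < b -> f1 x = 0.
Proof.
move=> df f0 x xab.
have d0 : is_derive x 1 f 0.
  apply: (near_eq_is_derive _ (derC 0 x)); have [ax xb] := andP xab.
  apply: filterS2 (lt_nbhsr ax) (lt_nbhsl xb) => y ay yb.
  by rewrite f0// ay.
by case: (df x) => _ <-; case: d0 => _ ->.
Qed.

(** [k |-> c k] is multiplication by the operator of which the [F i] are the
    eigenvectors, so it preserves linear relations. *)
Lemma relation_shift k : (forall x, a < x < b -> comb k F x = 0) ->
  forall x, a < x < b -> comb (fun i => k i * c i) F x = 0.
Proof.
have ab' := ab.
move=> k0; pose l i := k i * c i.
have k1 := deriv_flat (Dv_comb k) k0.
have k2 := deriv_flat (Dv_comb1 k) k1.
have Pk x : a < x < b -> P x * comb k psis x = 0.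
  by move=> xab; have := k2 x xab; rewrite comb2E ?k0//; lra.
have Pl x : a < x < b -> P x * comb l psis x = 0.
  move=> xab; have -> : P x * comb l psis x = U x * (P x * comb k psis x) - P x * comb k F x.
    rewrite /comb !mulr_sumr -sumrB; apply: eq_bigr => i _.
    by rewrite /l /psi; field; rewrite Uc_neq0.
  by rewrite Pk// k0// !mulr0 subr0.
have ce : continuous (energy (fun=> alpha ^+ 2) (comb l F) (comb l F1)).
  by apply: ct_energy; [exact: ctC|exact: ct_comb|exact: ct_comb].
have e0 : prim a (energy (fun=> alpha ^+ 2) (comb l F) (comb l F1)) b <= 0.
  rewrite energy_comb /pairing (@eq_prim _ _ _ (fun=> 0 * 0)).
  - by rewrite primZ ?mul0r//; exact: ctC.
  - exact: ltW.
  - by apply: ct_pair => //; exact: ct_comb.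
  - exact: ctC.
  - by move=> x /Pl E; rewrite mulrA E !mul0r.
move=> x xab; have xab' : a <= x <= b by lra.
have e1 t : a <= t <= b -> 0 <= energy (fun=> alpha ^+ 2) (comb l F) (comb l F1) t.
  by move=> _; apply: addr_ge0; [exact: sqr_ge0|apply: mulr_ge0; exact: sqr_ge0].
have /eqP := prim_eq0 ab ce e1 e0 xab'.
have p0 : 0 <= alpha ^+ 2 * comb l F x ^+ 2 by apply: mulr_ge0; exact: sqr_ge0.
rewrite /energy paddr_eq0 ?sqr_ge0//.
by case/andP => _; rewrite mulf_eq0 !sqrf_eq0 (gt_eqF alpha0) => /eqP.
Qed.

(** Applying [relation_shift] once for each index [j] other than [i] multiplies
    the coefficients by [c - c j], which isolates the one of [i]. *)
Lemma eigenfunctions_independent k :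
  (forall x, a < x < b -> comb k F x = 0) -> forall i, k i = 0.
Proof.
have ab' := ab.
move=> k0 i; apply/eqP; apply/negPn/negP => ki.
have key (s : seq R) x : a < x < b -> comb (fun i => k i * \prod_(t <- s) (c i - t)) F x = 0.
  elim: s x => [|t s IH] x xab.
    by rewrite -[RHS](k0 x xab); apply: eq_bigr => j _; rewrite big_nil mulr1.
  set g := fun i => k i * \prod_(t <- s) (c i - t).
  have -> : comb (fun i => k i * \prod_(t0 <- t :: s) (c i - t0)) F x =
      comb (fun i => g i * c i) F x - t * comb g F x.
    rewrite /comb mulr_sumr -sumrB; apply: eq_bigr => j _.
    by rewrite big_cons /g; ring.
  by rewrite (relation_shift IH xab) (IH x xab) mulr0 subr0.
have := key [seq c j | j <- index_enum _ & j != i].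
have [[dFi _] Fia F1ia] := sF i.
have F1i0 : F1 i a != 0 by rewrite F1ia oner_neq0.
have ba0 : 0 < b - a by lra.
have [h hb [hp _]] := deriv_sign dFi (@cF1 i) Fia F1i0 ba0.
have ahb : a < a + h < b by lra.
move=> /(_ (a + h) ahb)/eqP; rewrite /comb (bigD1 i)//= [X in _ + X]big1.
  rewrite addr0 !mulf_eq0 (negbTE ki)/= => /orP[|/eqP E0]; last by rewrite E0 mul0r ltxx in hp.
  rewrite big_map big_filter prodf_seq_eq0 => /hasP[j _ /andP[ji]].
  by rewrite subr_eq0 (inj_eq cinj) eq_sym (negbTE ji).
move=> j ji; rewrite big_map big_filter.
suff /eqP -> : \prod_(t <- index_enum 'I_n | t != i) (c j - c t) == 0 by rewrite mulr0 mul0r.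
by rewrite prodf_seq_eq0; apply/hasP; exists j; rewrite ?mem_index_enum//= ji subrr eqxx.
Qed.

(** At most [size s] eigenvalues carry a nonnegative pairing when [P] is comparable
    to [U - ub]: on their span the form [int (P (U - ub) psi^2) - int (phi'^2 + alpha^2 phi^2)]
    is nonpositive, which bounds [int phi'^2] by [M int phi^2] and contradicts the
    Poincare inequality for functions vanishing on a fine enough grid. *)
Lemma nonneg_pairing_bound ub M (s : seq R) : 0 < M ->
  (forall i, c i <= ub) -> (forall x, a <= x <= b -> 0 <= P x * (U x - ub)) ->
  (forall x, a <= x <= b -> P x ^+ 2 <= M * (P x * (U x - ub))) ->
  (forall phi (phi1 : R -> R), Dv phi phi1 -> continuous phi1 ->
     (forall p, p \in s -> phi p = 0) -> 0 <= prim a (energy (fun=> - M) phi phi1) b) ->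
  (forall i, 0 <= pairing (psis i) (psis i)) ->
  (n <= size s)%N.
Proof.
have ab' := ab.
move=> M0 cub P0 PM grid D0; rewrite leqNgt; apply/negP => sn.
have [k [i ki] ks] := vanishing_combination F sn.
have := grid _ _ (Dv_comb k) (@ct_comb k F1 cF1) ks => G.
set f := comb k F in G ks *; set f1 := comb k F1 in G *; set ps := comb k psis.
have cf : continuous f by exact: ct_comb.
have cf1 : continuous f1 by exact: ct_comb.
have cps : continuous ps by exact: ct_comb.
have cU' : continuous (fun x => U x - ub) by exact: ct_Uc.
have EA := energy_comb k; rewrite -/f -/f1 -/ps in EA.
have cA : continuous (energy (fun=> alpha ^+ 2) f f1) by apply: ct_energy => //; exact: ctC.
have cM : continuous (energy (fun=> - M) f f1) by apply: ct_energy => //; exact: ctC.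
have cff : continuous (fun x => f x ^+ 2) by exact: ctX.
have cpf : continuous (fun x => P x * (ps x * f x)) by exact: ct_pair.
have cB : continuous (fun x => P x * (ps x * ((U x - ub) * ps x))).
  by apply: ct_pair => //; exact: ctM.
pose I2 := prim a (fun x => f x ^+ 2) b.
pose Bf := prim a (fun x => P x * (ps x * ((U x - ub) * ps x))) b.
(* the form is diagonal on the eigenfunctions *)
have LB : Bf - pairing ps f <= 0.
  rewrite /Bf /pairing -primB//.
  have -> : (fun x => P x * (ps x * ((U x - ub) * ps x)) - P x * (ps x * f x)) =
      fun x => P x * (ps x * comb (fun i => k i * (c i - ub)) psis x).
    apply/funext => x; rewrite -mulrBr; congr (_ * _); rewrite -mulrBr; congr (_ * _).
    rewrite /ps /f /comb mulr_sumr -sumrB; apply: eq_bigr => j _.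
    by rewrite /psi; field; rewrite Uc_neq0.
  rewrite -/(pairing ps _) pairing_comb; apply: sumr_le0 => j _.
  apply: mulr_le0_ge0; last exact: D0.
  by rewrite mulrA -expr2 mulr_ge0_le0 ?sqr_ge0// subr_le0.
have h2 : 2 * pairing ps f <= Bf + M * I2.
  rewrite /Bf /I2 /pairing -primZ// -primZ// -primD//; last by apply: ctM => //; exact: ctC.
  apply: le_prim; [exact: ltW|by apply: ctM => //; exact: ctC|..].
    by apply: ctD => //; apply: ctM => //; exact: ctC.
  move=> x xab; have xab' : a <= x <= b by lra.
  have := PM x xab'; move: (U x - ub) => h Ph.
  have h0 : 0 <= M * (P x * (ps x * (h * ps x)) + M * f x ^+ 2 - 2 * (P x * (ps x * f x))).
    have -> : M * (P x * (ps x * (h * ps x)) + M * f x ^+ 2 - 2 * (P x * (ps x * f x))) =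
      (M * f x - P x * ps x) ^+ 2 + (M * (P x * h) - P x ^+ 2) * ps x ^+ 2 by ring.
    by rewrite addr_ge0 ?sqr_ge0// mulr_ge0 ?sqr_ge0// subr_ge0.
  by rewrite pmulr_rge0// in h0; lra.
have E : prim a (energy (fun=> alpha ^+ 2) f f1) b =
    prim a (energy (fun=> - M) f f1) b + (alpha ^+ 2 + M) * I2.
  rewrite /I2 -primZ// -primD//; last by apply: ctM => //; exact: ctC.
  by congr (prim _ _ _); apply/funext => x; rewrite /energy; ring.
have a2 : 0 < alpha ^+ 2 by rewrite exprn_gt0.
have I20 : I2 <= 0.
  rewrite -(pmulr_rle0 _ a2); rewrite EA in E; lra.
have f0 x : a < x < b -> comb k F x = 0.
  move=> xab; have xab' : a <= x <= b by lra.
  have := prim_eq0 ab cff _ I20 xab'; move=> /(_ (fun t _ => sqr_ge0 (f t)))/eqP.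
  by rewrite sqrf_eq0 => /eqP.
by rewrite (eigenfunctions_independent f0) eqxx in ki.
Qed.

(** Above the curvature the pairing is positive on all eigenfunctions, so the
    form with potential [pot mu], [c i < mu < m], is negative on their span. *)
Lemma pos_pairing_bound (s : seq R) : (forall x, a <= x <= b -> 0 < P x) ->
  (forall mu phi (phi1 : R -> R), mu < m -> Dv phi phi1 -> continuous phi1 ->
     (forall p, p \in s -> phi p = 0) -> 0 <= prim a (energy (pot mu) phi phi1) b) ->
  (n <= size s)%N.
Proof.
have ab' := ab.
move=> P0 grid; rewrite leqNgt; apply/negP => sn.
have [k [i ki] ks] := vanishing_combination F sn.
have [mu cmu mum] : exists2 mu, forall i, c i < mu & mu < m.
  pose M0 := \big[Num.max/m - 1]_i c i.
  have M0m : M0 < m by apply: bigmax_lt => //; rewrite gtrBl.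
  exists ((M0 + m) / 2); last lra.
  by move=> j; have : c j <= M0 by [exact: le_bigmax]; lra.
have := grid _ _ _ mum (Dv_comb k) (@ct_comb k F1 cF1) ks => G.
set f := comb k F in G ks *; set f1 := comb k F1 in G *; set ps := comb k psis.
have cf : continuous f by exact: ct_comb.
have cf1 : continuous f1 by exact: ct_comb.
have cps : continuous ps by exact: ct_comb.
have EA := energy_comb k; rewrite -/f -/f1 -/ps in EA.
have cA : continuous (energy (fun=> alpha ^+ 2) f f1) by apply: ct_energy => //; exact: ctC.
have cQ : continuous (energy (pot mu) f f1) by apply: ct_energy => //; exact: ct_pot.
have cpf : continuous (fun x => P x * (ps x * f x)) by exact: ct_pair.
pose l j := k j * (mu - c j); pose chi := comb l psis.
have cchi : continuous chi by exact: ct_comb.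
have cw : continuous (fun x => P x * (psi mu chi x * chi x)) by apply: ct_pair => //; exact: ct_psi.
have cpc : continuous (fun x => P x * (ps x * chi x)) by exact: ct_pair.
have E : prim a (energy (pot mu) f f1) b = - (pairing ps chi + pairing (psi mu chi) chi).
  have -> : prim a (energy (pot mu) f f1) b = prim a (energy (fun=> alpha ^+ 2) f f1) b
      + - prim a (fun x => P x * (psi mu f x * f x)) b.
    have cpp : continuous (fun x => P x * (psi mu f x * f x)) by apply: ct_pair => //; exact: ct_psi.
    rewrite -primB//; congr (prim _ _ _); apply/funext => x.
    by rewrite /energy /pot /psi; field; rewrite Uc_neq0.
  have cpp : continuous (fun x => P x * (psi mu f x * f x)) by apply: ct_pair => //; exact: ct_psi.
  rewrite EA /pairing -primB// -primD// -primN; last by exact: ctD.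
  congr (prim _ _ _); apply/funext => x.
  have fE : f x = (U x - mu) * ps x + chi x.
    rewrite /f /ps /chi /comb mulr_sumr -big_split; apply: eq_bigr => j _.
    by rewrite /= /l /psi; field; rewrite Uc_neq0.
  by rewrite /psi fE; field; rewrite Uc_neq0.
have p1 : 0 < pairing ps chi.
  have D0 j : 0 < pairing (psis j) (psis j).
    have [[dFj _] Fja F1ja] := sF j.
    have F1j0 : F1 j a != 0 by rewrite F1ja oner_neq0.
    have ba0 : 0 < b - a by lra.
    have [h hb [hp _]] := deriv_sign dFj (@cF1 j) Fja F1j0 ba0.
    have Fj0 : F j (a + h) != 0 by apply/eqP => E0; rewrite E0 mul0r ltxx in hp.
    apply: (@prim_gt0 _ a b _ (a + h)) => //; first lra.
    - exact: ct_pair.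
    - by move=> t tab; rewrite mulr_ge0 ?(ltW (P0 t tab))// -expr2 sqr_ge0.
    - rewrite mulr_gt0 ?P0//; first lra.
      by rewrite -expr2 exprn_even_gt0//= /psi mulf_neq0// invr_eq0 Uc_neq0.
  rewrite /ps /chi pairing_comb (bigD1 i)//= ltr_pwDl//.
    rewrite mulr_gt0// /l mulrA mulr_gt0 ?subr_gt0//.
    by rewrite -expr2 exprn_even_gt0.
  apply: sumr_ge0 => j _; apply: mulr_ge0 (ltW (D0 j)).
  by rewrite /l mulrA -expr2 mulr_ge0 ?sqr_ge0// subr_ge0 ltW.
have p2 : 0 <= pairing (psi mu chi) chi.
  apply: prim_ge0 => //; first exact: ltW.
  move=> x xab; have xab' : a <= x <= b by lra.
  rewrite mulr_ge0 ?(ltW (P0 x xab'))// /psi mulrAC mulr_ge0 -?expr2 ?sqr_ge0//.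
  by rewrite invr_ge0 ltW// Uc_gt0.
by rewrite E in G; lra.
Qed.

End Family.

End Eigenfunctions.

(** * Oscillation criteria *)

Section Riccati.
Context {R : realType}.
Implicit Types (f v : R -> R) (x y p d e w : R).

Lemma riccati_der f (f1 : R -> R) v x : is_derive x 1 f (f1 x) ->
  is_derive x 1 f1 (v x * f x) -> f x != 0 ->
  is_derive x 1 (fun y => f1 y / f y) (v x - (f1 x / f x) ^+ 2).
Proof.
move=> df df1 fx; have := derM df1 (derV df fx).
by move/der_eq; apply; field.
Qed.

(** In a region where [f''/f <= 0] the Riccati quotient [f'/f] decreases and is
    controlled by the distance to the ends, which limits how deep the well can be
    if [f] has no zero. *)
Lemma well_depth f (f1 : R -> R) v p d e w : 0 < d -> 0 < e -> e <= d / 2 ->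
  (forall x, p - d <= x <= p + d ->
     [/\ is_derive x 1 f (f1 x), is_derive x 1 f1 (v x * f x), f x != 0 & v x <= 0]) ->
  (forall x, p - e <= x <= p + e -> v x <= - w) -> 2 * e * w <= 4 / d.
Proof.
move=> d0 e0 ed Hf Hw; pose Q x := f1 x / f x.
have dQ x : p - d <= x <= p + d -> is_derive x 1 Q (v x - Q x ^+ 2).
  by move=> /Hf[df df1 fx _]; exact: riccati_der.
have Qdec x y : p - d <= x -> x <= y -> y <= p + d -> Q y <= Q x.
  move=> dx xy yd; rewrite -lerN2.
  apply: (@der_le_cc _ (fun x => - Q x) (fun x => - (v x - Q x ^+ 2))) => //.
    by move=> t txy; apply: derN; apply: dQ; lra.
  move=> t txy; have [|_ _ _ vt] := Hf t; first lra.
  by rewrite opprB subr_ge0 (le_trans vt)// sqr_ge0.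
(* [1 / Q] has slope at least one *)
have slope x y : p - d <= x -> x <= y -> y <= p + d ->
    (forall t, x <= t <= y -> Q t != 0) -> y - x <= (Q y)^-1 - (Q x)^-1.
  move=> dx xy yd Q0.
  suff: (Q x)^-1 - x <= (Q y)^-1 - y by lra.
  apply: (@der_le_cc _ (fun x => (Q x)^-1 - x) (fun x => - (v x - Q x ^+ 2) / Q x ^+ 2 - 1)) => //.
    move=> t txy; have Qt := Q0 t txy; have tpd : p - d <= t <= p + d by lra.
    by have := derD (derV (dQ t tpd) Qt) (derN (derI t)).
  move=> t txy; have Qt := Q0 t txy.
  have [|_ _ _ vt] := Hf t; first lra.
  have -> : - (v t - Q t ^+ 2) / Q t ^+ 2 - 1 = - v t / Q t ^+ 2 by field.
  by rewrite divr_ge0 ?sqr_ge0// oppr_ge0.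
have left : Q (p - e) <= 2 / d.
  rewrite leNgt; apply/negP => q; have q0 : 0 < Q (p - e) by apply: lt_trans q; rewrite divr_gt0.
  have pos t : p - d <= t <= p - e -> 0 < Q t.
    by move=> tt; apply: lt_le_trans q0 _; apply: Qdec; lra.
  have := slope (p - d) (p - e); have Qd : 0 < (Q (p - d))^-1 by rewrite invr_gt0 pos//; lra.
  have : (Q (p - e))^-1 < d / 2 by rewrite -invf_div ltf_pV2// posrE divr_gt0.
  move=> h1 h2; suff: p - e - (p - d) <= (Q (p - e))^-1 - (Q (p - d))^-1 by lra.
  by apply: h2; [lra..|move=> t tt; rewrite gt_eqF// pos].
have right : - (2 / d) <= Q (p + e).
  rewrite leNgt; apply/negP => q.
  have q0 : Q (p + e) < 0 by apply: lt_trans q _; rewrite oppr_lt0 divr_gt0.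
  have neg t : p + e <= t <= p + d -> Q t < 0.
    by move=> tt; apply: le_lt_trans q0; apply: Qdec; lra.
  have := slope (p + e) (p + d); have Qd : (Q (p + d))^-1 < 0 by rewrite invr_lt0 neg//; lra.
  have : - (d / 2) < (Q (p + e))^-1.
    rewrite -invf_div -invrN ltf_nV2// ?negrE//.
    by rewrite oppr_lt0 divr_gt0.
  move=> h1 h2; suff: p + d - (p + e) <= (Q (p + d))^-1 - (Q (p + e))^-1 by lra.
  by apply: h2; [lra..|move=> t tt; rewrite lt_eqF// neg].
have drop : Q (p + e) + w * (p + e) <= Q (p - e) + w * (p - e).
  rewrite -lerN2; apply: (@der_le_cc _ (fun x => - (Q x + w * x)) (fun x => - (v x - Q x ^+ 2 + w))).
  - lra.
  - move=> t te; have te' : p - d <= t <= p + d by lra.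
    have := derN (derD (dQ t te') (derM (derC w t) (derI t))).
    by move/der_eq; apply; ring.
  - move=> t te; have := Hw t te; have := sqr_ge0 (Q t); lra.
have -> : 4 / d = 2 / d + 2 / d by ring.
lra.
Qed.

(** Supercritical inverse-square wells: [atan ((x f'/f - 1/2) / om) + om ln x] is
    nonincreasing, so a zero-free interval has bounded logarithmic length. *)
Lemma inverse_square_oscillation f (f1 : R -> R) v (om x1 x2 : R) : 0 < om -> 0 < x1 -> x1 <= x2 ->
  (forall x, x1 <= x <= x2 ->
     [/\ is_derive x 1 f (f1 x), is_derive x 1 f1 (v x * f x), f x != 0 &
       v x <= - ((4^-1 + om ^+ 2) / x ^+ 2)]) ->
  om * (ln x2 - ln x1) <= pi.
Proof.
move=> om0 x10 x12 Hf; pose z x := x * (f1 x / f x) - 2^-1.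
pose T x := atan (z x / om) + om * ln x.
have dz x : x1 <= x <= x2 -> is_derive x 1 z (f1 x / f x + x * (v x - (f1 x / f x) ^+ 2)).
  move=> /Hf[df df1 fx _].
  have := derD (derM (derI x) (riccati_der df df1 fx)) (derN (derC (2^-1 : R) x)).
  by move/der_eq; apply; ring.
pose T' x := (f1 x / f x + x * (v x - (f1 x / f x) ^+ 2)) / om * (1 + (z x / om) ^+ 2)^-1 + om / x.
have dT x : x1 <= x <= x2 -> is_derive x 1 T (T' x).
  move=> xx; have x0 : 0 < x by lra.
  have d1 := derM (dz x xx) (derC om^-1 x).
  have d2 := derComp d1 (is_derive1_atan (z x / om)).
  have := derD d2 (derM (derC om x) (is_derive1_ln x0)).
  by move/der_eq; apply; rewrite /T'; ring.
have T'0 x : x1 <= x <= x2 -> T' x <= 0.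
  move=> xx; have x0 : 0 < x by lra.
  have [_ _ _ vx] := Hf x xx.
  rewrite /T'; set q := f1 x / f x in vx *.
  have zz : 0 <= (z x / om) ^+ 2 by exact: sqr_ge0.
  have E : om / x = (om ^+ 2 + z x ^+ 2) / x / om * (1 + (z x / om) ^+ 2)^-1.
    field; rewrite !gt_eqF//=; have := sqr_ge0 (z x); have : 0 < om ^+ 2 by rewrite exprn_gt0.
    lra.
  rewrite E -mulrDl -mulrDl mulr_le0_ge0//; last by rewrite invr_ge0; lra.
  rewrite mulr_le0_ge0 ?invr_ge0 ?(ltW om0)//.
  have : x * v x <= - ((4^-1 + om ^+ 2) / x).
    have -> : - ((4^-1 + om ^+ 2) / x) = x * - ((4^-1 + om ^+ 2) / x ^+ 2) by field; rewrite gt_eqF.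
    by rewrite ler_wpM2l// ltW.
  have -> : (om ^+ 2 + z x ^+ 2) / x = (4^-1 + om ^+ 2) / x + x * q ^+ 2 - q.
    by rewrite /z -/q; field; rewrite gt_eqF.
  lra.
have : T x2 <= T x1.
  rewrite -lerN2; apply: (@der_le_cc _ (fun x => - T x) (fun x => - T' x)) => // x xx.
    by apply: derN; exact: dT.
  by rewrite oppr_ge0 T'0.
rewrite /T; have := atan_gtNpi2 (z x2 / om); have := atan_ltpi2 (z x1 / om).
lra.
Qed.

End Riccati.

(** * Eigenvalues below the range of a smooth profile *)

Section Profile.
Context {R : realType}.
Variables (a b m alpha beta : R) (u u1 u2 u3 : R -> R).
Hypotheses (ab : a < b) (alpha0 : 0 < alpha).
Hypotheses (du : Dv u u1) (du1 : Dv u1 u2) (du2 : Dv u2 u3) (cu3 : continuous u3).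
Hypothesis mu : forall x, a <= x <= b -> m <= u x.
Implicit Types (c x y p : R) (F : R -> R).

Definition profU x := u (clamp a b x).
Definition profP x := beta - u2 (clamp a b x).
Local Notation B := (b + 1).
Local Notation U := profU.
Local Notation P := profP.
Local Notation potc := (pot alpha U P).
Local Notation shotc := (shot a B alpha U P).

Let bB : b < B. Proof. by rewrite ltrDl. Qed.
Let aB : a < B. Proof. exact: lt_trans ab bB. Qed.
Let cU : continuous U. Proof. by apply: ct_clampC; exact: Dv_cont du. Qed.
Let cP : continuous P.
Proof. by apply: ctD; [exact: ctC|apply: ctN; apply: ct_clampC; exact: Dv_cont du2]. Qed.
Let mU x : m <= U x. Proof. by apply: mu; exact: clamp_itv. Qed.

(** Solutions with given data at [a] are unique, so it is enough to shoot from
    [a]; the equation is solved a bit beyond [b], in order to follow the zeros that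
    enter or leave through [b]. *)
Definition eigs : set R :=
  [set c | c < m /\ exists F (F1 : R -> R), shotc c F F1 /\ F b = 0].

Let V c := if c < m then potc c else fun=> 0.

Let cV c : continuous (V c).
Proof. by rewrite /V; case: ifP => cm; [exact: (ct_pot cU cP mU)|exact: ctC]. Qed.

Let Pbd : exists2 K : R, 0 < K & forall x, `|P x| <= K.
Proof.
have [K K0 HK] := cont_bounded a b cP; exists K => // x.
have -> : P x = P (clamp a b x) by rewrite /P (clamp_id (clamp_itv ab x)).
by apply: HK; exact: clamp_itv.
Qed.

Lemma inv_close c c' x : c < m -> c' < c + (m - c) / 2 ->
  `|(U x - c')^-1 - (U x - c)^-1| <= `|c' - c| * (2 / (m - c) ^+ 2).
Proof.
move=> cm c'm; have mUx := mU x.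
have d1 : 0 < U x - c' by lra.
have d2 : 0 < U x - c by lra.
have -> : (U x - c')^-1 - (U x - c)^-1 = (c' - c) * ((U x - c')^-1 * (U x - c)^-1).
  by field; rewrite !gt_eqF.
rewrite normrM ler_wpM2l// ger0_norm; last by rewrite mulr_ge0// invr_ge0 ltW.
have -> : 2 / (m - c) ^+ 2 = ((m - c) / 2)^-1 * (m - c)^-1.
  by field; rewrite gt_eqF// subr_gt0.
apply: ler_pM; rewrite ?invr_ge0 ?(ltW d1) ?(ltW d2)//.
  by rewrite lef_pV2 ?posrE//; lra.
by rewrite lef_pV2 ?posrE//; lra.
Qed.

Lemma inv_close_near c (e : R) : c < m -> 0 < e ->
  \forall c' \near c, forall x, `|(U x - c')^-1 - (U x - c)^-1| < e.
Proof.
move=> cm e0; have mc : 0 < m - c by rewrite subr_gt0.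
pose k := 2 / (m - c) ^+ 2; have k0 : 0 < k by rewrite divr_gt0// exprn_gt0.
pose d := Num.min ((m - c) / 2) (e / k).
have [d1 d2] : d <= (m - c) / 2 /\ d <= e / k by rewrite !ge_min !lexx orbT.
have d0 : 0 < d by rewrite lt_min; apply/andP; split; exact: divr_gt0.
apply: (near_dist d0) => c' c'd x; apply: le_lt_trans (inv_close x cm _) _.
  by move: c'd; rewrite ltr_norml; lra.
rewrite -ltr_pdivlMr//; exact: lt_le_trans d2.
Qed.

Let HV c (e : R) : c < m -> 0 < e ->
  \forall c' \near c, forall x, a <= x <= B -> `|V c' x - V c x| < e.
Proof.
move=> cm e0; have [K K0 HK] := Pbd.
have eK : 0 < e / K by rewrite divr_gt0.
apply: filterS2 (inv_close_near cm eK) (lt_nbhsl cm) => c' Hc' c'm x _.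
rewrite /V cm c'm /pot.
have -> : alpha ^+ 2 - P x / (U x - c') - (alpha ^+ 2 - P x / (U x - c)) =
  - (P x * ((U x - c')^-1 - (U x - c)^-1)) by ring.
rewrite normrN normrM; apply: (le_lt_trans (ler_wpM2r _ (HK x))) => //.
by rewrite mulrC -ltr_pdivlMr.
Qed.

(** The solutions shot from [a] at all [c < m] as one family, to which the
    counting of zeros applies; beyond [m] the potential is replaced by 0, for the
    sake of a total function of [c]. *)
Lemma shooting_family : exists S S1 : R -> R -> R,
  [/\ forall c, Dv (S c) (S1 c), forall c, continuous (S1 c),
      forall c, c < m -> shotc c (S c) (S1 c),
      forall c x, c < m -> a <= x <= B -> S c x = 0 -> S1 c x != 0 &
      forall c (e : R), c < m -> 0 < e -> \forall c' \near c, forall x, a <= x <= B ->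
        `|S c' x - S c x| < e /\ `|S1 c' x - S1 c x| < e].
Proof.
have /choice[SS HSS] : forall c, exists SS : (R -> R) * (R -> R),
    [/\ solves a B (V c) SS.1 SS.2, SS.1 a = 0 & SS.2 a = 1].
  by move=> c; have [S [S1 H]] := ivp aB 0 1 (@cV c); exists (S, S1).
exists (fun c => (SS c).1), (fun c => (SS c).2); split.
- by move=> c; have [[]] := HSS c.
- by move=> c; have [[_ /Dv_cont]] := HSS c.
- by move=> c cm; have := HSS c; rewrite /V cm.
- move=> c x cm xaB Sx; apply/eqP => S1x.
  have [sS _ S1a] := HSS c.
  have [_ E] := solution_simple_zero (@cV c) sS xaB Sx S1x.
  by move: S1a; rewrite E => /esym/eqP; rewrite oner_eq0.
- exact: (solutions_depend_continuously aB cV HV HSS).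
Qed.

Lemma shot_unique c F (F1 : R -> R) G (G1 : R -> R) : c < m -> shotc c F F1 -> shotc c G G1 ->
  forall x, a <= x <= B -> F x = G x /\ F1 x = G1 x.
Proof.
move=> cm [[dF dF1] Fa F1a] [[dG dG1] Ga G1a] x xaB.
have cp : continuous (potc c) by exact: (ct_pot cU cP mU cm).
have [M M0 HM] := cont_bounded a B cp.
have [C C0 HC] := ivp_bound aB (ltW M0).
have dW : Dv (fun t => F t - G t) (fun t => F1 t - G1 t).
  by move=> t; exact: derD (dF t) (derN (dG t)).
have dW1 : Dv (fun t => F1 t - G1 t) (fun t => potc c t * (F (clamp a B t) - G (clamp a B t)) + 0).
  by move=> t; apply: (der_eq (derD (dF1 t) (derN (dG1 t)))); ring.
have r0 : forall t, a <= t <= B -> `|0 : R| <= 0 by move=> t _; rewrite normr0.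
have Wa : F a - G a = 0 by rewrite Fa Ga subrr.
have W1a : F1 a - G1 a = 0 by rewrite F1a G1a subrr.
have [] := HC _ _ _ _ 0 cp (ctC 0) (lexx 0) HM r0 dW dW1 Wa W1a x xaB.
by rewrite mulr0 !normr_le0 !subr_eq0 => /eqP-> /eqP->.
Qed.

(** Far below the profile the potential is positive. *)
Lemma no_zeros_far_below : exists c1 : R, forall c, c <= c1 -> c < m /\
  forall F (F1 : R -> R), shotc c F F1 -> zeros_le F `]a, b] 0.
Proof.
have [K K0 HK] := Pbd; have a2 : 0 < alpha ^+ 2 by rewrite exprn_gt0.
exists (m - K / alpha ^+ 2) => c cc.
have Ka : 0 < K / alpha ^+ 2 by rewrite divr_gt0.
have cm : c < m by lra.
split=> // F F1 [sF Fa F1a] s [us zs].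
case: s us zs => // x s _ /(_ x (mem_head _ _))[]; rewrite in_itv/= => xab Fx.
have ab' := ab; exfalso.
have p0 t : a <= t <= B -> 0 <= potc c t.
  move=> _; have Ut : 0 < U t - c by exact: (Uc_gt0 mU _ cm).
  rewrite /pot subr_ge0 ler_pdivrMr//.
  apply: le_trans (ler_norm _) _; apply: le_trans (HK t) _.
  rewrite mulrC -ler_pdivrMr//; have := mU t; lra.
have xaB : a < x <= B by lra.
by have := solution_nonosc sF p0 Fa F1a xaB; rewrite Fx eqxx.
Qed.

(** The potential is positive. *)
Lemma eigs_below_curvature : (forall x, a <= x <= b -> beta < u2 x) -> eigs = set0.
Proof.
move=> bu; apply/seteqP; split=> // c [cm [F [F1 [[sF Fa F1a] Fb]]]].
have p0 t : a <= t <= B -> 0 <= potc c t.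
  move=> _; have Ut : 0 < U t - c by exact: (Uc_gt0 mU _ cm).
  rewrite /pot addr_ge0 ?sqr_ge0// oppr_ge0 mulr_le0_ge0 ?invr_ge0 ?(ltW Ut)//.
  by rewrite /P subr_le0 ltW// bu// clamp_itv.
have baB : a < b <= B by rewrite ab ltW.
by have := solution_nonosc sF p0 Fa F1a baB; rewrite Fb eqxx.
Qed.

Lemma eigs_list_family (s : seq R) (A : R -> (R -> R) -> Prop) : uniq s ->
  (forall c, c \in s -> c < m /\ exists F (F1 : R -> R), [/\ shotc c F F1, F b = 0 & A c F]) ->
  exists (c : 'I_(size s) -> R) (F F1 : 'I_(size s) -> R -> R),
    [/\ injective c, forall i, c i < m, forall i, shotc (c i) (F i) (F1 i),
        forall i, F i b = 0 & forall i, A (c i) (F i)].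
Proof.
move=> us Hs; pose c (i : 'I_(size s)) := nth 0 s i.
have cs i : c i \in s by exact: mem_nth.
have /choice[FF HFF] : forall i, exists FF : (R -> R) * (R -> R),
    [/\ shotc (c i) FF.1 FF.2, FF.1 b = 0 & A (c i) FF.1].
  by move=> i; have [_ [F [F1 H]]] := Hs _ (cs i); exists (F, F1).
exists c, (fun i => (FF i).1), (fun i => (FF i).2); split.
- by move=> i j /eqP; rewrite nth_uniq// => /eqP/val_inj.
- by move=> i; have [] := Hs _ (cs i).
- by move=> i; have [] := HFF i.
- by move=> i; have [] := HFF i.
- by move=> i; have [] := HFF i.
Qed.

Local Notation pairs := (fun c (F : R -> R) => pairing a b P (psi U c F) (psi U c F)).

(** By the Wronskian identity, [S c' b * S1 c b] is [c' - c] times a pairing of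
    nearby solutions, whose sign is the one of the pairing at [c]. *)
Lemma crossing (S S1 : R -> R -> R) c :
  (forall c, c < m -> shotc c (S c) (S1 c)) ->
  (forall c (e : R), c < m -> 0 < e -> \forall c' \near c, forall x, a <= x <= B ->
     `|S c' x - S c x| < e /\ `|S1 c' x - S1 c x| < e) ->
  c < m -> S c b = 0 -> pairs c (S c) < 0 ->
  \forall c' \near c, (c' < c -> 0 < S c' b * S1 c b) /\ (c < c' -> S c' b * S1 c b < 0).
Proof.
move=> HS Hdep cm Sb neg.
have [cSc _] := shot_cont (HS c cm).
set D := pairs c (S c) in neg.
have cpsi := ct_psi cU mU cm cSc.
have [K1 K10 HK1] := Pbd.
have [K2 K20 HK2] := cont_bounded a b cpsi.
have [K3 K30 HK3] := cont_bounded a b cSc.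
have ci : continuous (fun x => (U x - c)^-1) by exact: (ct_invUc cU mU cm).
have [K4 K40 HK4] := cont_bounded a b ci.
pose e := - D / (2 * (K1 * K2 * (b - a))).
have L0 : 0 < b - a by rewrite subr_gt0.
have e0 : 0 < e by rewrite divr_gt0 ?oppr_gt0// !mulr_gt0.
pose e1 := e / (2 * (K4 + 1)).
have e10 : 0 < e1 by rewrite divr_gt0// mulr_gt0// addr_gt0.
pose e2 := Num.min 1 (e / (2 * K3)).
have [e21 e22] : e2 <= 1 /\ e2 <= e / (2 * K3) by rewrite !ge_min !lexx orbT.
have e20 : 0 < e2 by rewrite lt_min ltr01 divr_gt0// mulr_gt0.
apply: filterS3 (Hdep c e1 cm e10) (inv_close_near cm e20) (lt_nbhsl cm) => c' H1 H2 c'm.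
have [cSc' _] := shot_cont (HS c' c'm).
have cpsi' := ct_psi cU mU c'm cSc'.
have close x : a < x < b -> `|psi U c' (S c') x - psi U c (S c) x| <= e.
  move=> /andP[ax xb]; have xab : a <= x <= b by rewrite !ltW.
  have xaB : a <= x <= B by rewrite (ltW ax)/= (le_trans (ltW xb))// ltW.
  have -> : psi U c' (S c') x - psi U c (S c) x =
    (S c' x - S c x) * (U x - c')^-1 + S c x * ((U x - c')^-1 - (U x - c)^-1).
    by rewrite /psi; ring.
  have i1 : `|(U x - c')^-1| <= K4 + 1.
    rewrite -(subrK (U x - c)^-1 (U x - c')^-1).
    apply: le_trans (ler_normD _ _) _; rewrite addrC.
    by apply: lerD; [exact: HK4|exact: le_trans (ltW (H2 x)) e21].
  have h1 : `|(S c' x - S c x) * (U x - c')^-1| <= e / 2.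
    rewrite normrM; have -> : e / 2 = e1 * (K4 + 1).
      by rewrite /e1; field; rewrite gt_eqF// addr_gt0.
    by apply: ler_pM => //; have [/ltW] := H1 x xaB.
  have h2 : `|S c x * ((U x - c')^-1 - (U x - c)^-1)| <= e / 2.
    rewrite normrM; have -> : e / 2 = K3 * (e / (2 * K3)).
      by field; rewrite gt_eqF.
    by apply: ler_pM => //; [exact: HK3|exact: le_trans (ltW (H2 x)) e22].
  apply: le_trans (ler_normD _ _) _; lra.
have W := wronskian ab bB cU cP mU cm c'm (HS c cm) (HS c' c'm).
rewrite Sb mul0r subr0 in W.
have Q : pairing a b P (psi U c (S c)) (psi U c' (S c')) < 0.
  have c1 : continuous (fun x => P x * (psi U c (S c) x * psi U c' (S c') x)) by exact: ct_pair.
  have c2 : continuous (fun x => P x * (psi U c (S c) x * psi U c (S c) x)) by exact: ct_pair.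
  have : `|pairing a b P (psi U c (S c)) (psi U c' (S c')) - D| <= K1 * K2 * e * (b - a).
    rewrite /D /pairing -primB//.
    apply: prim_norm; [exact: ltW|by apply: ctD => //; exact: ctN|].
    move=> x xab; have xab' : a <= x <= b by lra.
    have -> : P x * (psi U c (S c) x * psi U c' (S c') x) - P x * (psi U c (S c) x * psi U c (S c) x)
      = (P x * psi U c (S c) x) * (psi U c' (S c') x - psi U c (S c) x) by ring.
    rewrite normrM; apply: ler_pM => //; last exact: close.
    by rewrite normrM; apply: ler_pM => //; exact: HK2.
  have -> : K1 * K2 * e * (b - a) = - D / 2 by rewrite /e; field; rewrite !gt_eqF.
  by rewrite ler_norml; lra.
rewrite [S c' b * _]mulrC -W; split=> cc'.
  by rewrite nmulr_lgt0// subr_lt0.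
by rewrite pmulr_rlt0// subr_gt0.
Qed.

(** The eigenvalues with a nonnegative pairing are finitely many, by
    [nonneg_pairing_bound] with a grid fine enough for Poincare's inequality with
    constant [M]; at the others the crossing direction is fixed. *)
Lemma eigs_finite_in_range ub M : 0 < M -> m <= ub ->
  (forall x, a <= x <= b -> 0 <= (beta - u2 x) * (u x - ub)) ->
  (forall x, a <= x <= b -> (beta - u2 x) ^+ 2 <= M * ((beta - u2 x) * (u x - ub))) ->
  finite_set eigs.
Proof.
move=> M0 mub P0 PM.
have [S [S1 [dS cS1 sS simple dep]]] := shooting_family.
have Sa c : c < m -> S c a = 0 by move=> /sS[].
have [c1 Hc1] := no_zeros_far_below.
have Hc1' c : c <= c1 -> zeros_le (S c) `]a, b] 0.
  by move=> /Hc1[cm H]; exact: H (sS c cm).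
pose Em := [set c | c < m /\ exists F (F1 : R -> R), [/\ shotc c F F1, F b = 0 & 0 <= pairs c F]].
have fEm : finite_set Em.
  have [|s Hs] := @interpolation_grid R a b (fun V => V = fun=> - M) ab.
    move=> p pab; exists 1, M; split; rewrite ?ltr01 ?(ltW M0)//.
    move=> V0 x -> xab xp x1; have xp0 : 0 < `|x - p| by rewrite normr_gt0 subr_eq0.
    have h1 : M <= M / `|x - p|.
      by rewrite ler_pdivlMr// ler_piMr ?(ltW M0)// ltW.
    have h2 : 0 <= (4 * (x - p) ^+ 2)^-1 by rewrite invr_ge0 mulr_ge0// sqr_ge0.
    lra.
  apply: (@finite_bounded_lists _ _ (size s)) => l ul Hl.
  have [c [F [F1 [cinj cm sF Fb A]]]] := eigs_list_family ul Hl.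
  apply: (nonneg_pairing_bound ab bB alpha0 cU cP mU cm cinj sF Fb M0
    (fun i => le_trans (ltW (cm i)) mub) _ _ _ A (s := s)).
  - by move=> x xab; rewrite /P /U clamp_id//; exact: P0.
  - by move=> x xab; rewrite /P /U clamp_id//; exact: PM.
  - by move=> phi phi1 dphi cphi1 phis; apply: (Hs (fun=> - M)) => //; exact: ctC.
have := eigenvalues_finite ab bB dS cS1 Sa simple dep fEm Hc1' _.
have cross c : c < m -> S c b = 0 -> ~ Em c -> \forall c' \near c,
     (c' < c -> 0 < S c' b * S1 c b) /\ (c < c' -> S c' b * S1 c b < 0).
  move=> cm Sb nEm; apply: crossing => //.
  rewrite ltNge; apply/negP => D0; apply: nEm; split=> //.
  by exists (S c), (S1 c); split=> //; exact: sS.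
move=> /(_ cross); apply: sub_finite_set => c [cm [F [F1 [sF Fb]]]]; split=> //.
have baB : a <= b <= B by rewrite !ltW.
by have [<- _] := shot_unique cm sF (sS c cm) baB.
Qed.


Lemma taylor2_ge (f f1 f2 : R -> R) p x (k : R) : Dv f f1 -> Dv f1 f2 -> f1 p = 0 ->
  (forall t, `|t - p| <= `|x - p| -> k <= f2 t) -> f p + k / 2 * (x - p) ^+ 2 <= f x.
Proof.
have right (g g1 g2 : R -> R) q z : Dv g g1 -> Dv g1 g2 -> g1 q = 0 -> q <= z ->
    (forall t, q <= t <= z -> k <= g2 t) -> g q + k / 2 * (z - q) ^+ 2 <= g z.
  move=> dg dg1 g1q qz Hk.
  have dl (t : R) : is_derive t 1 (fun t => k * (t - q)) k.
    by apply: (der_eq (derM (derC k t) (derD (derI t) (derN (derC q t))))); ring.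
  have dq (t : R) : is_derive t 1 (fun t => k / 2 * (t - q) ^+ 2) (k * (t - q)).
    apply: (der_eq (derM (derC (k / 2) t) (derX2 (derD (derI t) (derN (derC q t)))))).
    by field.
  have h1 t : q <= t <= z -> k * (t - q) <= g1 t.
    move=> /andP[qt tz]; have := Dv_le2 qt dl dg1 _; rewrite subrr mulr0 g1q !subr0; apply.
    by move=> s sq; apply: Hk; lra.
  have := Dv_le2 qz dq dg _; rewrite subrr expr0n/= mulr0 subr0 => H.
  have : k / 2 * (z - q) ^+ 2 <= g z - g q by apply: H => t tqz; apply: h1; lra.
  lra.
move=> df df1 f1p Hk; case: (leP p x) => [px|/ltW xp].
  apply: right px _ => // t tpx; apply: Hk; rewrite !ger0_norm; lra.
have dneg (t : R) : is_derive t 1 (fun x : R => - x) (-1) by exact: derN (derI t).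
have := right (fun t => f (- t)) (fun t => - f1 (- t)) (fun t => f2 (- t)) (- p) (- x).
rewrite !opprK (_ : (- x + p) ^+ 2 = (x - p) ^+ 2); last by ring.
apply.
- by move=> t; apply: (der_eq (derComp (dneg t) (df (- t)))); rewrite mulN1r.
- move=> t; apply: (der_eq (derN (derComp (dneg t) (df1 (- t))))).
  by rewrite mulN1r opprK.
- by rewrite f1p oppr0.
- by rewrite lerN2.
- by move=> t tt; apply: Hk; rewrite !ler0_norm; lra.
Qed.

Lemma taylor2_le (f f1 f2 : R -> R) p x (k : R) : Dv f f1 -> Dv f1 f2 -> f1 p = 0 ->
  (forall t, `|t - p| <= `|x - p| -> f2 t <= k) -> f x <= f p + k / 2 * (x - p) ^+ 2.
Proof.
move=> df df1 f1p Hk.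
have := @taylor2_ge (fun t => - f t) (fun t => - f1 t) (fun t => - f2 t) p x (- k).
have dfN : Dv (fun t => - f t) (fun t => - f1 t) by move=> t; exact: derN.
have df1N : Dv (fun t => - f1 t) (fun t => - f2 t) by move=> t; exact: derN.
have E : - f1 p = 0 by rewrite f1p oppr0.
move=> /(_ dfN df1N E) H.
have : - f p + - k / 2 * (x - p) ^+ 2 <= - f x by apply: H => t /Hk; rewrite lerN2.
lra.
Qed.

Let u2_lip : exists2 L : R, 0 < L & forall p x, a - 1 <= p <= b + 1 -> a - 1 <= x <= b + 1 ->
  `|u2 x - u2 p| <= L * `|x - p|.
Proof.
have [L L0 HL] := cont_bounded (a - 1) (b + 1) cu3; exists L => //.
have main p x : a - 1 <= p <= b + 1 -> a - 1 <= x <= b + 1 -> p <= x -> `|u2 x - u2 p| <= L * (x - p).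
  move=> pab xab; rewrite le_eqVlt => /predU1P[->|px]; first by rewrite !subrr normr0 mulr0.
  have [z pz ->] := Dv_mvt px du2; rewrite normrM (ger0_norm (x := x - p)); last lra.
  by rewrite ler_wpM2r//; [lra|apply: HL; lra].
move=> p x pab xab; case: (leP p x) => [px|/ltW xp].
  by rewrite (ger0_norm (x := x - p)) ?subr_ge0//; exact: main.
by rewrite distrC (ler0_norm (x := x - p)) ?subr_le0// opprB; exact: main.
Qed.

(** [pos_pairing_bound] requires a grid on which all the potentials [pot mu] are
    dominated by Hardy's. Only the points where [u] is minimal matter: if [u'] is
    nonzero there, [pot mu] is at worst [- C / |x - p|]; at a critical minimum,
    [P / (u - m)] is at most [2 (beta - u'') / (u'' (x - p)^2)] up to lower order
    terms, and [2 (beta / u'' - 1) <= 1/4] means [beta <= 9/8 u'']. *)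
Lemma eigs_finite_above : (forall x, a <= x <= b -> u2 x < beta) ->
  (forall p, a <= p <= b -> u p = m -> u1 p = 0 -> beta <= 9 / 8 * u2 p) -> finite_set eigs.
Proof.
have ab' := ab.
move=> ub hardy; have [K K0 HK] := Pbd; have [L L0 HL] := u2_lip.
have Ppos x : a <= x <= b -> 0 < P x by move=> xab; rewrite /profP clamp_id// subr_gt0 ub.
(* it suffices to bound [P / (u - m)] *)
have reduce p (d C : R) : 0 < d -> 0 <= C ->
    (forall x, a <= x <= b -> x != p -> `|x - p| < d -> 0 < u x - m /\
      P x <= ((4 * (x - p) ^+ 2)^-1 + C / `|x - p|) * (u x - m)) ->
    exists d C : R, [/\ 0 < d, 0 <= C & forall V x, (exists2 mu, mu < m & V = potc mu) ->
      a <= x <= b -> x != p -> `|x - p| < d -> - (4 * (x - p) ^+ 2)^-1 - C / `|x - p| <= V x].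
  move=> d0 C0 H; exists d, C; split=> // W x [mu0 mum ->] xab xp xd.
  have [um Px] := H x xab xp xd.
  have Uu : U x = u x by rewrite /profU clamp_id.
  have : P x / (U x - mu0) <= (4 * (x - p) ^+ 2)^-1 + C / `|x - p|.
    rewrite Uu ler_pdivrMr; last lra.
    apply: le_trans Px _; rewrite ler_wpM2l//; last lra.
    apply: addr_ge0; last by rewrite divr_ge0.
    by rewrite invr_ge0; apply: mulr_ge0 => //; exact: sqr_ge0.
  by rewrite /pot; have := sqr_ge0 alpha; lra.
have [|s Hs] := @interpolation_grid R a b (fun V => exists2 mu, mu < m & V = potc mu) ab.
  move=> p pab; have := mu pab; rewrite le_eqVlt => /predU1P[upm|upm]; last first.
    pose e := (u p - m) / 2; have e0 : 0 < e by rewrite divr_gt0// subr_gt0.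
    have /cvgrPdist_lt/(_ _ e0)/nbhs_dist[d d0 Hd] := @Dv_cont _ _ _ du p.
    apply: (reduce p (Num.min d 1) (K / e)).
    - by rewrite lt_min d0 ltr01.
    - by rewrite divr_ge0// ltW.
    - move=> x xab xp; rewrite lt_min => /andP[xd x1].
      have xp0 : 0 < `|x - p| by rewrite normr_gt0 subr_eq0.
      have := Hd x xd; rewrite ltr_norml => ux.
      have ue : e <= u x - m by rewrite /e in ux *; lra.
      split; first lra.
      apply: le_trans (ler_norm _) _; apply: le_trans (HK x) _.
      apply: (@le_trans _ _ (K / e / `|x - p| * (u x - m))).
        rewrite -ler_pdivrMl; last exact: divr_gt0 (divr_gt0 K0 e0) xp0.
        have -> : (K / e / `|x - p|)^-1 * K = e * `|x - p| by field; rewrite !gt_eqF.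
        by apply: le_trans ue; rewrite ler_piMr ?(ltW e0)// ltW.
      rewrite ler_wpM2r//; first lra.
      by rewrite lerDr invr_ge0 mulr_ge0// sqr_ge0.
  have [u1p|u1p] := eqVneq (u1 p) 0; last first.
    pose q := `|u1 p| / 2; have q0 : 0 < q by rewrite divr_gt0// normr_gt0.
    have /cvgrPdist_lt/(_ _ q0)/nbhs_dist[d d0 Hd] := @Dv_cont _ _ _ du1 p.
    have big t : `|t - p| < d -> q <= `|u1 t|.
      move=> /Hd; have := ler_normD (u1 p - u1 t) (u1 t); rewrite subrK /q; lra.
    apply: (reduce p d (K / q)) => //; first by rewrite divr_ge0// ltW.
    move=> x xab xp xd; have xp0 : 0 < `|x - p| by rewrite normr_gt0 subr_eq0.
    have uq : q * `|x - p| <= u x - m.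
      rewrite upm -[leRHS]ger0_norm; last by rewrite subr_ge0 -upm mu.
      case: (ltgtP p x) xp => // [px|xp'] _.
        have [z pz ->] := Dv_mvt px du; rewrite normrM ler_wpM2r//.
        by apply: big; move: xd; rewrite !gtr0_norm; lra.
      have [z pz E] := Dv_mvt xp' du; rewrite (distrC (u x)) E normrM (distrC p x) ler_wpM2r//.
      by apply: big; move: xd; rewrite !ltr0_norm; lra.
    have qx : 0 < q * `|x - p| by rewrite mulr_gt0.
    split; first lra.
    apply: le_trans (ler_norm _) _; apply: le_trans (HK x) _.
    apply: (@le_trans _ _ (K / q / `|x - p| * (u x - m))).
      rewrite -ler_pdivrMl; last exact: divr_gt0 (divr_gt0 K0 q0) xp0.
      by have -> : (K / q / `|x - p|)^-1 * K = q * `|x - p| by field; rewrite !gt_eqF.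
    rewrite ler_wpM2r//; first lra.
    by rewrite lerDr invr_ge0 mulr_ge0// sqr_ge0.
  pose k := u2 p; have bk := hardy p pab (esym upm) u1p.
  have k0 : 0 < k by have := ub p pab; rewrite /k; lra.
  pose C := 9 * L / (2 * k).
  have C0 : 0 < C by rewrite divr_gt0// mulr_gt0.
  pose d := Num.min 1 (k / (2 * L)).
  have [d1 dk] : d <= 1 /\ d <= k / (2 * L) by rewrite !ge_min !lexx orbT.
  have d0 : 0 < d by rewrite lt_min ltr01 divr_gt0// mulr_gt0.
  apply: (reduce p d C) => //; first exact: ltW.
  move=> x xab xp xd; set y := `|x - p|.
  have y0 : 0 < y by rewrite normr_gt0 subr_eq0.
  have Ly : L * y <= k / 2.
    have : y <= k / (2 * L) by apply: ltW; exact: lt_le_trans dk.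
    by rewrite ler_pdivlMr ?mulr_gt0//; lra.
  have y1 : y <= 1 by apply: ltW; exact: lt_le_trans d1.
  have near_u2 t : `|t - p| <= y -> `|u2 t - k| <= L * y.
    move=> tp; apply: le_trans (HL p t _ _) _; first by lra.
      by move: tp; rewrite ler_norml; lra.
    by rewrite ler_wpM2l// ltW.
  have T : u p + (k - L * y) / 2 * (x - p) ^+ 2 <= u x.
    apply: taylor2_ge du du1 u1p _ => t /near_u2; rewrite ler_norml; lra.
  have y2 : (x - p) ^+ 2 = y ^+ 2 by rewrite /y real_normK// num_real.
  rewrite y2 in T *; rewrite -upm in T.
  have yy : 0 < y ^+ 2 by rewrite exprn_gt0.
  have kL : 0 < (k - L * y) / 2 by lra.
  have low : 0 < (k - L * y) / 2 * y ^+ 2 by rewrite mulr_gt0.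
  split; first lra.
  have Px : P x <= k / 8 + L * y.
    have : `|u2 x - k| <= L * y by apply: near_u2.
    by rewrite /profP clamp_id// ler_norml -/k; rewrite -/k in bk; lra.
  apply: le_trans Px _.
  apply: (@le_trans _ _ (((4 * y ^+ 2)^-1 + C / y) * ((k - L * y) / 2 * y ^+ 2))).
    have -> : ((4 * y ^+ 2)^-1 + C / y) * ((k - L * y) / 2 * y ^+ 2) =
       (k - L * y) / 8 + C * y * ((k - L * y) / 2) by field; rewrite gt_eqF.
    have h1 : C * y * (k / 4) <= C * y * ((k - L * y) / 2).
      by apply: ler_wpM2l; [rewrite mulr_ge0// ltW|lra].
    have h2 : C * y * (k / 4) = 9 / 8 * (L * y) by rewrite /C; field; rewrite gt_eqF.
    lra.
  rewrite ler_wpM2l//; last lra.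
  apply: addr_ge0; last by rewrite divr_ge0 ?(ltW C0) ?(ltW y0).
  by rewrite invr_ge0; apply: mulr_ge0 => //; exact: sqr_ge0.
apply: (@finite_bounded_lists _ _ (size s)) => l ul Hl.
have Hl' c : c \in l -> c < m /\ exists F (F1 : R -> R), [/\ shotc c F F1, F b = 0 & True].
  by move=> /Hl[cm [F [F1 [sF Fb]]]]; split=> //; exists F, F1.
have [c [F [F1 [cinj cm sF Fb _]]]] := eigs_list_family (A := fun _ _ => True) ul Hl'.
apply: (pos_pairing_bound ab bB cU cP mU cm cinj sF Fb (s := s)) => //.
move=> mu0 phi phi1 mum dphi cphi1 phis; apply: Hs => //; first by exists mu0.
exact: (ct_pot cU cP mU mum).
Qed.

(** Decreasing [c] from [c0] makes all zeros leave through [b]. *)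
Lemma eigs_of_zeros n : (exists2 c0, c0 < m &
    forall F (F1 : R -> R), shotc c0 F F1 -> zeros_ge F `]a, b[ n) ->
  exists s : seq R, [/\ uniq s, size s = n & forall c, c \in s -> eigs c].
Proof.
move=> [c0 c0m Hz].
have [S [S1 [dS cS1 sS simple dep]]] := shooting_family.
have Sa c : c < m -> S c a = 0 by move=> /sS[].
have [c1 Hc1] := no_zeros_far_below.
have Hc1' c : c <= c1 -> zeros_le (S c) `]a, b] 0.
  by move=> /Hc1[cm H]; exact: H (sS c cm).
have [s [us sn Hs]] := eigenvalues_from_zeros ab bB dS cS1 Sa simple dep c0m Hc1' (Hz _ _ (sS c0 c0m)).
exists s; split=> // c /Hs[cc0 Sb]; have cm := le_lt_trans cc0 c0m; split=> //.
by exists (S c), (S1 c); split=> //; exact: sS.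
Qed.

Lemma interior_min_critical p : a < p < b -> u p = m -> u1 p = 0.
Proof.
move=> pab upm; have ab' := ab.
apply/eqP; apply/negPn/negP => u1p.
have dum : Dv (fun x => u x - m) u1.
  by move=> x; apply: (der_eq (derD (du x) (derN (derC m x)))); rewrite subr0.
pose r := Num.min (p - a) (b - p).
have [ra rb] : r <= p - a /\ r <= b - p by rewrite !ge_min !lexx orbT.
have r0 : 0 < r by rewrite lt_min; lra.
have um0 : u p - m = 0 by rewrite upm subrr.
have [h hr [hp hn]] := deriv_sign dum (Dv_cont du1) um0 u1p r0.
have g1 : 0 <= u (p + h) - m by rewrite subr_ge0 mu//; lra.
have g2 : 0 <= u (p - h) - m by rewrite subr_ge0 mu//; lra.
case: (ltP 0 (u1 p)) => [q|q].
  by move: hn; rewrite pmulr_llt0// ltNge g2.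
by move: hp; rewrite ltNge mulr_ge0_le0.
Qed.

(** At an interior minimum with [u'' < beta] the potential contains a well whose
    depth times width is unbounded as [c] tends to the minimum. *)
Lemma zero_near_minimum p (d : R) : a < p < b -> u p = m -> u2 p < beta -> 0 < d ->
  exists2 c0, c0 < m & forall c F (F1 : R -> R), c0 <= c < m -> shotc c F F1 ->
    exists z, [/\ `|z - p| < d, a < z < b & F z = 0].
Proof.
move=> pab upm u2p d0; have ab' := ab.
have [L L0 HL] := u2_lip.
have u1p := interior_min_critical pab upm.
pose g := (beta - u2 p) / 2; have g0 : 0 < g by rewrite divr_gt0// subr_gt0.
have [K K0 HK] := cont_bounded a b (Dv_cont du2).
have a2 : 0 < alpha ^+ 2 by rewrite exprn_gt0.
pose d1 := Num.min (Num.min (d / 2) 1) (Num.min (Num.min ((p - a) / 2) ((b - p) / 2))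
  (Num.min (g / L) (g / (2 * alpha ^+ 2 * K)))).
have [[dd d_1] [[da db] [dL dK]]] : (d1 <= d / 2 /\ d1 <= 1) /\
    ((d1 <= (p - a) / 2 /\ d1 <= (b - p) / 2) /\ (d1 <= g / L /\ d1 <= g / (2 * alpha ^+ 2 * K))).
  by rewrite !ge_min !lexx !orbT.
have d10 : 0 < d1.
  rewrite !lt_min ltr01 !divr_gt0 ?mulr_gt0//= ?andbT; lra.
clearbody d1.
have Pg x : `|x - p| <= d1 -> g <= beta - u2 x.
  move=> xd; have : `|u2 x - u2 p| <= g.
    apply: (le_trans (HL p x _ _)); first lra.
      by move: xd; rewrite ler_norml; lra.
    by rewrite mulrC -ler_pdivlMr//; exact: le_trans dL.
  by rewrite ler_norml /g; lra.
have uK x : `|x - p| <= d1 -> u x - m <= K * (x - p) ^+ 2.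
  move=> xd; have : u x <= u p + K / 2 * (x - p) ^+ 2.
    apply: taylor2_le du du1 u1p _ => t tp.
    have : `|t - p| <= d1 by exact: le_trans xd.
    rewrite ler_norml => td; apply: le_trans (ler_norm _) _; apply: HK; lra.
  have : 0 <= K * (x - p) ^+ 2 by rewrite mulr_ge0 ?sqr_ge0// ltW.
  rewrite upm; lra.
pose T := 4 / d1 + d1 * alpha ^+ 2.
have T0 : 0 < T by rewrite addr_gt0 ?divr_gt0// mulr_gt0.
pose e := Num.min (d1 / 2) (g / ((K + 1) * T)).
have [ed eT] : e <= d1 / 2 /\ e <= g / ((K + 1) * T) by rewrite !ge_min !lexx orbT.
have K1 : 0 < K + 1 by rewrite addr_gt0.
have e0 : 0 < e by rewrite lt_min; apply/andP; split; rewrite divr_gt0// mulr_gt0.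
clearbody e.
pose h := Num.min (g / (2 * alpha ^+ 2)) (e ^+ 2).
have [h1 h2] : h <= g / (2 * alpha ^+ 2) /\ h <= e ^+ 2 by rewrite !ge_min !lexx orbT.
have h0 : 0 < h.
  have aa : 0 < 2 * alpha ^+ 2 by rewrite mulr_gt0.
  by rewrite lt_min; apply/andP; split; [exact: divr_gt0|exact: exprn_gt0].
clearbody h.
exists (m - h); first by rewrite gtrBl.
move=> c F F1 /andP[hc cm] [[dF dF1] Fa F1a].
apply: contrapT => nz.
have inab x : p - d1 <= x <= p + d1 -> [/\ a < x < b, clamp a B x = x, clamp a b x = x & `|x - p| <= d1].
  move=> xd; split; [lra|apply: clamp_id; lra|apply: clamp_id; lra|rewrite ler_norml; lra].
have nzF x : p - d1 <= x <= p + d1 -> F x != 0.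
  move=> xd; have [xab _ _ xp] := inab x xd.
  apply/eqP => Fx; apply: nz; exists x; split=> //; lra.
have Vle x : p - d1 <= x <= p + d1 -> potc c x <= 0.
  move=> xd; have [xab _ cx xp] := inab x xd.
  have Uc : 0 < U x - c by apply: (Uc_gt0 mU _ cm).
  rewrite /pot subr_le0 ler_pdivlMr// /profP /profU cx; apply: le_trans (Pg x xp).
  have : u x - c <= g / alpha ^+ 2; last by rewrite ler_pdivlMr// mulrC.
  have e1 : (x - p) ^+ 2 <= d1.
    have -> : (x - p) ^+ 2 = `|x - p| * `|x - p| by rewrite -expr2 real_normK// num_real.
    apply: (@le_trans _ _ (`|x - p| * 1)); last by rewrite mulr1.
    by rewrite ler_wpM2l// (le_trans xp).
  have e2 : K * (x - p) ^+ 2 <= g / (2 * alpha ^+ 2).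
    apply: (le_trans (ler_wpM2l (ltW K0) e1)); rewrite mulrC -ler_pdivlMr//.
    apply: (le_trans dK); rewrite le_eqVlt; apply/orP; left; apply/eqP.
    by field; rewrite !gt_eqF.
  have -> : g / alpha ^+ 2 = g / (2 * alpha ^+ 2) + g / (2 * alpha ^+ 2) by field; rewrite gt_eqF.
  have := uK x xp; lra.
pose w := g / ((K + 1) * e ^+ 2) - alpha ^+ 2.
have Vw x : p - e <= x <= p + e -> potc c x <= - w.
  move=> xe; have xd : p - d1 <= x <= p + d1 by lra.
  have [xab _ cx xp] := inab x xd.
  have Uc : 0 < U x - c by apply: (Uc_gt0 mU _ cm).
  rewrite /pot /w opprB lerD2l lerN2 ler_pdivlMr// /profP /profU cx.
  apply: le_trans (Pg x xp); rewrite mulrAC ler_pdivrMr; last by rewrite mulr_gt0// exprn_gt0.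
  rewrite ler_wpM2l//; first exact: ltW.
  have e1 : (x - p) ^+ 2 <= e ^+ 2.
    by rewrite -ler_sqrt ?sqr_ge0// !sqrtr_sqr (gtr0_norm e0) ler_norml; lra.
  have := ler_wpM2l (ltW K0) e1; have := uK x xp; lra.
have := @well_depth R F F1 (potc c) p d1 e w d10 e0 ed _ Vw.
have Hf x : p - d1 <= x <= p + d1 ->
     [/\ is_derive x 1 F (F1 x), is_derive x 1 F1 (potc c x * F x), F x != 0 & potc c x <= 0].
  move=> xd; have [xab cx _ xp] := inab x xd; split; [exact: dF| |exact: nzF|exact: Vle].
  by have := dF1 x; rewrite cx.
move=> /(_ Hf); apply/negP; rewrite -ltNge /w.
have -> : 2 * e * (g / ((K + 1) * e ^+ 2) - alpha ^+ 2) = 2 * (g / ((K + 1) * e)) - 2 * e * alpha ^+ 2.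
  by field; rewrite !gt_eqF.
have : T <= g / ((K + 1) * e).
  rewrite ler_pdivlMr ?mulr_gt0//; move: eT; rewrite ler_pdivlMr ?mulr_gt0//; lra.
have : 2 * e * alpha ^+ 2 <= d1 * alpha ^+ 2 by rewrite ler_wpM2r ?(ltW a2)//; lra.
have : 0 < 4 / d1 by rewrite divr_gt0.
have : 0 < d1 * alpha ^+ 2 by rewrite mulr_gt0.
by rewrite /T; lra.
Qed.

Lemma zeros_near_minima (ps : seq R) : uniq ps ->
  (forall p, p \in ps -> [/\ a < p < b, u p = m & u2 p < beta]) ->
  exists2 c0, c0 < m & forall F (F1 : R -> R), shotc c0 F F1 -> zeros_ge F `]a, b[ (size ps).
Proof.
move=> ups Hps.
have [d d0 Hd] : exists2 d : R, 0 < d & forall p q, p \in ps -> q \in ps -> p != q -> 2 * d <= `|p - q|.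
  elim: ps {ups Hps} => [|x s [d d0 Hd]]; first by exists 1.
  have [e e0 He] := finite_set_gap x (finite_seq s).
  exists (Num.min d (e / 2)); first by rewrite lt_min d0 divr_gt0.
  have [md me] : Num.min d (e / 2) <= d /\ Num.min d (e / 2) <= e / 2 by rewrite !ge_min !lexx orbT.
  move=> p q; rewrite !inE => /orP[/eqP->|ps] /orP[/eqP->|qs] pq.
  - by rewrite eqxx in pq.
  - by have := He q qs; rewrite eq_sym distrC => /(_ pq); lra.
  - by have := He p ps pq; lra.
  - by have := Hd p q ps qs pq; lra.
have [c0 c0m Hc0] : exists2 c0, c0 < m & forall c F (F1 : R -> R), c0 <= c < m -> shotc c F F1 ->
    forall p, p \in ps -> exists z, [/\ `|z - p| < d, a < z < b & F z = 0].
  elim: ps {ups Hd} Hps => [_|x s IH Hps]; first by exists (m - 1); [rewrite gtrBl|].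
  have [|c0 c0m Hc0] := IH; first by move=> p ps; apply: Hps; rewrite inE ps orbT.
  have [xab ux u2x] := Hps x (mem_head _ _).
  have [c2 c2m Hc2] := zero_near_minimum xab ux u2x d0.
  exists (Num.max c0 c2); first by rewrite gt_max c0m.
  move=> c F F1; rewrite ge_max => /andP[/andP[cc0 cc2] cm] sF p.
  rewrite inE => /orP[/eqP->|ps].
    by apply: Hc2 sF; rewrite cc2.
  by apply: Hc0 sF p ps; rewrite cc0.
exists c0 => // F F1 sF.
have /choice[g Hg] : forall p, exists z, p \in ps -> [/\ `|z - p| < d, a < z < b & F z = 0].
  move=> p; case: (boolP (p \in ps)) => [ps_|_]; last by exists 0.
  have [|z Hz] := Hc0 c0 F F1 _ sF p ps_; first by rewrite lexx.
  by exists z.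
exists (map g ps); last by rewrite size_map.
split.
  rewrite map_inj_in_uniq// => p q pps qps gpq; apply/eqP; apply/negPn/negP => pq.
  have [h1 _ _] := Hg p pps; have [h2 _ _] := Hg q qps; have := Hd p q pps qps pq.
  rewrite -gpq in h2; have := ler_distD (g p) p q; rewrite (distrC p (g p)); lra.
by move=> z /mapP[p pps ->]; have [_ zab Fz] := Hg p pps; rewrite in_itv.
Qed.

Lemma critical_min_curvature p : a <= p <= b -> u p = m -> u1 p = 0 -> 0 <= u2 p.
Proof.
move=> pab up u1p; rewrite leNgt; apply/negP => u2p; have ab' := ab.
pose k := u2 p / 2; have k0 : k < 0 by rewrite pmulr_llt0// invr_gt0.
have cN : continuous (fun x => k - u2 x).
  by apply: ctD; [exact: ctC|apply: ctN; exact: Dv_cont du2].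
have p0 : 0 < k - u2 p by rewrite /k; lra.
have [e e0 He] := cont_pos_near cN p0.
have [x [xab xp xe]] := punctured_point ab pab e0.
have := @taylor2_le u u1 u2 p x k du du1 u1p.
have H t : `|t - p| <= `|x - p| -> u2 t <= k.
  by move=> /le_lt_trans/(_ xe)/He; lra.
move=> /(_ H); rewrite up; have := mu xab.
have : k / 2 * (x - p) ^+ 2 < 0.
  by rewrite nmulr_rlt0 ?exprn_even_gt0//; lra.
lra.
Qed.

(** Let [tau = beta - 9/8 u''(p)]. Taylor's formula at order two bounds
    [u - m] by [A (x - p)^2] near [p], where [A] exceeds [u''(p) / 2] by a fraction
    of [tau]; [q] and [th] take up what remains of [tau]: half of the excess over
    Hardy's constant absorbs [alpha^2], and [th] allows [c] to stay below [m]. *)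
Lemma critical_well p : a <= p <= b -> u p = m -> u1 p = 0 -> 9 / 8 * u2 p < beta ->
  exists q th y0 : R, [/\ 0 < q, 0 < th, 0 < y0 & forall c x, c < m -> a <= x <= b ->
    0 < `|x - p| <= y0 -> m - th * (x - p) ^+ 2 <= c ->
    potc c x <= - ((4^-1 + q) / (x - p) ^+ 2)].
Proof.
move=> pab upm u1p bp; have ab' := ab.
have [L L0 HL] := u2_lip.
have a2 : 0 < alpha ^+ 2 by rewrite exprn_gt0.
pose k := u2 p; have k0 : 0 <= k by exact: critical_min_curvature pab upm u1p.
pose tau := beta - 9 / 8 * k; have tau0 : 0 < tau by rewrite subr_gt0.
pose eta := tau / 9; pose A := k / 2 + eta.
have eta0 : 0 < eta by rewrite divr_gt0.
have A0 : 0 < A by rewrite ltr_wpDl// divr_ge0.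
pose q := tau / (12 * A); have q0 : 0 < q by rewrite divr_gt0// mulr_gt0.
pose th := A * q / (4^-1 + 2 * q).
have q4 : 0 < 4^-1 + 2 * q by rewrite addr_gt0 ?invr_gt0// mulr_gt0.
have th0 : 0 < th by rewrite divr_gt0// mulr_gt0.
have thq : (4^-1 + 2 * q) * (A + th) <= beta - k - 2 * eta.
  have -> : (4^-1 + 2 * q) * (A + th) = A / 4 + 3 * (A * q).
    by rewrite /th; field; rewrite gt_eqF//; have := q4; lra.
  have -> : A * q = tau / 12 by rewrite /q; field; rewrite gt_eqF.
  by have := tau0; rewrite /A /eta /tau; lra.
have AE : A = (k + 2 * eta) / 2 by rewrite /A; field.
clearbody th q A.
pose y0 := Num.min 1 (Num.min (2 * eta / L) (q / alpha ^+ 2)).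
have [y1 [yL yq]] : y0 <= 1 /\ (y0 <= 2 * eta / L /\ y0 <= q / alpha ^+ 2).
  by rewrite !ge_min !lexx !orbT.
have y00 : 0 < y0 by rewrite !lt_min ltr01 !divr_gt0 ?mulr_gt0.
clearbody y0 eta.
exists q, th, y0; split=> // c x cm xab; rewrite -[(x - p) ^+ 2]real_normK ?num_real//.
have ux t : `|t - p| <= `|x - p| -> `|x - p| <= y0 -> `|u2 t - k| <= 2 * eta.
  move=> tx xy0; apply: (@le_trans _ _ (L * `|t - p|)).
    by apply: HL; [lra|move: (le_trans tx (le_trans xy0 y1)); rewrite ler_norml; lra].
  by rewrite mulrC -ler_pdivlMr//; exact: le_trans (le_trans tx xy0) yL.
have ule : `|x - p| <= y0 -> u x <= m + A * `|x - p| ^+ 2.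
  move=> xy0; rewrite real_normK ?num_real// AE -upm.
  apply: taylor2_le du du1 u1p _ => t /ux/(_ xy0); rewrite ler_norml; lra.
move: (ux x (lexx _)) ule; set y := `|x - p| => u2x ule /andP[yy yy0] cth.
have y2 : 0 < y ^+ 2 by rewrite exprn_gt0.
have Pge : beta - k - 2 * eta <= P x.
  by have := u2x yy0; rewrite /profP clamp_id// ler_norml; lra.
have Uc : 0 < U x - c by exact: (Uc_gt0 mU _ cm).
have Ule : U x - c <= (A + th) * y ^+ 2.
  by rewrite /profU clamp_id//; have := ule yy0; lra.
have main : (4^-1 + 2 * q) / y ^+ 2 <= P x / (U x - c).
  rewrite ler_pdivlMr//; apply: le_trans Pge; rewrite mulrAC ler_pdivrMr//.
  apply: (le_trans (ler_wpM2l (ltW q4) Ule)).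
  by rewrite mulrA ler_wpM2r ?(ltW y2).
have aq : alpha ^+ 2 <= q / y ^+ 2.
  rewrite ler_pdivlMr// mulrC -ler_pdivlMr//; apply: le_trans yq; apply: le_trans (yy0).
  by rewrite expr2 ler_piMr ?(ltW yy)//; exact: le_trans yy0 y1.
have -> : (4^-1 + q) / y ^+ 2 = (4^-1 + 2 * q) / y ^+ 2 - q / y ^+ 2 by ring.
by rewrite /pot; lra.
Qed.

(** At a critical minimum with [beta > 9/8 u''] the limiting potential is a
    supercritical inverse-square well, with infinitely many oscillations. *)
Lemma zeros_near_critical_minimum p n : a <= p <= b -> u p = m -> u1 p = 0 ->
  9 / 8 * u2 p < beta ->
  exists2 c0, c0 < m & forall F (F1 : R -> R), shotc c0 F F1 -> zeros_ge F `]a, b[ n.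
Proof.
move=> pab upm u1p bp; have ab' := ab.
have [L L0 HL] := u2_lip.
have a2 : 0 < alpha ^+ 2 by rewrite exprn_gt0.
(* side of [p] on which the oscillations are counted *)
have [sg [l [sg2 l0 Hl]]] : exists sg l : R, [/\ sg ^+ 2 = 1, 0 < l &
    forall y, 0 < y <= l -> a < p + sg * y < b].
  case: (ltP p b) => pb.
    exists 1, ((b - p) / 2); split; [ring|lra|move=> y yl; lra].
  exists (-1), ((b - a) / 2); split; [ring|lra|move=> y yl; lra].
have sgn : `|sg| = 1.
  by apply/eqP; rewrite -sqrp_eq1// real_normK ?num_real// sg2.
have dist y : 0 <= y -> `|p + sg * y - p| = y.
  by move=> y0; rewrite [p + _]addrC addrK normrM sgn mul1r ger0_norm.
have [q [th [y1 [q0 th0 y10 well]]]] := critical_well pab upm u1p bp.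
pose om := Num.sqrt q; have om0 : 0 < om by rewrite sqrtr_gt0.
have om2 : om ^+ 2 = q by rewrite sqr_sqrtr// ltW.
pose y0 := Num.min l y1.
have [yl yy1] : y0 <= l /\ y0 <= y1 by rewrite !ge_min !lexx !orbT.
have y00 : 0 < y0 by rewrite lt_min l0.
clearbody om y0.
pose r := expR (- ((pi + 1) / om)); have r0 : 0 < r by exact: expR_gt0.
have pi0 : 0 < (pi + 1 : R) / om by rewrite divr_gt0// addr_gt0// pi_gt0.
have r1 : r < 1 by rewrite expR_lt1 oppr_lt0.
pose Y i := y0 * r ^+ i.
have Y0 i : 0 < Y i by rewrite mulr_gt0// exprn_gt0.
have YS i : Y i.+1 = Y i * r by rewrite /Y exprS; ring.
have Ydec i j : (i <= j)%N -> Y j <= Y i.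
  move=> /subnKC<-; elim: (j - i)%N => [|s IH]; first by rewrite addn0.
  by rewrite addnS YS; apply: le_trans IH; rewrite ler_piMr ?(ltW (Y0 _))// ltW.
have YSlt i : Y i.+1 < Y i by rewrite YS gtr_pMr.
have Yy0 i : Y i <= y0 by have := Ydec 0%N i (leq0n _); rewrite {2}/Y expr0 mulr1.
pose c0 := m - th * Y (n.*2) ^+ 2.
have c0m : c0 < m by rewrite gtrBl mulr_gt0// exprn_gt0.
exists c0 => // F F1 [[dF dF1] Fa F1a].
have inl y : 0 < y <= y0 -> [/\ a < p + sg * y < b, clamp a B (p + sg * y) = p + sg * y &
    clamp a b (p + sg * y) = p + sg * y].
  move=> yy; have yab : a < p + sg * y < b by apply: Hl; lra.
  by split=> //; apply: clamp_id; lra.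
have Vle y : Y (n.*2) <= y <= y0 -> potc c0 (p + sg * y) <= - ((4^-1 + om ^+ 2) / y ^+ 2).
  move=> /andP[Yy yy0]; have yy : 0 < y by exact: lt_le_trans Yy.
  have [|/andP[ya yb] _ _] := inl y; first by rewrite yy.
  have sq : (p + sg * y - p) ^+ 2 = y ^+ 2 by rewrite [p + _]addrC addrK exprMn sg2 mul1r.
  rewrite om2 -sq; apply: well => //; first by rewrite !ltW.
    by rewrite dist ?(ltW yy)// yy/= (le_trans yy0).
  by rewrite sq /c0 lerB// ler_wpM2l ?(ltW th0)// ler_sqr ?nnegrE ?(ltW yy) ?(ltW (Y0 _)).
have daff (y : R) : is_derive y 1 (fun y => p + sg * y) sg.
  by apply: (der_eq (derD (derC p y) (derM (derC sg y) (derI y)))); ring.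
have zero i : (i.+1 <= n.*2)%N -> exists2 z, Y i.+1 <= z <= Y i & F (p + sg * z) = 0.
  move=> ni; apply: contrapT => nz.
  have Hf x : Y i.+1 <= x <= Y i ->
     [/\ is_derive x 1 (fun y => F (p + sg * y)) (sg * F1 (p + sg * x)),
         is_derive x 1 (fun y => sg * F1 (p + sg * y)) (potc c0 (p + sg * x) * F (p + sg * x)),
         F (p + sg * x) != 0 & potc c0 (p + sg * x) <= - ((4^-1 + om ^+ 2) / x ^+ 2)].
    move=> /andP[x1 x2]; have x0 : 0 < x by exact: lt_le_trans x1.
    have xy0 : x <= y0 by exact: le_trans x2 (Yy0 _).
    have [|xab cx _] := inl x; first by rewrite x0.
    split.
    - exact: derComp (daff x) (dF (p + sg * x)).
    - have := derM (derC sg x) (derComp (daff x) (dF1 (p + sg * x))).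
      move/der_eq; apply; rewrite cx mul0r add0r mulrA -expr2 sg2 mul1r//.
    - by apply/eqP => Fx; apply: nz; exists x => //; rewrite x1.
    - by apply: Vle; rewrite xy0 andbT (le_trans _ x1)// Ydec.
  have := inverse_square_oscillation (f := fun y => F (p + sg * y))
    (f1 := fun y => sg * F1 (p + sg * y)) (v := fun y => potc c0 (p + sg * y))
    om0 (Y0 i.+1) (ltW (YSlt i)) Hf.
  have -> : ln (Y i.+1) = ln (Y i) + - ((pi + 1) / om).
    by rewrite YS (@lnM _ (Y i) r) ?posrE// [ln r]expRK.
  have -> : om * (ln (Y i) - (ln (Y i) + - ((pi + 1) / om))) = pi + 1 by field; rewrite gt_eqF.
  by apply/negP; rewrite -ltNge ltrDl.
have [s [us sn Hs]] : exists s : seq R, [/\ uniq s, size s = n & forall z, z \in s ->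
    Y n.*2 < z <= y0 /\ F (p + sg * z) = 0].
  elim: (n) {c0 c0m Vle dF dF1 F1a Fa} zero => [_|j IH zero]; first by exists [::].
  have [|s [us sn Hs]] := IH.
    by move=> i ij; apply: zero; rewrite doubleS; apply: leq_trans ij _; rewrite ltnW.
  have [|z zY Fz] := zero j.*2; first by rewrite doubleS ltnW.
  exists (z :: s); split=> /=.
  - rewrite us andbT; apply/negP => /Hs[/andP[zY' _] _].
    by move: zY => /andP[_]; rewrite leNgt zY'.
  - by rewrite sn.
  - have Yj : Y j.+1.*2 < Y j.*2.+1 by rewrite doubleS YSlt.
    move=> w; rewrite inE => /orP[/eqP->|/Hs[/andP[w1 w2] Fw]].
      by move: zY => /andP[z1 z2]; split=> //; rewrite (lt_le_trans Yj z1) (le_trans z2).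
    split=> //; rewrite w2 andbT; apply: lt_trans w1.
    exact: lt_trans Yj (YSlt _).
have sg0 : sg != 0 by rewrite -normr_gt0 sgn.
exists [seq p + sg * z | z <- s]; last by rewrite size_map sn.
split.
  by rewrite map_inj_in_uniq// => x y _ _ /addrI/(mulfI sg0).
move=> w /mapP[z /Hs[/andP[z1 z2] Fz] ->]; split=> //.
have [|zab _ _] := inl z; last by rewrite in_itv.
by rewrite z2 andbT; exact: lt_trans z1.
Qed.


End Profile.

(** * Square-integrable functions on an interval *)

Section SquareIntegrable.
Context {R : realType}.
Variables (a b : R).
Hypothesis ab : a < b.
Local Notation mu := (@lebesgue_measure R).
Local Notation intg f := (mu.-integrable `[a, b] (EFin \o f)).
Local Notation I f := (\int[mu]_(t in `[a, b]) f t).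
Implicit Types (f g h V : R -> R) (x y k : R).

Lemma ae_imp (P Q : R -> Prop) : (forall x, P x -> Q x) ->
  {ae mu, forall x, P x} -> {ae mu, forall x, Q x}.
Proof. exact: (@filterS _ _ (ae_filter_ringOfSetsType mu)). Qed.

Lemma ae_imp2 (P Q S : R -> Prop) : (forall x, P x -> Q x -> S x) ->
  {ae mu, forall x, P x} -> {ae mu, forall x, Q x} -> {ae mu, forall x, S x}.
Proof. exact: (@filterS2 _ _ (ae_filter_ringOfSetsType mu)). Qed.

Definition aeq f g := {ae mu, forall x, x \in `]a, b[ -> f x = g x}.

Lemma aeq_sym f g : aeq f g -> aeq g f.
Proof. by apply: ae_imp => x H xab; rewrite H. Qed.
Lemma aeq_trans f g h : aeq f g -> aeq g h -> aeq f h.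
Proof. by apply: ae_imp2 => x H1 H2 xab; rewrite H1// H2. Qed.

Lemma ae_neq (c : R) : {ae mu, forall x, x != c}.
Proof.
exists [set c]; split; [exact: measurable_set1|exact: lebesgue_measure_set1|].
by move=> x /= /negP; rewrite negbK => /eqP.
Qed.

Lemma aeq_closed f g : aeq f g -> \forall x \ae mu, `[a, b]%classic x -> f x = g x.
Proof.
have nab := ae_imp2 (fun x (p : x != a) (q : x != b) => conj p q) (ae_neq a) (ae_neq b).
move=> fg; apply: ae_imp2 fg nab => x H [xa xb] /=.
rewrite in_itv/= => /andP[ax bx]; apply: H.
by rewrite in_itv/= !lt_neqAle ax bx xb eq_sym xa.
Qed.

Lemma intgZD k f g : intg f -> intg g -> intg (fun x => k * f x + g x).
Proof.
move=> fi gi; have kf : intg (fun x => k * f x).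
  by have := @integrableZl _ _ _ mu `[a, b] (measurable_itv _) k _ fi.
exact: (@integrableD _ _ _ mu `[a, b] (measurable_itv _) _ _ kf gi).
Qed.

Lemma intgD f g : intg f -> intg g -> intg (fun x => f x + g x).
Proof. by move=> fi gi; exact: (@integrableD _ _ _ mu `[a, b] (measurable_itv _) _ _ fi gi). Qed.

Lemma intgZ k f : intg f -> intg (fun x => k * f x).
Proof. by move=> fi; have := @integrableZl _ _ _ mu `[a, b] (measurable_itv _) k _ fi. Qed.

Lemma intg_cont f : continuous f -> intg f.
Proof. exact: cont_integrable. Qed.

Lemma bounded_cont f : continuous f -> [bounded f x | x in `[a, b]%classic].
Proof.
move=> cf; have [M M0 HM] := cont_bounded a b cf.
exists M; split; first exact: num_real.
move=> y My x /=; rewrite in_itv/= => xab; exact: le_trans (HM x xab) (ltW My).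
Qed.

Lemma meas_cont f : continuous f -> measurable_fun `[a, b] f.
Proof. by move=> cf; exact: (measurable_funS measurableT) (continuous_measurable_fun cf). Qed.

Lemma intgM_cont f g : continuous f -> intg g -> intg (fun x => f x * g x).
Proof.
move=> cf gi.
by have := @integrableMr _ _ _ mu `[a, b] (measurable_itv _) f _ (meas_cont cf) (bounded_cont cf) gi.
Qed.

Lemma intg_abs f : intg f -> intg (fun x => `|f x|).
Proof. by move=> fi; have := @integrable_norm _ _ _ mu `[a, b] f fi. Qed.

Lemma L2_intg f : L2 a b f -> intg f.
Proof.
move=> [mf fi]; apply: (@le_integrable _ _ _ mu `[a, b] (measurable_itv _) _ (EFin \o (fun x => f x ^+ 2 + 1))).
- exact/measurable_EFinP.
- move=> x _ /=; rewrite lee_fin (ger0_norm (x := _ + 1)); last by rewrite addr_ge0 ?sqr_ge0.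
  by rewrite ler_norml; have := sqr_ge0 (f x - 1); have := sqr_ge0 (f x + 1); lra.
- by apply: intgD => //; exact: intg_cont (ctC 1).
Qed.

Lemma L2_intg2 f : L2 a b f -> intg (fun x => f x ^+ 2). Proof. by case. Qed.

Lemma L2_cont f : continuous f -> L2 a b f.
Proof. by move=> cf; split; [exact: meas_cont|apply: intg_cont; exact: ctX]. Qed.

Lemma L2_bound f g : measurable_fun `[a, b] f -> intg g ->
  (forall x, x \in `[a, b] -> f x ^+ 2 <= g x) -> L2 a b f.
Proof.
move=> mf gi fg; split=> //.
apply: (@le_integrable _ _ _ mu `[a, b] (measurable_itv _) _ (EFin \o g)) => //.
- by apply/measurable_EFinP; exact: measurable_funX.
- move=> x /= xab; rewrite lee_fin !ger0_norm ?sqr_ge0//; first exact: fg.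
  by apply: le_trans (fg x xab); exact: sqr_ge0.
Qed.

Lemma L2ZD k f g : L2 a b f -> L2 a b g -> L2 a b (fun x => k * f x + g x).
Proof.
move=> Lf Lg; have [mf fi] := Lf; have [mg gi] := Lg.
apply: (@L2_bound _ (fun x => 2 * k ^+ 2 * f x ^+ 2 + 2 * g x ^+ 2)).
- by apply: measurable_funD => //; exact: measurable_funM.
- by apply: intgZD => //; exact: intgZ.
- by move=> x _; have := sqr_ge0 (k * f x - g x); lra.
Qed.

Lemma L2M_cont f g : continuous f -> L2 a b g -> L2 a b (fun x => f x * g x).
Proof.
move=> cf Lg; have [mg gi] := Lg.
apply: (@L2_bound _ (fun x => f x ^+ 2 * g x ^+ 2)).
- by apply: measurable_funM => //; exact: meas_cont.
- by apply: intgM_cont => //; exact: ctX.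
- by move=> x _; rewrite exprMn.
Qed.

Lemma I_ZD k f g : intg f -> intg g -> I (fun x => k * f x + g x) = k * I f + I g.
Proof.
move=> fi gi; have -> := @RintegralD _ _ _ mu `[a, b] (fun x => k * f x) g (measurable_itv _) (intgZ k fi) gi.
by rewrite (@RintegralZl _ _ _ mu `[a, b] f k (measurable_itv _) fi).
Qed.

Lemma I_D f g : intg f -> intg g -> I (fun x => f x + g x) = I f + I g.
Proof. by move=> fi gi; exact: (@RintegralD _ _ _ mu `[a, b] f g (measurable_itv _) fi gi). Qed.

Lemma I_Z k f : intg f -> I (fun x => k * f x) = k * I f.
Proof. by move=> fi; exact: (@RintegralZl _ _ _ mu `[a, b] f k (measurable_itv _) fi). Qed.

Lemma I_le f g : intg f -> intg g -> (forall x, x \in `[a, b] -> f x <= g x) -> I f <= I g.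
Proof. by move=> fi gi fg; apply: le_Rintegral => // x /= xab; exact: fg. Qed.

Lemma I_ge0 f : (forall x, 0 <= f x) -> 0 <= I f.
Proof. by move=> f0; apply: Rintegral_ge0 => x _; exact: f0. Qed.

Lemma I_cont f : continuous f -> I f = prim a f b.
Proof. by move=> cf; rewrite prim_Rint// ltW. Qed.

Lemma I_aeq f g : intg f -> intg g -> aeq f g -> I f = I g.
Proof.
move=> fi gi fg; rewrite /Rintegral; congr fine; apply: ae_eq_integral => //.
- exact: measurable_int fi.
- exact: measurable_int gi.
- by apply: ae_imp (aeq_closed fg) => x H xab /=; rewrite H.
Qed.

Lemma I_abs f : intg f -> `|I f| <= I (fun x => `|f x|).
Proof. by move=> fi; exact: (@le_normr_Rintegral _ _ _ mu `[a, b] f (measurable_itv _) fi). Qed.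

Lemma cauchy_schwarz1 f : L2 a b f -> (I (fun x => `|f x|)) ^+ 2 <= (b - a) * I (fun x => f x ^+ 2).
Proof.
move=> Lf; have fi := L2_intg Lf; have f2 := L2_intg2 Lf.
pose t := I (fun x => `|f x|) / (b - a).
have ba : 0 < b - a by rewrite subr_gt0.
have : 0 <= I (fun x => (`|f x| - t) ^+ 2) by apply: I_ge0 => x; exact: sqr_ge0.
have -> : (fun x => (`|f x| - t) ^+ 2) = (fun x => (- 2 * t) * `|f x| + (f x ^+ 2 + t ^+ 2)).
  by apply/funext => x; rewrite -[f x ^+ 2]real_normK ?num_real//; ring.
have ct2 : intg (fun=> t ^+ 2) by exact: intg_cont (ctC _).
rewrite I_ZD; [|exact: intg_abs|exact: intgD].
rewrite I_D// (I_cont (ctC (t ^+ 2))) (@prim_uniq _ (fun x => t ^+ 2 * x)); last first.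
- by move=> x; apply: (der_eq (derM (derC (t ^+ 2) x) (derI x))); ring.
- exact: ctC.
set A := I (fun x => `|f x|); rewrite /t -/A => H.
have E : - 2 * (A / (b - a)) * A + (I (fun x => f x ^+ 2) + ((A / (b - a)) ^+ 2 * b - (A / (b - a)) ^+ 2 * a))
   = I (fun x => f x ^+ 2) - A ^+ 2 / (b - a) by field; rewrite gt_eqF.
by rewrite E subr_ge0 ler_pdivrMr// mulrC in H.
Qed.

(** The indefinite integral of [f], frozen outside [[a, b]]. *)
Definition indef f x := \int[mu]_(t in `[a, clamp a b x]) f t.

Lemma intgS f x : intg f -> mu.-integrable `[a, clamp a b x] (EFin \o f).
Proof.
move=> fi; apply: integrableS fi => //; have /andP[_ xb] := clamp_itv ab x.
by apply: subset_itvl; rewrite bnd_simp.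
Qed.

Lemma ct_indef f : intg f -> continuous (indef f).
Proof.
move=> fi x.
have H := @parameterized_integral_continuous R a b f (ltW ab) fi.
have xab : `[a, b]%classic (clamp a b x) by rewrite /= in_itv /= clamp_itv.
move/subspace_continuousP: H => /(_ _ xab) H.
apply/cvgrPdist_lt => e e0.
have {}H := (cvgrPdist_lt _ _).1 H e e0.
have : \forall z \near clamp a b x, `[a, b]%classic z ->
    `|\int[mu]_(t in `[a, clamp a b x]) f t - \int[mu]_(t in `[a, z]) f t| < e by exact: H.
move=> Hz; apply: (@filterS _ (nbhs x) _ _ _ _ (@ct_clamp _ a b x _ Hz)) => z /= Hcz.
by apply: Hcz; rewrite in_itv /= clamp_itv.
Qed.

Lemma indef_a f : indef f a = 0.
Proof. by rewrite /indef clamp_id ?lexx ?ltW// set_itv1 Rintegral_set1. Qed.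

Lemma indefE f x : x \in `[a, b] -> indef f x = \int[mu]_(t in `[a, x]) f t.
Proof. by rewrite in_itv => xab; rewrite /indef clamp_id. Qed.

Lemma indef_ZD k f g x : intg f -> intg g ->
  indef (fun x => k * f x + g x) x = k * indef f x + indef g x.
Proof.
move=> fi gi; have fx := intgS x fi; have gx := intgS x gi; rewrite /indef.
have kf : mu.-integrable `[a, clamp a b x] (EFin \o (fun x => k * f x)).
  by have := @integrableZl _ _ _ mu `[a, clamp a b x] (measurable_itv _) k _ fx.
have -> := @RintegralD _ _ _ mu `[a, clamp a b x] (fun x => k * f x) g (measurable_itv _) kf gx.
by rewrite (@RintegralZl _ _ _ mu `[a, clamp a b x] f k (measurable_itv _) fx).
Qed.

Lemma indef_aeq f g x : intg f -> intg g -> aeq f g -> indef f x = indef g x.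
Proof.
move=> fi gi fg; rewrite /indef /Rintegral; congr fine; apply: ae_eq_integral => //.
- exact: measurable_int (intgS x fi).
- exact: measurable_int (intgS x gi).
- apply: ae_imp (aeq_closed fg) => y H xab /=; rewrite H//.
  move: xab; rewrite /= !in_itv/= => /andP[-> yx]; apply: le_trans yx _.
  by case/andP: (clamp_itv ab x).
Qed.

Lemma indef_cont f x : continuous f -> indef f x = prim a f (clamp a b x).
Proof. by move=> cf; rewrite prim_Rint//; case/andP: (clamp_itv ab x). Qed.

Lemma indef_bound f x : intg f -> `|indef f x| <= I (fun x => `|f x|).
Proof.
move=> fi; apply: le_trans (@le_normr_Rintegral _ _ _ mu `[a, clamp a b x] f (measurable_itv _) (intgS x fi)) _.
have af := intg_abs fi; have [ax xb] := andP (clamp_itv ab x).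
have -> : I (fun x => `|f x|) = \int[mu]_(t in `[a, clamp a b x]) `|f t| + \int[mu]_(t in `[clamp a b x, b]) `|f t|.
  exact: Rint_split.
by rewrite lerDl; apply: Rintegral_ge0.
Qed.

(** Lebesgue differentiation: an integrable function is determined almost
    everywhere by its indefinite integral. *)
Lemma indef_inj f g : intg f -> intg g -> (forall x, x \in `[a, b] -> indef f x = indef g x) ->
  aeq f g.
Proof.
move=> fi gi fg; pose h x := - 1 * g x + f x.
have hi : intg h by exact: intgZD.
have h0 x : x \in `[a, b] -> indef h x = 0.
  by move=> xab; rewrite indef_ZD// fg// mulN1r addNr.
have mab : measurable (`[a, b]%classic : set (measurableTypeR R)) by exact: measurable_itv.
have loc := integrable_locally mab hi.
have hi' y : mu.-integrable [set` Interval (BLeft a) (BRight y)] (EFin \o (h \_ `[a, b])).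
  have H := (@integrable_mkcond _ _ _ mu `[a, b]%classic (EFin \o h) mab).1 hi.
  by rewrite restrict_EFin in H; apply: integrableS H.
have := FTC1 hi' loc.
apply: ae_imp => x /=.
rewrite /aeq => + xab; have [ax xb] := andP (xab : a < x < b).
rewrite /= lte_fin => /(_ ax)[d1 d2].
set F := (fun y => \int[mu]_(t in `[a, y]) (h \_ `[a, b]%classic) t) in d1 d2.
have F0 y : y \in `]a, b[ -> F y = 0.
  move=> yab; rewrite -(h0 y); last by move: yab; rewrite !in_itv/= => /andP[/ltW-> /ltW->].
  have [ay yb] := andP (yab : a < y < b).
  rewrite indefE; last by rewrite in_itv/= !ltW.
  apply: eq_Rintegral => t; rewrite inE/= in_itv/= => /andP[at_ ty].
  by rewrite patchE mem_set//= in_itv/= at_ (le_trans ty (ltW yb)).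
have dF : is_derive x 1 F 0.
  apply: (near_eq_is_derive _ (derC 0 x)).
  apply: filterS2 (lt_nbhsr ax) (lt_nbhsl xb) => y ay yb.
  by rewrite F0// in_itv/= ay.
have : (F^`()%classic) x = 0 by rewrite derive1E; case: dF.
rewrite d2 patchE mem_set/=; last by rewrite in_itv/= !ltW.
by rewrite /h; lra.
Qed.

End SquareIntegrable.

(** * Weak derivatives of the second order *)

Section SecondOrderSobolev.
Context {R : realType}.
Variables (a b : R).
Hypothesis ab : a < b.
Local Notation mu := (@lebesgue_measure R).
Local Notation intg f := (mu.-integrable `[a, b] (EFin \o f)).
Local Notation I f := (\int[mu]_(t in `[a, b]) f t).
Local Notation cl := (clamp a b).
Local Notation aeq := (aeq a b).
Local Notation indef := (indef a b).
Implicit Types (f g h p r V S F G phi : R -> R) (x y k : R).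

Lemma L1_density g (e : R) : intg g -> 0 < e ->
  exists2 h, continuous h & I (fun x => `|g x - h x|) < e.
Proof.
move=> gi e0.
have mE : measurable (`[a, b]%classic : set (measurableTypeR R)) by exact: measurable_itv.
have fE : (mu `[a, b]%classic < +oo)%E.
  by rewrite lebesgue_measure_itv/=; case: ifP => _; rewrite -?EFinB ltry.
have [h_ [ch hi /fine_cvgP[_ H]]] := approximation_continuous_integrable mE fE gi.
have [N _ HN] := (cvgrPdist_lt _ _).1 H e e0.
exists (h_ N) => //; have := HN N (leqnn _).
rewrite /= sub0r normrN ger0_norm; first by [].
by apply: fine_ge0; apply: integral_ge0 => x _; rewrite lee_fin.
Qed.

Lemma intgM_contr f g : continuous f -> intg g -> intg (fun x => g x * f x).
Proof.
move=> cf gi; rewrite (_ : (fun x => _) = fun x => f x * g x); first exact: intgM_cont.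
by apply/funext => x; rewrite mulrC.
Qed.

(** Both sides are continuous in [g] for the [L^1] norm, and the identity holds
    for continuous [g], which are dense. *)
Lemma ibp1 g phi (phi1 : R -> R) : intg g -> Dv phi phi1 -> continuous phi1 ->
  I (fun x => g x * phi x) = I g * phi b - I (fun x => indef g x * phi1 x).
Proof.
move=> gi dphi cphi1; have cphi := Dv_cont dphi.
have [K K0 HK] := cont_bounded a b cphi.
have [K1 K10 HK1] := cont_bounded a b cphi1.
have ci := ct_indef ab gi.
have cip : continuous (fun x => indef g x * phi1 x) by exact: ctM.
have gphi : intg (fun x => g x * phi x).
  exact: intgM_contr.
pose C := K + K + K1 * (b - a).
have C0 : 0 < C by rewrite addr_gt0 ?addr_gt0// mulr_gt0// subr_gt0.
apply/eqP; rewrite -subr_eq0 -normr_le0; apply/ler_addgt0Pr => e e0; rewrite add0r.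
have eC : 0 < e / C by rewrite divr_gt0.
have [h ch Hh] := L1_density gi eC.
have hi : intg h by exact: intg_cont.
pose d x := - 1 * h x + g x.
have di : intg d by exact: intgZD.
have dE : I (fun x => `|d x|) < e / C.
  by apply: le_lt_trans Hh; rewrite le_eqVlt; apply/orP; left; apply/eqP;
    congr Rintegral; apply/funext => x; rewrite /d mulN1r addrC.
have cid := ct_indef ab di.
have dphi' : intg (fun x => d x * phi x).
  exact: intgM_contr.
(* the identity holds for the continuous function h *)
have Eh : prim a (fun x => h x * phi x) b = prim a h b * phi b - prim a (fun x => prim a h x * phi1 x) b.
  have cP := prim_cont a ch.
  have c1 : continuous (fun x => h x * phi x) by exact: ctM.
  have c2 : continuous (fun x => prim a h x * phi1 x) by exact: ctM.
  have dG : Dv (fun x => prim a h x * phi x) (fun x => h x * phi x + prim a h x * phi1 x).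
    by move=> x; exact: derM (prim_Dv a ch x) (dphi x).
  have := prim_uniq a b (ctD c1 c2) dG; rewrite primD// prim0 mul0r subr0; lra.
have ih x : x \in `[a, b] -> indef h x = prim a h x.
  by rewrite in_itv/= => xab; rewrite indef_cont// clamp_id.
have E : I (fun x => g x * phi x) - (I g * phi b - I (fun x => indef g x * phi1 x)) =
    I (fun x => d x * phi x) - (I d * phi b - I (fun x => indef d x * phi1 x)).
  have e1 : I (fun x => g x * phi x) = I (fun x => d x * phi x) + I (fun x => h x * phi x).
    rewrite -I_D//; last by apply: intg_cont; exact: ctM.
    by congr Rintegral; apply/funext => x; rewrite /d; ring.
  have e2 : I g = I d + I h.
    by rewrite -I_D//; congr Rintegral; apply/funext => x; rewrite /d; ring.
  have e3 : I (fun x => indef g x * phi1 x) = I (fun x => indef d x * phi1 x) + I (fun x => prim a h x * phi1 x).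
    rewrite -I_D; [|exact/intg_cont/ctM|by apply/intg_cont/ctM => //; exact: prim_cont].
    apply: eq_Rintegral => x; rewrite inE/= => xab.
    by rewrite /d indef_ZD// ih//; ring.
  rewrite e1 e2 e3 (I_cont ab ch) (I_cont ab (ctM ch cphi)) (I_cont ab (ctM (prim_cont a ch) cphi1)) Eh.
  ring.
rewrite E; set D := I (fun x => `|d x|).
have D0 : 0 <= D by apply: I_ge0 => x.
have b1 : `|I (fun x => d x * phi x)| <= K * D.
  apply: le_trans (I_abs dphi') _; rewrite /D -I_Z; last exact: intg_abs.
  apply: I_le; [exact: intg_abs|apply: intgZ; exact: intg_abs|].
  move=> x; rewrite in_itv/= normrM mulrC => xab; exact: (ler_wpM2r (normr_ge0 _) (HK x xab)).
have b2 : `|I d * phi b| <= K * D.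
  have bab : a <= b <= b by rewrite lexx ltW.
  rewrite normrM mulrC; exact: (ler_pM (normr_ge0 _) (normr_ge0 _) (HK b bab) (I_abs di)).
have b3 : `|I (fun x => indef d x * phi1 x)| <= K1 * (b - a) * D.
  have cdp : continuous (fun x => indef d x * phi1 x) by exact: ctM.
  rewrite (I_cont ab cdp) mulrAC; apply: (prim_norm (ltW ab) cdp) => x /andP[ax xb].
  have xab : a <= x <= b by rewrite !ltW.
  rewrite normrM mulrC.
  exact: (ler_pM (normr_ge0 _) (normr_ge0 _) (HK1 x xab) (indef_bound ab x di)).
have : C * D < e by rewrite mulrC -ltr_pdivlMr.
move: (I (fun x => d x * phi x)) (I d * phi b) (I (fun x => indef d x * phi1 x)) b1 b2 b3 => p q r.
have := ler_normB p (q - r); have := ler_normB q r.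
rewrite /C; clearbody D; clear -D; lra.
Qed.

(** [p] and [g] are first and second weak derivatives of [f]. *)
Definition H2d f p g := [/\ primitive_of a b f p, primitive_of a b p g & L2 a b g].

Lemma weak_derivative2P f g : weak_derivative a b 2 f g <-> exists p, H2d f p g.
Proof.
split.
  by move=> /= [p [fp [q [pq [Lq qg]]]]]; exists p; rewrite -qg.
by move=> [p [fp pg Lg]]; exists p; split=> //; exists g.
Qed.

(** The function with data [(k0, k1)] at [a] and second derivative [g]; it is
    differentiable on the whole line, and the prototype of elements of [H^2]. *)
Definition H2prim k0 k1 g x := k0 + k1 * (x - a) + prim a (indef g) x.

Lemma Dv_H2prim k0 k1 g : intg g -> Dv (H2prim k0 k1 g) (fun x => k1 + indef g x).
Proof.
move=> gi x.
have D := derM (derC k1 x) (derD (derI x) (derN (derC a x))).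
apply: (der_eq (derD (derD (derC k0 x) D) (prim_Dv a (ct_indef ab gi) x))); ring.
Qed.

Lemma a_in : a \in `[a, b]. Proof. by rewrite in_itv/= lexx ltW. Qed.
Lemma b_in : b \in `[a, b]. Proof. by rewrite in_itv/= lexx ltW. Qed.
Hint Resolve a_in b_in : core.

Lemma H2d_deriv f p g x : H2d f p g -> x \in `[a, b] -> p x = p a + indef g x.
Proof. by move=> [_ pg _] xab; rewrite pg// indefE. Qed.

Lemma H2dE f p g x : H2d f p g -> x \in `[a, b] -> f x = H2prim (f a) (p a) g x.
Proof.
move=> H xab; have [fp pg Lg] := H; have gi := L2_intg Lg.
have ci := ct_indef ab gi; have cpi : continuous (fun x => p a + indef g x).
  by apply: ctD => //; exact: ctC.
rewrite fp// (@eq_Rintegral _ _ _ mu _ (fun x => p a + indef g x)); last first.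
  move=> t; rewrite inE/= => tx; apply: H2d_deriv H _.
  by move: tx xab; rewrite !in_itv/= => /andP[-> tx] /andP[_]; exact: le_trans.
rewrite -prim_Rint//; last by move: xab; rewrite in_itv => /andP[].
rewrite (prim_uniq _ _ cpi (Dv_H2prim 0 (p a) gi)) /H2prim prim0; ring.
Qed.

Lemma H2d_ext f f' p g : (forall x, x \in `[a, b] -> f' x = f x) -> H2d f p g -> H2d f' p g.
Proof. by move=> ff [fp pg Lg]; split=> // x xab; rewrite !ff// fp. Qed.

Lemma H2d_H2prim k0 k1 g : L2 a b g -> H2d (H2prim k0 k1 g) (fun x => k1 + indef g x) g.
Proof.
move=> Lg; have gi := L2_intg Lg; have ci := ct_indef ab gi; split=> //.
  move=> x xab; rewrite -prim_Rint.
  - by rewrite (prim_uniq _ _ _ (Dv_H2prim k0 k1 gi)); [ring|apply: ctD => //; exact: ctC].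
  - by apply: ctD => //; exact: ctC.
  - by move: xab; rewrite in_itv => /andP[].
by move=> x xab /=; rewrite (indef_a ab) addr0 indefE.
Qed.

Lemma H2d_cont f p g : H2d f p g -> continuous (fun x => f (cl x)).
Proof.
move=> H; have [_ _ /L2_intg gi] := H.
rewrite (_ : (fun x => _) = (fun x => H2prim (f a) (p a) g (cl x))).
  by apply: ct_clampC; exact: Dv_cont (Dv_H2prim (f a) (p a) gi).
by apply/funext => x; apply: H2dE H _; rewrite in_itv/= clamp_itv.
Qed.

Lemma H2d_cont1 f p g : H2d f p g -> continuous (fun x => p (cl x)).
Proof.
move=> H; have [_ _ /L2_intg gi] := H.
rewrite (_ : (fun x => _) = (fun x => p a + indef g (cl x))).
  by apply: ctD; [exact: ctC|apply: ct_clampC; exact: ct_indef].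
by apply/funext => x; apply: H2d_deriv H _; rewrite in_itv/= clamp_itv.
Qed.

Lemma L2_ext f f' : (forall x, x \in `[a, b] -> f x = f' x) -> L2 a b f -> L2 a b f'.
Proof.
move=> ff [mf fi]; split.
  by apply: eq_measurable_fun mf => x; rewrite inE/=; exact: ff.
apply: eq_integrable fi => // x; rewrite inE/= => xab; rewrite ff//.
Qed.

Lemma L2_clamp f : continuous (fun x => f (cl x)) -> L2 a b f.
Proof. by move=> cf; apply: L2_ext (L2_cont _ _ cf) => x; rewrite in_itv => xab; rewrite clamp_id. Qed.

Lemma cont_zero_closed f x : continuous f -> (forall y, a < y < b -> f y = 0) ->
  a <= x <= b -> f x = 0.
Proof.
move=> cf f0 xab; apply/eqP/negPn/negP => fx.
have f2 : 0 < f x ^+ 2 by rewrite exprn_even_gt0.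
have [e e0 He] := cont_pos_near (ctX (n := 2) cf) f2.
suff [y yab yx] : exists2 y, a < y < b & `|y - x| < e.
  by have := He y yx; rewrite f0// expr0n/= ltxx.
have ab' := ab; case: (ltP x ((a + b) / 2)) => xm.
  exists (x + Num.min (e / 2) ((b - a) / 4)).
    have [m1 m2] : Num.min (e / 2) ((b - a) / 4) <= e / 2 /\ Num.min (e / 2) ((b - a) / 4) <= (b - a) / 4.
      by rewrite !ge_min !lexx orbT.
    have : 0 < Num.min (e / 2) ((b - a) / 4) by rewrite lt_min; lra.
    lra.
  rewrite [x + _]addrC addrK ger0_norm; first by rewrite gt_min; lra.
  by rewrite le_min; lra.
exists (x - Num.min (e / 2) ((b - a) / 4)).
  have [m1 m2] : Num.min (e / 2) ((b - a) / 4) <= e / 2 /\ Num.min (e / 2) ((b - a) / 4) <= (b - a) / 4.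
    by rewrite !ge_min !lexx orbT.
  have : 0 < Num.min (e / 2) ((b - a) / 4) by rewrite lt_min; lra.
  lra.
rewrite [x - _]addrC addrK normrN ger0_norm; first by rewrite gt_min; lra.
by rewrite le_min; lra.
Qed.

(** Both functions are differentiable inside the interval, which determines the
    first derivatives; the second ones follow by Lebesgue differentiation. *)
Lemma H2d_uniq f f' p p' g g' : H2d f p g -> H2d f' p' g' ->
  (forall x, x \in `[a, b] -> f x = f' x) ->
  (forall x, x \in `[a, b] -> p x = p' x) /\ aeq g g'.
Proof.
move=> H H' ff; have [_ _ /L2_intg gi] := H; have [_ _ /L2_intg gi'] := H'.
pose D x := H2prim (f a) (p a) g x - H2prim (f' a) (p' a) g' x.
pose D1 x := (p a + indef g x) - (p' a + indef g' x).
have dD : Dv D D1 by move=> x; exact: derD (Dv_H2prim _ _ gi x) (derN (Dv_H2prim _ _ gi' x)).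
have D0 x : a < x < b -> D x = 0.
  move=> /andP[ax xb]; have xab : x \in `[a, b] by rewrite in_itv/= !ltW.
  by rewrite /D -(H2dE H)// -(H2dE H')// ff// subrr.
have D10 x : a <= x <= b -> D1 x = 0.
  have cD1 : continuous D1.
    by apply: ctD; [|apply: ctN]; (apply: ctD; [exact: ctC|exact: ct_indef]).
  move=> xab; apply: cont_zero_closed xab => //; exact: deriv_flat dD D0.
have pa : p a = p' a.
  have aab : a <= a <= b by rewrite lexx ltW.
  by have := D10 a aab; rewrite /D1 !(indef_a ab); lra.
have gg x : x \in `[a, b] -> indef g x = indef g' x.
  by rewrite in_itv/= => xab; have := D10 x xab; rewrite /D1 pa; lra.
split; last exact: indef_inj.
by move=> x xab; rewrite (H2d_deriv H)// (H2d_deriv H')// pa gg.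
Qed.

Lemma H2d_lin k f f' p p' g g' : H2d f p g -> H2d f' p' g' ->
  H2d (fun x => k * f x + f' x) (fun x => k * p x + p' x) (fun x => k * g x + g' x).
Proof.
move=> H H'; have [_ _ Lg] := H; have [_ _ Lg'] := H'.
have gi := L2_intg Lg; have gi' := L2_intg Lg'.
have L := L2ZD k Lg Lg'; have Li := L2_intg L.
have HP := H2d_H2prim (k * f a + f' a) (k * p a + p' a) L.
have E x : x \in `[a, b] -> k * p x + p' x = (k * p a + p' a) + indef (fun x => k * g x + g' x) x.
  by move=> xab; rewrite (H2d_deriv H)// (H2d_deriv H')// indef_ZD//; ring.
have [h1 _ _] := HP; split=> //.
- move=> x xab.
  have -> : k * f x + f' x = H2prim (k * f a + f' a) (k * p a + p' a) (fun x => k * g x + g' x) x.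
    rewrite (H2dE H)// (H2dE H')// /H2prim.
    rewrite (_ : prim a (indef (fun x => k * g x + g' x)) x = k * prim a (indef g) x + prim a (indef g') x).
      by move: (prim a (indef g) x) (prim a (indef g') x) => *; ring.
    rewrite -primZ; last exact: ct_indef.
    rewrite -primD; [|by apply: ctM; [exact: ctC|exact: ct_indef]|exact: ct_indef].
    by congr (prim _ _ _); apply/funext => t; rewrite indef_ZD.
  rewrite h1//; congr (_ + _).
    by rewrite /H2prim prim0 subrr mulr0 !addr0.
  apply: eq_Rintegral => t; rewrite inE/= => tx.
  have tab : t \in `[a, b].
    by move: tx xab; rewrite !in_itv/= => /andP[-> tx] /andP[_]; exact: le_trans.
  by rewrite -E.
- by move=> x xab; rewrite E// indefE.
Qed.

Lemma H2d_smooth f (f1 f2 : R -> R) : Dv f f1 -> Dv f1 f2 -> continuous f2 -> H2d f f1 f2.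
Proof.
move=> df df1 cf2; split; last exact: L2_cont.
- move=> x; rewrite in_itv/= => /andP[ax _]; rewrite -prim_Rint//; last exact: Dv_cont df1.
  by rewrite (prim_uniq _ _ (Dv_cont df1) df); ring.
- move=> x; rewrite in_itv/= => /andP[ax _]; rewrite -prim_Rint//.
  by rewrite (prim_uniq _ _ cf2 df1); ring.
Qed.

(** The boundary term at [b] is kept: it is what decides whether a solution
    with zero data at [a] satisfies the other Dirichlet condition. *)
Lemma green f p g phi (phi1 phi2 : R -> R) : H2d f p g -> Dv phi phi1 -> Dv phi1 phi2 ->
  continuous phi2 -> f a = 0 -> phi a = 0 -> phi b = 0 ->
  I (fun x => g x * phi x) = I (fun x => f x * phi2 x) - f b * phi1 b.
Proof.
move=> H dphi dphi1 cphi2 fa pa pb; have [_ _ /L2_intg gi] := H.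
have cphi1 := Dv_cont dphi1.
rewrite (ibp1 gi dphi cphi1) pb mulr0 sub0r.
have df := Dv_H2prim (f a) (p a) gi.
have ci := ct_indef ab gi.
have cf := Dv_cont df.
have c1 : continuous (fun x => indef g x * phi1 x) by exact: ctM.
have c2 : continuous (fun x => H2prim (f a) (p a) g x * phi2 x) by exact: ctM.
have -> : I (fun x => f x * phi2 x) = I (fun x => H2prim (f a) (p a) g x * phi2 x).
  by apply: eq_Rintegral => x; rewrite inE/= => xab; rewrite (H2dE H).
rewrite !I_cont//.
have c3 : continuous (fun x => p a * phi1 x) by apply: ctM => //; exact: ctC.
have c4 : continuous (fun x => indef g x * phi1 x + H2prim (f a) (p a) g x * phi2 x) by exact: ctD.
have E : prim a (fun x => p a * phi1 x + (indef g x * phi1 x + H2prim (f a) (p a) g x * phi2 x)) b = f b * phi1 b.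
  rewrite (@prim_uniq _ (fun x => H2prim (f a) (p a) g x * phi1 x)).
  - by rewrite -!(H2dE H)// fa mul0r subr0.
  - exact: ctD.
  - by move=> x; apply: (der_eq (derM (df x) (dphi1 x))); ring.
rewrite primD// primD// primZ// (prim_uniq _ _ cphi1 dphi) pa pb subrr mulr0 in E.
lra.
Qed.

End SecondOrderSobolev.

(** * The real resolvent equation *)

Section RealResolvent.
Context {R : realType}.
Variables (a b alpha : R).
Hypotheses (ab : a < b) (alpha0 : 0 < alpha).
Local Notation mu := (@lebesgue_measure R).
Local Notation intg f := (mu.-integrable `[a, b] (EFin \o f)).
Local Notation I f := (\int[mu]_(t in `[a, b]) f t).
Local Notation cl := (clamp a b).
Local Notation aeq := (aeq a b).
Local Notation indef := (indef a b).
Local Notation H2d := (H2d a b).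
Implicit Types (f g h p r V F G chi : R -> R) (x y k : R).

(** Real and imaginary parts of the elements of the operator domain. *)
Definition H20 f := sobolev a b 2 f /\ forall y, y \notin `]a, b[ -> f y = 0.

Definition helm f y := wderiv a b 2 f y - alpha ^+ 2 * f y.

Lemma H20_data f : H20 f -> exists p, H2d f p (wderiv a b 2 f).
Proof.
move=> [[g wg] _]; apply/weak_derivative2P.
exact: (xgetPex (fun=> 0) (ex_intro _ g wg)).
Qed.

Lemma H20_of f p g : H2d f p g -> f a = 0 -> f b = 0 ->
  exists f', [/\ H20 f', H2d f' p g & forall x, x \in `[a, b] -> f' x = f x].
Proof.
move=> H fa fb; pose f' x := if x \in `]a, b[ then f x else 0.
have E x : x \in `[a, b] -> f' x = f x.
  rewrite /f' !in_itv/= => xab; case: ifP => // /negbT; rewrite negb_and -!leNgt.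
  move=> /orP[xa|bx].
    by rewrite (_ : x = a)//; apply/eqP; rewrite eq_le xa; case/andP: xab.
  by rewrite (_ : x = b)//; apply/eqP; rewrite eq_le bx andbC; case/andP: xab.
have H' := H2d_ext ab E H.
exists f'; split=> //; split; last by move=> y /negbTE yn; rewrite /f' yn.
by exists g; apply/weak_derivative2P; exists p.
Qed.

Lemma wderiv2_aeq f p g : H20 f -> H2d f p g -> aeq (wderiv a b 2 f) g.
Proof. by move=> /H20_data[q Hq] H; have [] := H2d_uniq ab Hq H. Qed.

Lemma H20_ends f : H20 f -> f a = 0 /\ f b = 0.
Proof. by move=> [_ H]; split; apply: H; rewrite in_itv/= ltxx ?andbF. Qed.

Lemma H20_ext f g : H20 f -> H20 g -> (forall x, x \in `[a, b] -> f x = g x) -> f = g.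
Proof.
move=> [_ Hf] [_ Hg] fg; apply/funext => x.
case: (boolP (x \in `]a, b[)) => [xab|xab]; last by rewrite Hf// Hg.
by apply: fg; move: xab; rewrite !in_itv/= => /andP[/ltW-> /ltW->].
Qed.

Lemma H20_lin k f g : H20 f -> H20 g -> H20 (fun x => k * f x + g x).
Proof.
move=> Hf Hg; have [p Hp] := H20_data Hf; have [q Hq] := H20_data Hg.
split; last by move=> y yn; rewrite (proj2 Hf)// (proj2 Hg)// mulr0 addr0.
have H := H2d_lin ab k Hp Hq.
by exists (fun x => k * wderiv a b 2 f x + wderiv a b 2 g x); apply/weak_derivative2P;
  exists (fun x => k * p x + q x).
Qed.

Lemma H20_0 : H20 (fun=> 0).
Proof.
have d0 : Dv (fun _ : R => 0 : R) (fun=> 0) by move=> x; exact: derC.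
split=> //; exists (fun=> 0); apply/weak_derivative2P; exists (fun=> 0).
by apply: (@H2d_smooth _ _ _ _ _ _ d0 d0); exact: ctC.
Qed.

Lemma helm_0 : aeq (helm (fun=> 0)) (fun=> 0).
Proof.
have d0 : Dv (fun _ : R => 0 : R) (fun=> 0) by move=> y; exact: derC.
have := wderiv2_aeq H20_0 (@H2d_smooth _ a b _ _ _ d0 d0 (ctC (0 : R))).
by apply: ae_imp => x E xab; rewrite /helm E// mulr0 subrr.
Qed.

Lemma helm_lin k f g : H20 f -> H20 g ->
  aeq (helm (fun x => k * f x + g x)) (fun x => k * helm f x + helm g x).
Proof.
move=> Hf Hg; have [p Hp] := H20_data Hf; have [q Hq] := H20_data Hg.
have := wderiv2_aeq (H20_lin k Hf Hg) (H2d_lin ab k Hp Hq).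
by apply: ae_imp => x H xab; rewrite /helm H//; ring.
Qed.

Lemma H20_L2 f : H20 f -> L2 a b f.
Proof. by move=> /H20_data[p H]; exact: L2_clamp (H2d_cont ab H). Qed.

Lemma helm_L2 f : H20 f -> L2 a b (helm f).
Proof.
move=> Hf; have [p [_ _ Lg]] := H20_data Hf.
have := L2ZD (- alpha ^+ 2) (H20_L2 Hf) Lg.
by apply: L2_ext => x _; rewrite /helm; ring.
Qed.

(** Variation of constants with a right-hand side in [L^2], by the Volterra
    equation for [F]. *)
Lemma forced_solution V : continuous V -> exists2 C : R, 0 < C & forall r, L2 a b r ->
  exists F p g, [/\ H2d F p g, F a = 0 /\ p a = 0,
    forall x, x \in `[a, b] -> g x = V x * F x + r x &
    forall x, x \in `[a, b] -> `|F x| <= C * I (fun x => `|r x|)].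
Proof.
move=> cV; have [M M0 HM] := cont_bounded a b cV.
exists (2 * (b - a) * weight a M b).
  by rewrite mulr_gt0 ?expR_gt0// mulr_gt0// subr_gt0.
move=> r Lr; have ri := L2_intg Lr; have cir := ct_indef ab ri.
have [F [cF FE]] := volterra_solution ab cV (prim_cont a cir).
pose g x := 1 * (V x * F (cl x)) + r x.
have cK : continuous (fun x => V x * F (cl x)) by exact: ct_kernel.
have Lg : L2 a b g by apply: L2ZD => //; exact: L2_cont.
have gi := L2_intg Lg.
have H := H2d_H2prim ab 0 0 Lg.
have E x : x \in `[a, b] -> F x = H2prim a b 0 0 g x.
  rewrite in_itv/= => xab; have [ax xb] := andP xab.
  rewrite FE /H2prim mul0r !add0r /volt -primD//; last exact: prim_cont.
  apply: eq_prim => //; [by apply: ctD => //; exact: prim_cont|exact: ct_indef|].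
  move=> t atx; have tab : a <= t <= b by lra.
  by rewrite indef_ZD//; [rewrite (@indef_cont _ a b ab _ t cK) clamp_id// mul1r addrC|exact: intg_cont].
exists F, (fun x => 0 + indef g x), g; split.
- exact: (H2d_ext ab E H).
- by rewrite FE /volt !prim0 (indef_a ab) !addr0.
- by move=> x; rewrite in_itv/= => xab; rewrite /g mul1r clamp_id.
- move=> x; rewrite in_itv/= => xab.
  have -> : 2 * (b - a) * weight a M b * I (fun x => `|r x|) = 2 * (I (fun x => `|r x|) * (b - a)) * weight a M b by ring.
  apply: (volterra_bound ab cV HM cF) xab => t tab.
  rewrite FE addrK; have [at_ tb] := andP tab.
  apply: le_trans (prim_norm (C := I (fun x => `|r x|)) at_ cir _) _.
    by move=> s _; exact: indef_bound.
  by rewrite ler_wpM2l ?lerD2r//; apply: I_ge0 => s.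
Qed.

(** Such an [S] spans the solutions of [S'' = V S] that vanish at [a]. *)
Definition homogeneous V S (S1 S2 : R -> R) := [/\ Dv S S1, Dv S1 S2, continuous S2,
  S a = 0 /\ S1 a = 1 & forall x, x \in `[a, b] -> S2 x = V x * S x].

Lemma homogeneous_H2d V S S1 S2 : homogeneous V S S1 S2 -> H2d S S1 S2.
Proof. by move=> [dS dS1 cS2 _ _]; exact: H2d_smooth. Qed.

(** Such an [f] is a fixed point of a Volterra operator. *)
Lemma cauchy_zero V f p g : continuous V -> H2d f p g -> f a = 0 -> p a = 0 ->
  aeq g (fun x => V x * f x) -> forall x, x \in `[a, b] -> f x = 0.
Proof.
move=> cV H fa pa gV x; rewrite in_itv/= => xab.
have [M M0 HM] := cont_bounded a b cV.
have cf := H2d_cont ab H; have [_ _ /L2_intg gi] := H.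
have cVf : continuous (fun x => V x * f (cl x)) by exact: ctM.
have gV' : aeq g (fun x => V x * f (cl x)).
  apply: ae_imp gV => y Hy yab; rewrite Hy// clamp_id//.
  by move: yab; rewrite in_itv/= => /andP[/ltW-> /ltW->].
have fE t : a <= t <= b -> f (cl t) = volt a b V (fun t => f (cl t)) t.
  move=> tab; have [at_ tb] := andP tab.
  rewrite clamp_id// (H2dE ab H) ?in_itv// /H2prim fa pa mul0r !add0r /volt.
  apply: eq_prim => //; [exact: ct_indef|exact: (prim_cont a (ct_kernel cV cf))|].
  move=> s ast; have sab : a <= s <= b by lra.
  rewrite (indef_aeq ab s gi (intg_cont _ _ cVf) gV') indef_cont// clamp_id//.
  by congr (prim _ _ _); apply/funext => q; rewrite (clamp_id (clamp_itv ab q)).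
have := volterra_bound ab cV HM cf (C := 0) _ xab.
rewrite mulr0 mul0r clamp_id// normr_le0 => H0; apply/eqP; apply: H0.
by move=> t tab; rewrite {1}fE// subrr normr0.
Qed.

(** Both sides solve the same Cauchy problem at [a]. *)
Lemma solution_repr V S S1 S2 f p g F (q : R -> R) h r : continuous V -> homogeneous V S S1 S2 ->
  H2d f p g -> f a = 0 -> aeq g (fun x => V x * f x + r x) ->
  H2d F q h -> F a = 0 -> q a = 0 -> aeq h (fun x => V x * F x + r x) ->
  forall x, x \in `[a, b] -> f x = p a * S x + F x.
Proof.
move=> cV hS H fa gV HF Fa qa kV x xab.
have [_ _ _ [Sa S1a] S2V] := hS; have HS := homogeneous_H2d hS.
have H1 := H2d_lin ab (- p a) HS (H2d_lin ab (- 1) HF H).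
have := cauchy_zero cV H1 _ _ _ xab => H0.
suff: - p a * S x + (-1 * F x + f x) = 0 by lra.
apply: H0.
- by rewrite Sa Fa fa; ring.
- by rewrite S1a qa; ring.
- apply: ae_imp2 gV kV => y Hg Hk yab; rewrite Hg// Hk// S2V; first by ring.
  by move: yab; rewrite !in_itv/= => /andP[/ltW-> /ltW->].
Qed.

(** A multiple of [S] corrects the value at [b] of the solution with zero data
    at [a]. *)
Lemma dirichlet_solution V S S1 S2 r : continuous V -> homogeneous V S S1 S2 -> S b != 0 ->
  L2 a b r -> exists2 f, H20 f & aeq (wderiv a b 2 f) (fun x => V x * f x + r x).
Proof.
move=> cV hS Sb Lr; have [C C0 HC] := forced_solution cV.
have [F [p [g [HF [Fa pa] gE _]]]] := HC r Lr.
have [_ _ _ [Sa S1a] S2V] := hS; have HS := homogeneous_H2d hS.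
have H := H2d_lin ab (- (F b / S b)) HS HF.
have [||f [Hf Hd fE]] := H20_of H; [by rewrite Sa Fa mulr0 addr0|by field|].
exists f => //; apply: aeq_trans (wderiv2_aeq Hf Hd) _.
apply: aeW => x xab; have xab' : x \in `[a, b].
  by move: xab; rewrite !in_itv/= => /andP[/ltW-> /ltW->].
by rewrite fE// gE// S2V//; ring.
Qed.

Lemma helm_homogeneous : exists S S1 S2, homogeneous (fun=> alpha ^+ 2) S S1 S2 /\ S b != 0.
Proof.
have cV : continuous (fun _ : R => alpha ^+ 2) by exact: ctC.
have [S [S1 [sS Sa S1a]]] := ivp ab 0 1 cV; have [dS dS1] := sS.
exists S, S1, (fun x => alpha ^+ 2 * S (cl x)); split.
  split=> //; first by apply: ct_kernel => //; exact: Dv_cont dS.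
  by move=> x; rewrite in_itv/= => xab; rewrite clamp_id.
by apply: (solution_nonosc sS _ Sa S1a) => [t _|]; [exact: sqr_ge0|rewrite ab lexx].
Qed.

Lemma helm_exists h : L2 a b h -> exists2 f, H20 f & aeq (helm f) h.
Proof.
move=> Lh; have [S [S1 [S2 [hS Sb]]]] := helm_homogeneous.
have [f Hf fE] := dirichlet_solution (ctC _) hS Sb Lh.
by exists f => //; apply: ae_imp fE => x H xab; rewrite /helm H//; ring.
Qed.

Lemma helm_inj f g : H20 f -> H20 g -> aeq (helm f) (helm g) -> f = g.
Proof.
move=> Hf Hg fg; apply: H20_ext => // x xab.
have [S [S1 [S2 [hS Sb]]]] := helm_homogeneous.
have cV := ctC (alpha ^+ 2).
pose d := (fun x => - 1 * f x + g x); have Hd : H20 d by exact: H20_lin.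
have [p Hp] := H20_data Hd; have [da db] := H20_ends Hd.
have d0 : Dv (fun _ : R => 0 : R) (fun=> 0) by move=> y; exact: derC.
have H0 := @H2d_smooth _ a b _ _ _ d0 d0 (ctC (0 : R)).
have dV : aeq (wderiv a b 2 d) (fun x => alpha ^+ 2 * d x + 0).
  apply: ae_imp2 fg (helm_lin (- 1) Hf Hg) => y E1 E2 yab.
  have : helm d y = 0 by rewrite /d (E2 yab) (E1 yab); ring.
  by move/eqP; rewrite /helm subr_eq0 addr0 => /eqP.
have zV : aeq (fun=> 0) (fun x => alpha ^+ 2 * 0 + 0) by apply: aeW => y _; ring.
have rep := solution_repr cV hS Hp da dV H0 erefl erefl zV.
have pa : p a = 0.
  have /eqP := rep b (b_in ab); rewrite db addr0 eq_sym mulf_eq0 (negbTE Sb) orbF.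
  by move/eqP.
by have := rep x xab; rewrite /d pa mul0r; lra.
Qed.

(** Square of the [H^2] norm of a real function. *)
Definition nrm2 f := I (fun x => f x ^+ 2) + I (fun x => wderiv a b 1 f x ^+ 2) +
  I (fun x => wderiv a b 2 f x ^+ 2).

Lemma wderiv0 f : L2 a b f -> wderiv a b 0 f = f.
Proof.
move=> Lf; suff [_ <-] : weak_derivative a b 0 f (wderiv a b 0 f) by [].
by apply: (xgetPex (fun=> 0)); exists f.
Qed.

Lemma wderiv1_L2 f p g : H2d f p g -> L2 a b (wderiv a b 1 f) /\ aeq (wderiv a b 1 f) p.
Proof.
move=> H; have [fp pg Lg] := H.
have Lp : L2 a b p by exact: L2_clamp (H2d_cont1 ab H).
have [q [fq [Lq <-]]] : weak_derivative a b 1 f (wderiv a b 1 f).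
  by apply: (xgetPex (fun=> 0)); exists p; exists p.
split=> //; apply: (indef_inj ab (L2_intg Lq) (L2_intg Lp)) => x xab.
have := fp x xab; have := fq x xab; rewrite !indefE//; lra.
Qed.

Lemma nrm2E f p g : H20 f -> H2d f p g ->
  nrm2 f = I (fun x => f x ^+ 2) + I (fun x => p x ^+ 2) + I (fun x => g x ^+ 2).
Proof.
move=> Hf H; have [L1 E1] := wderiv1_L2 H; have [_ _ Lg] := H.
have Lp : L2 a b p by exact: L2_clamp (H2d_cont1 ab H).
have E2 := wderiv2_aeq Hf H; have [q [_ _ L2w]] := H20_data Hf.
rewrite /nrm2; congr (_ + _ + _); apply: I_aeq; try exact: L2_intg2.
  by apply: ae_imp E1 => x Hx xab; rewrite Hx.
by apply: ae_imp E2 => x Hx xab; rewrite Hx.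
Qed.

Lemma helm_nrm2 f : H20 f -> I (fun x => helm f x ^+ 2) <= 2 * (1 + alpha ^+ 4) * nrm2 f.
Proof.
move=> Hf; have Lf := H20_L2 Hf; have Lh := helm_L2 Hf; have [p [_ _ Lw]] := H20_data Hf.
have f2 := L2_intg2 Lf; have w2 := L2_intg2 Lw.
have c0 : 0 <= 2 * alpha ^+ 4 :> R by rewrite mulr_ge0// exprn_ge0// ltW.
apply: (@le_trans _ _ (I (fun x => (2 * alpha ^+ 4) * f x ^+ 2 + 2 * wderiv a b 2 f x ^+ 2))).
  apply: I_le; [exact: L2_intg2|by apply: intgZD => //; exact: intgZ|].
  by move=> x _; rewrite /helm; have := sqr_ge0 (wderiv a b 2 f x + alpha ^+ 2 * f x); lra.
rewrite I_ZD//; last exact: intgZ.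
rewrite I_Z// /nrm2.
have i0 : 0 <= I (fun x => f x ^+ 2) by apply: I_ge0 => x; exact: sqr_ge0.
have i1 : 0 <= I (fun x => wderiv a b 1 f x ^+ 2) by apply: I_ge0 => x; exact: sqr_ge0.
have i2 : 0 <= I (fun x => wderiv a b 2 f x ^+ 2) by apply: I_ge0 => x; exact: sqr_ge0.
have := mulr_ge0 c0 i1; have := mulr_ge0 c0 i2; lra.
Qed.

Section Operator.
Variables (U P w S S1 S2 : R -> R) (c : R).
Hypotheses (cU : continuous U) (cP : continuous P).
Hypotheses (wE : forall x, w x = U x - c) (w0 : forall x, w x != 0).
Definition rayV x := alpha ^+ 2 - P x / w x.
Hypothesis hS : homogeneous rayV S S1 S2.

Let cw : continuous w.
Proof.
rewrite (_ : w = fun x => U x - c); last exact/funext.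
by apply: ctD => //; apply: ctN; exact: ctC.
Qed.
Let cwV : continuous (fun x => (w x)^-1). Proof. exact: ctV. Qed.
Let cV : continuous rayV.
Proof. by apply: ctD; [exact: ctC|apply: ctN; exact: ctM]. Qed.
Let dS : Dv S S1. Proof. by case: hS. Qed.
Let cS : continuous S. Proof. exact: Dv_cont dS. Qed.

(** [chi = (T - c) f] for the real operator [T] with coefficients [U] and [P],
    where [w = U - c]. Working with this relation avoids handling an inverse. *)
Definition shifted f chi := H20 chi /\ aeq (helm chi) (fun x => w x * helm f x + P x * f x).

Lemma shifted_ode f chi : H20 f -> shifted f chi ->
  aeq (wderiv a b 2 f) (fun x => rayV x * f x + helm chi x / w x).
Proof.
move=> Hf [Hc]; apply: ae_imp => x E xab; rewrite E// /helm /rayV.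
by field; rewrite w0.
Qed.

Lemma shifted_lin k f g chi eta : H20 f -> H20 g -> shifted f chi -> shifted g eta ->
  shifted (fun x => k * f x + g x) (fun x => k * chi x + eta x).
Proof.
move=> Hf Hg [Hc sc] [He se]; split; first exact: H20_lin.
have A := ae_imp2 (fun x e1 e2 => conj e1 e2) sc se.
have B := ae_imp2 (fun x e1 e2 => conj e1 e2) (helm_lin k Hf Hg) (helm_lin k Hc He).
apply: ae_imp2 A B => x [A1 A2] [B1 B2] xab.
by rewrite B1// B2// A1// A2//; ring.
Qed.

(** An element of the kernel solves the homogeneous equation and vanishes at [a]. *)
Lemma kernel_multiple f : H20 f -> shifted f (fun=> 0) ->
  exists2 k, forall x, x \in `[a, b] -> f x = k * S x & k = 0 -> f = fun=> 0.
Proof.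
move=> Hf sf; have [p Hp] := H20_data Hf; have [fa fb] := H20_ends Hf.
have d0 : Dv (fun _ : R => 0 : R) (fun=> 0) by move=> y; exact: derC.
have H0 := @H2d_smooth _ a b _ _ _ d0 d0 (ctC (0 : R)).
have fV : aeq (wderiv a b 2 f) (fun x => rayV x * f x + 0).
  by apply: ae_imp2 helm_0 (shifted_ode Hf sf) => x E1 E2 xab; rewrite E2// E1// mul0r.
have zV : aeq (fun=> 0) (fun x => rayV x * 0 + 0) by apply: aeW => y _; ring.
have rep := solution_repr cV hS Hp fa fV H0 erefl erefl zV.
exists (p a) => [x xab|pa]; first by rewrite rep// addr0.
apply: H20_ext => //; first exact: H20_0.
by move=> x xab; rewrite rep// pa mul0r addr0.
Qed.

Hypotheses (Sb : S b = 0) (S1b : S1 b != 0).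
Let D := I (fun x => P x * (S x / w x) ^+ 2).
Hypothesis D0 : D != 0.

(** Up to a factor, the coordinate along the eigenfunction in the spectral
    decomposition; its kernel is the complement of the eigenspace. *)
Definition dual f := I (fun x => helm f x * (S x / w x)).

Let cSw : continuous (fun x => S x / w x). Proof. exact: ctM. Qed.

Lemma dual_intg f : H20 f -> intg (fun x => helm f x * (S x / w x)).
Proof. by move=> Hf; apply: intgM_contr => //; exact/L2_intg/helm_L2. Qed.

Lemma dual_lin k f g : H20 f -> H20 g -> dual (fun x => k * f x + g x) = k * dual f + dual g.
Proof.
move=> Hf Hg; rewrite /dual -I_ZD; [|exact: dual_intg..].
apply: I_aeq; [exact/dual_intg/H20_lin|by apply: intgZD; exact: dual_intg|].
by apply: ae_imp (helm_lin k Hf Hg) => x E xab; rewrite E//; ring.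
Qed.

(** By Green's formula, as [S] solves the homogeneous equation with Dirichlet
    conditions. *)
Lemma range_dual f chi : H20 f -> shifted f chi -> dual chi = 0.
Proof.
move=> Hf sf; have [p Hp] := H20_data Hf; have [fa fb] := H20_ends Hf.
have [Hc _] := sf; have [_ dS1 cS2 [Sa S1a] S2V] := hS.
have G := green ab Hp dS dS1 cS2 fa Sa Sb; rewrite fb mul0r subr0 in G.
have [_ _ /L2_intg gi] := Hp.
have cff := H2d_cont ab Hp.
have i1 : intg (fun x => wderiv a b 2 f x * S x) by exact: intgM_contr.
have i2 : intg (fun x => S2 x * f x).
  by apply: intgM_cont => //; exact/L2_intg/H20_L2.
have i3 : intg (fun x => - 1 * (S2 x * f x) + wderiv a b 2 f x * S x) by exact: intgZD.
have -> : dual chi = I (fun x => - 1 * (S2 x * f x) + wderiv a b 2 f x * S x).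
  apply: I_aeq => //; first exact: dual_intg.
  apply: ae_imp (shifted_ode Hf sf) => x E xab.
  rewrite E// S2V; last by move: xab; rewrite !in_itv/= => /andP[/ltW-> /ltW->].
  by ring.
rewrite I_ZD// G (_ : I (fun x => f x * S2 x) = I (fun x => S2 x * f x)).
  by rewrite mulN1r addNr.
by congr Rintegral; apply/funext => x; rewrite mulrC.
Qed.

(** [S] truncated to the interval. *)
Lemma eigenfunction_exists : exists f, [/\ H20 f, forall x, x \in `[a, b] -> f x = S x,
  dual f = - D & shifted f (fun=> 0)].
Proof.
have HS := homogeneous_H2d hS; have [_ _ _ [Sa S1a] S2V] := hS.
have [f [Hf Hd fE]] := H20_of HS Sa Sb.
have E := wderiv2_aeq Hf Hd.
have hE : aeq (helm f) (fun x => - P x * (S x / w x)).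
  apply: ae_imp E => x E xab.
  have xab' : x \in `[a, b] by move: xab; rewrite !in_itv/= => /andP[/ltW-> /ltW->].
  by rewrite /helm E// S2V// fE// /rayV; ring.
have cD : continuous (fun x => P x * (S x / w x) ^+ 2) by apply: ctM => //; exact: ctX.
exists f; split=> //.
  have iD : intg (fun x => P x * (S x / w x) ^+ 2) by exact: intg_cont.
  rewrite /D -mulN1r -(I_Z (-1))//; apply: I_aeq; [exact: dual_intg|exact: intgZ|].
  by apply: ae_imp hE => x E1 xab; rewrite E1//; ring.
split; first exact: H20_0.
apply: ae_imp2 hE helm_0 => x E1 E2 xab.
have xab' : x \in `[a, b] by move: xab; rewrite !in_itv/= => /andP[/ltW-> /ltW->].
by rewrite E1// E2// fE//; field; rewrite w0.
Qed.

Lemma dual_decomposition e f : H20 e -> dual e = - D -> H20 f ->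
  exists k, dual (fun x => k * e x + f x) = 0.
Proof.
move=> He eD Hf; exists (dual f / D); rewrite dual_lin// eD; field; exact: D0.
Qed.

(** The solution [F] with zero data at [a] also vanishes at [b]: Green's formula
    with [S] gives [F b * S1 b = 0] from [dual chi = 0]. A multiple of the
    eigenfunction is then added in order to satisfy [dual f = 0]. *)
Lemma shifted_surjective chi : H20 chi -> dual chi = 0 ->
  exists f, [/\ H20 f, dual f = 0 & shifted f chi].
Proof.
move=> Hc dc.
have [_ dS1 cS2 [Sa S1a] S2V] := hS.
have Lr : L2 a b (fun x => helm chi x * (w x)^-1).
  have := L2M_cont cwV (helm_L2 Hc); apply: L2_ext => x _; exact: mulrC.
have [C C0 HC] := forced_solution cV.
have [F [p [g [HF [Fa pa] gE _]]]] := HC _ Lr.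
have [_ _ Lg] := HF; have gi := L2_intg Lg.
have cF := H2d_cont ab HF.
have LF : L2 a b F by exact: L2_clamp.
(* Green's formula: the value of [F] at [b] is dual to [chi] *)
have Fb : F b = 0.
  have G := green ab HF dS dS1 cS2 Fa Sa Sb.
  have i1 : intg (fun x => S2 x * F x) by apply: intgM_cont => //; exact: L2_intg.
  have i2 := dual_intg Hc.
  have E : I (fun x => g x * S x) = I (fun x => F x * S2 x).
    rewrite -[RHS]addr0 -dc /dual.
    rewrite (_ : (fun x => F x * S2 x) = fun x => S2 x * F x); last first.
      by apply/funext => x; rewrite mulrC.
    rewrite -I_D//; apply: eq_Rintegral => x; rewrite inE/= => xab.
    by rewrite gE// S2V//; ring.
  by move: G; rewrite E => /eqP; rewrite -subr_eq0 opprB addrC subrK mulf_eq0 (negbTE S1b) orbF => /eqP.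
have [f0 [Hf0 Hd0 f0E]] := H20_of HF Fa Fb.
have sf0 : shifted f0 chi.
  split=> //; apply: ae_imp (wderiv2_aeq Hf0 Hd0) => x E xab.
  have xab' : x \in `[a, b] by move: xab; rewrite !in_itv/= => /andP[/ltW-> /ltW->].
  by rewrite /helm E// gE// f0E// /rayV /helm; field; rewrite w0.
have [e [He eS eD se]] := eigenfunction_exists.
have [k dk] := dual_decomposition He eD Hf0.
exists (fun x => k * e x + f0 x); split; [exact: H20_lin|exact: dk|].
by have := shifted_lin k He Hf0 se sf0; congr shifted; apply/funext => x; rewrite mulr0 add0r.
Qed.

Lemma I_const k : I (fun=> k) = k * (b - a).
Proof.
have dk : Dv (fun x : R => k * x) (fun=> k).
  by move=> x; apply: (der_eq (derM (derC k x) (derI x))); ring.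
by rewrite I_cont//; [rewrite (prim_uniq _ _ (ctC k) dk); ring|exact: ctC].
Qed.

(** A preimage of [chi] is [k S + F], where [F] is controlled by [chi] and the
    condition [dual f = 0] determines [k]. *)
Lemma resolvent_sup : exists2 C : R, 0 < C & forall f chi, H20 f -> dual f = 0 ->
  shifted f chi -> forall x, x \in `[a, b] -> `|f x| <= C * I (fun x => `|helm chi x|).
Proof.
have [C C0 HC] := forced_solution cV.
have [_ dS1 cS2 [Sa S1a] S2V] := hS.
have cQ : continuous (fun x => P x * (S x / w x) * (w x)^-1) by apply: ctM => //; exact: ctM.
have [Kw Kw0 HKw] := cont_bounded a b cwV.
have [KQ KQ0 HKQ] := cont_bounded a b cQ.
have [KS KS0 HKS] := cont_bounded a b cSw.
have [K K0 HK] := cont_bounded a b cS.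
pose L := (KQ * C * (b - a) + KS) / `|D|.
have D1 : 0 < `|D| by rewrite normr_gt0.
have ba : 0 < b - a by rewrite subr_gt0.
have L0 : 0 < L by rewrite divr_gt0// addr_gt0// !mulr_gt0.
exists ((L * K + C) * Kw); first by rewrite mulr_gt0// addr_gt0// mulr_gt0.
move=> f chi Hf df sf x xab; have [Hc _] := sf.
pose r x := (w x)^-1 * helm chi x.
have Lh := helm_L2 Hc; have hi := L2_intg Lh.
have Lr : L2 a b r by exact: L2M_cont.
have ri := L2_intg Lr.
have [p Hp] := H20_data Hf; have [fa fb] := H20_ends Hf.
have [F [q [g [HF [Fa qa] gE FE]]]] := HC r Lr.
set J := I (fun x => `|r x|) in FE.
have J0 : 0 <= J by exact: I_ge0.
have fV : aeq (wderiv a b 2 f) (fun x => rayV x * f x + r x).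
  by apply: ae_imp (shifted_ode Hf sf) => y E yab; rewrite E// /r; ring.
have gV : aeq g (fun x => rayV x * F x + r x).
  by apply: aeW => y yab; apply: gE; move: yab; rewrite !in_itv/= => /andP[/ltW-> /ltW->].
have rep := solution_repr cV hS Hp fa fV HF Fa qa gV.
have iF : intg F by apply: L2_intg; exact: L2_clamp (H2d_cont ab HF).
have i1 : intg (fun x => P x * (S x / w x) * (w x)^-1 * F x) by exact: intgM_cont.
have i2 : intg (fun x => S x / w x * r x) by exact: intgM_cont.
have cD : continuous (fun x => P x * (S x / w x) ^+ 2) by apply: ctM => //; exact: ctX.
have iD : intg (fun x => P x * (S x / w x) ^+ 2) by exact: intg_cont.
have i3 := intgZD (- 1) i1 i2.
have i4 := intgZD (- p a) iD i3.
have E0 : dual f = - p a * D + (- 1 * I (fun x => P x * (S x / w x) * (w x)^-1 * F x) +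
    I (fun x => S x / w x * r x)).
  rewrite -I_ZD// -I_ZD//; apply: I_aeq => //; first exact: dual_intg.
  apply: ae_imp fV => y E yab; rewrite /helm E// rep.
    by rewrite /rayV; ring.
  by move: yab; rewrite !in_itv/= => /andP[/ltW-> /ltW->].
have b1 : `|I (fun x => P x * (S x / w x) * (w x)^-1 * F x)| <= KQ * C * (b - a) * J.
  apply: le_trans (I_abs i1) _.
  rewrite (_ : _ * J = KQ * (C * J) * (b - a)); last by ring.
  rewrite -I_const; apply: I_le; [exact: intg_abs|by apply: intg_cont; exact: ctC|].
  move=> y yab; rewrite normrM ler_pM// ?FE//; apply: HKQ; first by move: yab; rewrite in_itv.
have b2 : `|I (fun x => S x / w x * r x)| <= KS * J.
  apply: le_trans (I_abs i2) _; rewrite -I_Z//; last exact: intg_abs.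
  apply: I_le; [exact: intg_abs|by apply: intgZ; exact: intg_abs|].
  by move=> y yab; rewrite normrM ler_wpM2r//; apply: HKS; move: yab; rewrite in_itv.
have pab : `|p a| <= L * J.
  rewrite /L mulrAC ler_pdivlMr// -normrM.
  have -> : p a * D = I (fun x => S x / w x * r x) - I (fun x => P x * (S x / w x) * (w x)^-1 * F x).
    by have := E0; rewrite df; lra.
  have := ler_normB (I (fun x => S x / w x * r x)) (I (fun x => P x * (S x / w x) * (w x)^-1 * F x)).
  lra.
have JJ : J <= Kw * I (fun x => `|helm chi x|).
  rewrite -I_Z//; last exact: intg_abs.
  apply: I_le; [exact: intg_abs|by apply: intgZ; exact: intg_abs|].
  by move=> y yab; rewrite normrM ler_wpM2r//; apply: HKw; move: yab; rewrite in_itv.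
rewrite rep//; apply: le_trans (ler_normD _ _) _; rewrite normrM.
have SK : `|S x| <= K by apply: HK; move: xab; rewrite in_itv.
have s1 : `|p a| * `|S x| <= L * J * K by exact: ler_pM.
have s2 := FE x xab.
have s3 : (L * K + C) * J <= (L * K + C) * (Kw * I (fun x => `|helm chi x|)).
  by apply: ler_wpM2l => //; rewrite ltW// addr_gt0// mulr_gt0.
lra.
Qed.

(** The equation expresses [f''] by [f] and [chi], so the uniform bound on [f]
    propagates to the [H^2] norm. *)
Lemma resolvent_bound : exists2 C : R, 0 < C & forall f chi, H20 f -> dual f = 0 ->
  shifted f chi -> nrm2 f <= C * nrm2 chi.
Proof.
have [C C0 HC] := resolvent_sup.
have [Kw Kw0 HKw] := cont_bounded a b cwV.
have [K K0 HK] := cont_bounded a b cV.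
have ba : 0 < b - a by rewrite subr_gt0.
pose B0 := K * C * (b - a) + Kw.
have B00 : 0 < B0 by rewrite addr_gt0// !mulr_gt0.
pose E0 := C ^+ 2 + (2 * B0) ^+ 2 + 2 * (K * C) ^+ 2.
have E00 : 0 < E0 by rewrite !addr_gt0 ?mulr_gt0 ?exprn_gt0 ?mulr_gt0.
pose A := (b - a) ^+ 2 * E0 + 2 * Kw ^+ 2.
have A0 : 0 < A by rewrite addr_gt0 ?mulr_gt0 ?exprn_gt0.
have a4 : 0 < 2 * (1 + alpha ^+ 4) by rewrite mulr_gt0// addr_gt0// exprn_gt0.
exists (A * (2 * (1 + alpha ^+ 4))); first exact: mulr_gt0.
move=> f chi Hf df sf; have fC := HC f chi Hf df sf; have [Hc _] := sf.
have Lh := helm_L2 Hc; have hi := L2_intg Lh; have h2 := L2_intg2 Lh.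
have ahi := intg_abs hi.
have [p Hp] := H20_data Hf; have [fa fb] := H20_ends Hf; have [_ _ Lg] := Hp.
set g := wderiv a b 2 f in Hp Lg; have gi := L2_intg Lg.
set J := I (fun x => `|helm chi x|) in fC.
have J0 : 0 <= J by exact: I_ge0.
have ode := shifted_ode Hf sf; rewrite -/g in ode.
have ic k : intg (fun=> k) by apply: intg_cont; exact: ctC.
have Lf := H20_L2 Hf.
have Lp : L2 a b p by exact: L2_clamp (H2d_cont1 ab Hp).
have Lr : L2 a b (fun x => 1 * (rayV x * f x) + (w x)^-1 * helm chi x).
  by apply: L2ZD; exact: L2M_cont.
have rE : aeq g (fun x => 1 * (rayV x * f x) + (w x)^-1 * helm chi x).
  by apply: ae_imp ode => x E xab; rewrite E//; ring.
have rb x : x \in `[a, b] ->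
    `|1 * (rayV x * f x) + (w x)^-1 * helm chi x| <= Kw * `|helm chi x| + K * (C * J).
  move=> xab; have := ler_normD (1 * (rayV x * f x)) ((w x)^-1 * helm chi x).
  have xab' : a <= x <= b by move: xab; rewrite in_itv.
  have n1 : `|rayV x| * `|f x| <= K * (C * J) by apply: ler_pM => //; [exact: HK|exact: fC].
  have n2 : `|(w x)^-1| * `|helm chi x| <= Kw * `|helm chi x| by apply: ler_wpM2r => //; exact: HKw.
  rewrite mul1r !normrM; lra.
have gJ : I (fun x => `|g x|) <= B0 * J.
  apply: (@le_trans _ _ (I (fun x => Kw * `|helm chi x| + K * (C * J)))); last first.
    by rewrite I_ZD// I_const -/J /B0 le_eqVlt; apply/orP; left; apply/eqP; ring.
  apply: (@le_trans _ _ (I (fun x => `|1 * (rayV x * f x) + (w x)^-1 * helm chi x|))).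
    rewrite le_eqVlt; apply/orP; left; apply/eqP; apply: I_aeq.
    - exact: intg_abs.
    - by apply: intg_abs; exact: L2_intg.
    - by apply: ae_imp rE => x E xab; rewrite E.
  by apply: I_le => //; [by apply: intg_abs; exact: L2_intg|exact: intgZD].
have ib x : `|indef g x| <= B0 * J by apply: le_trans (indef_bound ab x gi) gJ.
have pab : `|p a| <= B0 * J.
  have := H2dE ab Hp (b_in ab); rewrite /H2prim fa fb add0r => /esym/eqP.
  rewrite addr_eq0 => /eqP E.
  rewrite -(ler_pM2r ba) -[X in _ * X <= _](gtr0_norm ba) -normrM E normrN.
  by apply: prim_norm => [||x _]; [exact: ltW|exact: ct_indef|exact: ib].
have pb x : x \in `[a, b] -> `|p x| <= 2 * B0 * J.
  move=> xab; rewrite (H2d_deriv Hp xab); have := ler_normD (p a) (indef g x).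
  have := ib x; lra.
have sq x y : `|x| <= y -> x ^+ 2 <= y ^+ 2.
  by move=> xy; rewrite -real_normK ?num_real// ler_sqr ?nnegrE// (le_trans _ xy).
have i1 : I (fun x => f x ^+ 2) <= (C * J) ^+ 2 * (b - a).
  rewrite -I_const; apply: I_le => //; first exact: L2_intg2.
  by move=> x xab; apply: sq; exact: fC.
have i2 : I (fun x => p x ^+ 2) <= (2 * B0 * J) ^+ 2 * (b - a).
  rewrite -I_const; apply: I_le => //; first exact: L2_intg2.
  by move=> x xab; apply: sq; exact: pb.
have i3 : I (fun x => g x ^+ 2) <= 2 * Kw ^+ 2 * I (fun x => helm chi x ^+ 2) +
    2 * (K * (C * J)) ^+ 2 * (b - a).
  rewrite -I_const -I_ZD//.
  rewrite (_ : I (fun x => g x ^+ 2) =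
    I (fun x => (1 * (rayV x * f x) + (w x)^-1 * helm chi x) ^+ 2)); last first.
    apply: I_aeq; [exact: L2_intg2|exact: L2_intg2|].
    by apply: ae_imp rE => x E xab; rewrite E.
  apply: I_le; [exact: L2_intg2|by apply: intgZD|].
  move=> x xab; have := sq _ _ (rb x xab).
  have := sqr_ge0 (Kw * `|helm chi x| - K * (C * J)).
  have -> : helm chi x ^+ 2 = `|helm chi x| ^+ 2 by rewrite real_normK// num_real.
  lra.
have J2 := cauchy_schwarz1 ab Lh; rewrite -/J in J2.
have hn := helm_nrm2 Hc.
rewrite (nrm2E Hf Hp) -mulrA.
apply: (@le_trans _ _ (A * I (fun x => helm chi x ^+ 2))); last by apply: ler_wpM2l => //; exact: ltW.
have m1 : E0 * (b - a) * J ^+ 2 <= E0 * (b - a) * ((b - a) * I (fun x => helm chi x ^+ 2)).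
  by apply: ler_wpM2l => //; rewrite ltW// mulr_gt0.
rewrite /A; move: m1; rewrite /E0; lra.
Qed.

End Operator.

End RealResolvent.

(** * The operator and its discrete spectrum *)

Section ComplexOperator.
Local Open Scope complex_scope.
Context {R : realType}.
Variables (a b alpha beta : R) (u U P : R -> R).
Hypotheses (ab : a < b) (alpha0 : 0 < alpha).
Hypotheses (cU : continuous U) (cP : continuous P).
Hypothesis UE : forall x, x \in `[a, b] -> u x = U x.
Hypothesis PE : forall x, x \in `[a, b] -> beta - cderiv a b (cderiv a b u) x = P x.
Local Notation mu := (@lebesgue_measure R).
Local Notation I f := (\int[mu]_(t in `[a, b]) f t).
Local Notation aeq := (aeq a b).
Local Notation H20 := (H20 a b).
Local Notation helm := (helm a b alpha).
Local Notation X := (@dirichlet_H2 R a b).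
Local Notation T := (rayleigh_kuo a b u alpha beta).
Implicit Types (f g h p r chi : R -> R) (phi v : R -> R[i]) (x y k : R) (z : R[i]).

Definition re phi t := complex.Re (phi t).
Definition im phi t := complex.Im (phi t).
Definition mkc f g t : R[i] := f t +i* g t.

Lemma complexP z z' : complex.Re z = complex.Re z' -> complex.Im z = complex.Im z' -> z = z'.
Proof. by case: z => ? ?; case: z' => ? ? /= -> ->. Qed.

Lemma reimP phi phi' : re phi = re phi' -> im phi = im phi' -> phi = phi'.
Proof.
by move=> E1 E2; apply/funext => t; apply: complexP; [move/funeqP: E1|move/funeqP: E2]; apply.
Qed.

Lemma re_mkc f g : re (mkc f g) = f. Proof. exact/funext. Qed.
Lemma im_mkc f g : im (mkc f g) = g. Proof. exact/funext. Qed.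

Lemma re_lin z phi phi' :
  re (z *: phi + phi') = fun t => complex.Re z * re phi t + (- complex.Im z * im phi t + re phi' t).
Proof.
apply/funext => t; rewrite /re /im.
rewrite (_ : (z *: phi + phi') t = z * phi t + phi' t)//.
by case: z (phi t) (phi' t) => [? ?] [? ?] [? ?] /=; ring.
Qed.

Lemma im_lin z phi phi' :
  im (z *: phi + phi') = fun t => complex.Re z * im phi t + (complex.Im z * re phi t + im phi' t).
Proof.
apply/funext => t; rewrite /re /im.
rewrite (_ : (z *: phi + phi') t = z * phi t + phi' t)//.
by case: z (phi t) (phi' t) => [? ?] [? ?] [? ?] /=; ring.
Qed.

Lemma dirichletP phi : X phi <-> H20 (re phi) /\ H20 (im phi).
Proof.
split=> [[s1 s2 v0]|[[s1 v1] [s2 v2]]].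
  by split; split=> // y /v0; rewrite /re /im => ->.
by split=> // y yab; apply: complexP; [exact: v1|exact: v2].
Qed.

Lemma dirichlet_mkc f g : H20 f -> H20 g -> X (mkc f g).
Proof. by move=> Hf Hg; apply/dirichletP; rewrite re_mkc im_mkc. Qed.

Lemma dirichlet_lin z phi phi' : X phi -> X phi' -> X (z *: phi + phi').
Proof.
move=> /dirichletP[h1 h2] /dirichletP[h3 h4]; apply/dirichletP.
by rewrite re_lin im_lin; split; do 2 apply: H20_lin => //.
Qed.

Lemma dirichlet_0 : X 0.
Proof. by apply/dirichletP; split; exact: H20_0. Qed.

Lemma dirichlet_scale z phi : X phi -> X (z *: phi).
Proof. by move=> h; rewrite -[_ *: _]addr0; apply: dirichlet_lin => //; exact: dirichlet_0. Qed.

Lemma helmholtz_parts phi y : cwderiv a b 2 phi y - (alpha ^+ 2)%:C * phi y =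
  helm (re phi) y +i* helm (im phi) y.
Proof.
rewrite /cwderiv /helm -/(re phi) -/(im phi) /re /im.
by case: (phi y) => r i /=; apply: complexP => /=; ring.
Qed.

(** The Dirichlet problem for [f'' - alpha^2 f] is solvable, so that the choice
    made by the operator is a solution. *)
Lemma inv_helmholtzP (h : R -> R[i]) : L2 a b (re h) -> L2 a b (im h) ->
  let psi := inv_helmholtz a b alpha h in
  [/\ X psi, aeq (helm (re psi)) (re h) & aeq (helm (im psi)) (im h)].
Proof.
move=> Lr Li psi.
have [f Hf fE] := helm_exists alpha ab Lr; have [g Hg gE] := helm_exists alpha ab Li.
suff [Xp E] : X psi /\ {ae mu, forall y, y \in `]a, b[ ->
    cwderiv a b 2 psi y - (alpha ^+ 2)%:C * psi y = h y}.
  split=> //; apply: ae_imp E => y E yab; have := E yab; rewrite helmholtz_parts /re /im => <- //.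
suff W : (X (mkc f g)) /\ {ae mu, forall y, y \in `]a, b[ ->
    cwderiv a b 2 (mkc f g) y - (alpha ^+ 2)%:C * mkc f g y = h y}.
  by rewrite /psi /inv_helmholtz; case: xgetP => [y _ []//|/(_ (mkc f g)) []].
split; first exact: dirichlet_mkc.
apply: ae_imp2 fE gE => y Ef Eg yab; rewrite helmholtz_parts re_mkc im_mkc.
by apply: complexP => /=; [exact: Ef|exact: Eg].
Qed.

(** The coefficients of the operator are real, so it acts separately on real and
    imaginary parts. *)
Lemma rayleigh_kuo_parts phi : X phi -> [/\ X (T phi),
  aeq (helm (re (T phi))) (fun x => U x * helm (re phi) x + P x * re phi x) &
  aeq (helm (im (T phi))) (fun x => U x * helm (im phi) x + P x * im phi x)].
Proof.
move=> Xp; have [Hr Hi] := (dirichletP phi).1 Xp.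
pose h y := (cderiv a b (cderiv a b u) y - beta)%:C * phi y -
      (u y)%:C * (cwderiv a b 2 phi y - (alpha ^+ 2)%:C * phi y).
have hr y : re h y = (cderiv a b (cderiv a b u) y - beta) * re phi y - u y * helm (re phi) y.
  by rewrite {1}/re /h helmholtz_parts {2}/re; case: (phi y) => ? ? /=; ring.
have hi y : im h y = (cderiv a b (cderiv a b u) y - beta) * im phi y - u y * helm (im phi) y.
  by rewrite {1}/im /h helmholtz_parts {2}/im; case: (phi y) => ? ? /=; ring.
have Lc f : H20 f -> L2 a b (fun x => (cderiv a b (cderiv a b u) x - beta) * f x - u x * helm f x).
  move=> Hf; have L1 := L2M_cont cU (helm_L2 alpha ab Hf).
  have L2' := L2M_cont cP (H20_L2 ab Hf).
  apply: L2_ext (L2ZD (- 1) L1 (L2ZD (- 1) L2' (L2_cont a b (ctC (0 : R))))) => x xab.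
  by rewrite UE// -PE//; ring.
have Lr : L2 a b (re h) by apply: L2_ext (Lc _ Hr) => x _; rewrite hr.
have Li : L2 a b (im h) by apply: L2_ext (Lc _ Hi) => x _; rewrite hi.
have [Xi Er Ei] := inv_helmholtzP Lr Li.
set psi := inv_helmholtz a b alpha h in Xi Er Ei.
have TE : T phi = -1 *: psi + 0 by rewrite scaleN1r addr0.
have X0 := dirichlet_0.
have [Pr Pi] := (dirichletP psi).1 Xi.
have Er' : re (T phi) = fun t => -1 * re psi t + 0.
  by rewrite TE re_lin; apply/funext => t /=; rewrite /re /=; ring.
have Ei' : im (T phi) = fun t => -1 * im psi t + 0.
  by rewrite TE im_lin; apply/funext => t /=; rewrite /im /=; ring.
have key f g r : H20 f -> H20 g -> aeq (helm g) r ->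
  (forall x, r x = (cderiv a b (cderiv a b u) x - beta) * f x - u x * helm f x) ->
  aeq (helm (fun t => -1 * g t + 0)) (fun x => U x * helm f x + P x * f x).
  move=> Hf Hg Eg rE.
  have A := ae_imp2 (fun x e1 e2 => conj e1 e2) (helm_lin alpha ab (-1) Hg (H20_0 a b)) (helm_0 alpha ab).
  apply: ae_imp2 A Eg => x [A1 A2] E xab.
  have xab' : x \in `[a, b] by move: xab; rewrite !in_itv/= => /andP[/ltW-> /ltW->].
  by rewrite A1// A2// E// rE UE// -PE//; ring.
split.
- by rewrite TE; exact: dirichlet_lin.
- by rewrite Er'; exact: key Hr Pr Er hr.
- by rewrite Ei'; exact: key Hi Pi Ei hi.
Qed.

Lemma H2norm_parts phi : X phi -> H2norm a b phi = Num.sqrt (nrm2 a b (re phi) + nrm2 a b (im phi)).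
Proof.
move=> /dirichletP[Hr Hi]; rewrite /H2norm; congr Num.sqrt.
have key (k : nat) : (k < 3)%N -> I (fun y => complex.Re (cwderiv a b k phi y) ^+ 2 +
    complex.Im (cwderiv a b k phi y) ^+ 2) =
    I (fun y => wderiv a b k (re phi) y ^+ 2) + I (fun y => wderiv a b k (im phi) y ^+ 2).
  move=> k3; have Lk f : H20 f -> L2 a b (wderiv a b k f).
    move=> Hf; have [p Hp] := H20_data Hf; case: k k3 => [|[|[|//]]] _.
    - by have L := H20_L2 ab Hf; rewrite wderiv0.
    - by have [] := wderiv1_L2 ab Hp.
    - by case: Hp.
  by rewrite -I_D//; [exact/L2_intg2/Lk|exact/L2_intg2/Lk].
rewrite 3!big_ord_recl big_ord0 addr0 !key//= /bump/= /nrm2 !wderiv0; [|exact: H20_L2..].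
by ring.
Qed.

Section FixedEigenvalue.
Variables (w S S1 S2 : R -> R) (c : R).
Hypotheses (wE : forall x, w x = U x - c) (w0 : forall x, w x != 0).
Hypothesis hS : homogeneous a b (rayV alpha P w) S S1 S2.
Local Notation shifted := (shifted a b alpha P w).
Local Notation dual := (dual a b alpha w S).
Local Notation A := (fun v => T v - c%:C *: v).

Lemma shift_lin phi : A phi = - c%:C *: phi + T phi.
Proof. by rewrite scaleNr addrC. Qed.

Lemma shift_dirichlet phi : X phi -> X (A phi).
Proof.
move=> Xp; have [XT _ _] := rayleigh_kuo_parts Xp.
by rewrite shift_lin; exact: dirichlet_lin.
Qed.

Lemma shift_re phi : X phi -> shifted (re phi) (re (A phi)).
Proof.
move=> Xp; have [XT Er Ei] := rayleigh_kuo_parts Xp.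
have [Hr Hi] := (dirichletP phi).1 Xp; have [Tr Ti] := (dirichletP _).1 XT.
have E : re (A phi) = fun t => - c * re phi t + re (T phi) t.
  by rewrite shift_lin re_lin; apply/funext => t /=; rewrite oppr0; ring.
rewrite E; split; first exact: H20_lin.
apply: ae_imp2 (helm_lin alpha ab (- c) Hr Tr) Er => x E1 E2 xab.
by rewrite E1// E2// wE; ring.
Qed.

Lemma shift_im phi : X phi -> shifted (im phi) (im (A phi)).
Proof.
move=> Xp; have [XT Er Ei] := rayleigh_kuo_parts Xp.
have [Hr Hi] := (dirichletP phi).1 Xp; have [Tr Ti] := (dirichletP _).1 XT.
have E : im (A phi) = fun t => - c * im phi t + im (T phi) t.
  by rewrite shift_lin im_lin; apply/funext => t /=; rewrite oppr0; ring.
rewrite E; split; first exact: H20_lin.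
apply: ae_imp2 (helm_lin alpha ab (- c) Hi Ti) Ei => x E1 E2 xab.
by rewrite E1// E2// wE; ring.
Qed.

Lemma shifted_uniq f chi eta : shifted f chi -> shifted f eta -> chi = eta.
Proof.
move=> [Hc sc] [He se]; apply: (helm_inj ab Hc He).
exact: aeq_trans sc (aeq_sym se).
Qed.

Lemma re0 : re 0 = fun=> 0. Proof. by []. Qed.
Lemma im0 : im 0 = fun=> 0. Proof. by []. Qed.

(** If [S b] were nonzero, then the real and imaginary parts of [phi] would be
    the multiple 0 of [S]. *)
Lemma eigenvalue_shot phi : X phi -> phi <> 0 -> T phi = c%:C *: phi -> S b = 0.
Proof.
move=> Xp p0 Tp; have A0 : A phi = 0 by rewrite Tp subrr.
have [Hr Hi] := (dirichletP phi).1 Xp.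
have sr := shift_re Xp; have si := shift_im Xp; rewrite A0 in sr si.
apply/eqP/negPn/negP => Sb; apply: p0.
have key f : H20 f -> shifted f (fun=> 0) -> f = fun=> 0.
  move=> Hf sf; have [k fk k0] := kernel_multiple ab cU cP wE w0 hS Hf sf.
  apply: k0; have [_ fb] := H20_ends Hf.
  have /eqP := fk b (b_in ab); rewrite fb eq_sym mulf_eq0 (negbTE Sb) orbF.
  by move/eqP.
by apply: reimP; [exact: key|exact: key].
Qed.

Hypotheses (Sb : S b = 0) (S1b : S1 b != 0).
Hypothesis D0 : I (fun x => P x * (S x / w x) ^+ 2) != 0.

Lemma dual_0 k f : H20 f -> dual f != 0 -> dual (fun x => k * f x) = 0 -> k = 0.
Proof.
move=> Hf f0; have := dual_lin ab cU wE w0 hS k Hf (H20_0 a b).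
have z : dual (fun=> 0) = 0.
  have := dual_lin ab cU wE w0 hS (-1) Hf Hf.
  have -> : (fun x => -1 * f x + f x) = fun=> 0 by apply/funext => x; ring.
  by rewrite mulN1r addNr.
rewrite z addr0 (_ : (fun x => k * f x + 0) = fun x => k * f x).
  by move=> -> /eqP; rewrite mulf_eq0 (negbTE f0) orbF => /eqP.
by apply/funext => x; rewrite addr0.
Qed.

(** Let [A = T - c], [e] the eigenfunction and [N] the kernel of the functional
    [dual]. [A] maps the domain into [N] and kills exactly the multiples of [e];
    none of them except 0 lies in [N], as [D0] says that [dual e] is nonzero. Hence
    [A^n v = 0] forces [A v = 0], and the root space is spanned by [e]. *)
Lemma discrete_spectrum_of_shot : real_sigma_d a b u alpha beta c.
Proof.
have [e0 [He0 e0S de0 se0]] := eigenfunction_exists ab cU cP wE w0 hS Sb.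
have d0 : dual e0 != 0 by rewrite de0 oppr_eq0.
pose e := mkc e0 (fun=> 0).
have Xe : X e by apply: dirichlet_mkc => //; exact: H20_0.
have re_e (k : R[i]) : re (k *: e) = fun x => complex.Re k * e0 x.
  by rewrite -[_ *: _]addr0 re_lin re0; apply/funext => x; rewrite re_mkc im_mkc; ring.
have im_e (k : R[i]) : im (k *: e) = fun x => complex.Im k * e0 x.
  by rewrite -[_ *: _]addr0 im_lin im0; apply/funext => x; rewrite re_mkc im_mkc; ring.
have s00 : shifted (fun=> 0) (fun=> 0).
  split; first exact: H20_0.
  by apply: ae_imp (helm_0 alpha ab) => x E xab; rewrite E//; ring.
have sk k : shifted (fun x => k * e0 x) (fun=> 0).
  have := shifted_lin ab k He0 (H20_0 a b) se0 s00.
  by congr shifted; apply/funext => x; ring.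
have Ae (k : R[i]) : A (k *: e) = 0.
  have Xk := dirichlet_scale k Xe; have sr := shift_re Xk; have si := shift_im Xk.
  rewrite re_e in sr; rewrite im_e in si.
  by apply: reimP; [exact: shifted_uniq sr (sk _)|exact: shifted_uniq si (sk _)].
pose N : set (R -> R[i]) := [set v | [/\ X v, dual (re v) = 0 & dual (im v) = 0]].
have AN v : X v -> N (A v).
  move=> Xv; have [Hr Hi] := (dirichletP v).1 Xv; split; first exact: shift_dirichlet.
  - exact: (range_dual ab cU wE w0 hS Sb Hr (shift_re Xv)).
  - exact: (range_dual ab cU wE w0 hS Sb Hi (shift_im Xv)).
have Ne (k : R[i]) : N (k *: e) -> k = 0.
  move=> [_]; rewrite re_e im_e => /(dual_0 He0 d0) k1 /(dual_0 He0 d0) k2.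
  exact: complexP.
have ker v : X v -> A v = 0 -> exists k : R[i], v = k *: e.
  move=> Xv A0; have [Hr Hi] := (dirichletP v).1 Xv.
  have sr := shift_re Xv; have si := shift_im Xv; rewrite A0 in sr si.
  have key f : H20 f -> shifted f (fun=> 0) -> exists k, f = fun x => k * e0 x.
    move=> Hf sf; have [k fk _] := kernel_multiple ab cU cP wE w0 hS Hf sf.
    exists k; have Hk : H20 (fun x => k * e0 x).
      have := H20_lin ab k He0 (H20_0 a b); congr H20; apply/funext => x.
      by rewrite addr0.
    by apply: (H20_ext Hf Hk) => x xab; rewrite fk// e0S.
  have [k1 E1] := key _ Hr sr; have [k2 E2] := key _ Hi si.
  by exists (k1 +i* k2); apply: reimP; [rewrite re_e|rewrite im_e].
have root v : root_space X T c%:C v -> exists k : R[i], v = k *: e.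
  move=> [Xv [n]]; elim: n v Xv => [|n IH] v Xv.
    by move=> /= ->; exists 0; rewrite scale0r.
  rewrite iterSr => /(IH _ (shift_dirichlet Xv))[k Ak]; apply: ker => //.
  by have := AN v Xv; rewrite Ak => /Ne ->; rewrite scale0r.
have rootk (k : R[i]) : root_space X T c%:C (k *: e).
  by split; [exact: dirichlet_scale|exists 1%N; exact: Ae].
have Nlin : linear_subspace X N.
  have A0 : A 0 = 0 by have := Ae 0; rewrite scale0r.
  split=> [v []//||k v v' [Xv v1 v2] [Xv' v1' v2']].
    exact: (eq_ind _ N (AN 0 dirichlet_0) _ A0).
  have [Hr Hi] := (dirichletP v).1 Xv; have [Hr' Hi'] := (dirichletP v').1 Xv'.
  split; first exact: dirichlet_lin.
  - rewrite re_lin !(dual_lin ab cU wE w0 hS) ?v1 ?v2 ?v1'//; first by ring.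
    exact: H20_lin.
  - rewrite im_lin !(dual_lin ab cU wE w0 hS) ?v1 ?v2 ?v2'//; first by ring.
    exact: H20_lin.
split.
- exists e; split=> //.
    by move=> ee; move: d0; rewrite -[e0](re_mkc _ (fun=> 0)) -/e ee; apply/negP/negPn/eqP;
      case: Nlin => _ [].
  by apply/eqP; rewrite -subr_eq0; apply/eqP; have := Ae 1; rewrite scale1r.
- exists 1%N, (fun=> e) => v /root[k ->].
  by exists (fun=> k); rewrite big_ord1.
- exists N; split=> //.
  + move=> v [Xv v1 v2]; rewrite (_ : T v = c%:C *: v + A v); last by rewrite addrC subrK.
    by case: Nlin => _ _; apply; [|exact: AN].
  + move=> v Xv; have [Hr Hi] := (dirichletP v).1 Xv.
    have [k1 E1] := dual_decomposition ab cU wE w0 hS D0 He0 de0 Hr.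
    have [k2 E2] := dual_decomposition ab cU wE w0 hS D0 He0 de0 Hi.
    exists (- (k1 +i* k2) *: e), ((k1 +i* k2) *: e + v); split; first exact: rootk.
      split; first exact: dirichlet_lin.
      * rewrite re_lin -[RHS]E1; congr dual; apply/funext => x /=.
        by rewrite re_mkc im_mkc; ring.
      * rewrite im_lin -[RHS]E2; congr dual; apply/funext => x /=.
        by rewrite re_mkc im_mkc; ring.
    by rewrite scaleNr addrA addNr add0r.
  + by move=> v [/root[k ->] /Ne ->] /=; rewrite scale0r.
  + split.
      move=> v [Xv v1 v2]; have [Hr Hi] := (dirichletP v).1 Xv.
      have [f [Hf df sf]] := shifted_surjective ab cU cP wE w0 hS Sb S1b D0 Hr v1.
      have [g [Hg dg sg]] := shifted_surjective ab cU cP wE w0 hS Sb S1b D0 Hi v2.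
      have Xm := dirichlet_mkc Hf Hg.
      exists (mkc f g); first by split; rewrite ?re_mkc ?im_mkc.
      have sr := shift_re Xm; have si := shift_im Xm; rewrite re_mkc in sr; rewrite im_mkc in si.
      by apply: reimP; [exact: shifted_uniq sr sf|exact: shifted_uniq si sg].
    have [C C0 HC] := resolvent_bound ab alpha0 cU cP wE w0 hS D0.
    exists (Num.sqrt C) => v [Xv v1 v2]; have [Hr Hi] := (dirichletP v).1 Xv.
    rewrite !H2norm_parts//; last exact: shift_dirichlet.
    rewrite -sqrtrM; last exact: ltW.
    by rewrite ler_wsqrtr// mulrDr lerD// HC//; [exact: shift_re|exact: shift_im].
Qed.

End FixedEigenvalue.

End ComplexOperator.

(** * Counting eigenvalues *)

Section Counting.
Context {R : realType}.
Variables (a b m alpha beta : R) (v v1 v2 v3 : R -> R) (Sp : set R).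
Hypotheses (ab : a < b) (alpha0 : 0 < alpha).
Hypotheses (dv : Dv v v1) (dv1 : Dv v1 v2) (dv2 : Dv v2 v3) (cv3 : continuous v3).
Hypothesis vm : forall x, a <= x <= b -> m <= v x.
Local Notation eigs := (eigs a b m alpha beta v v2).
Hypothesis Sp_eigs : Sp `<=` eigs.
Hypothesis eigs_Sp : (forall x, a <= x <= b -> v2 x < beta) -> eigs `<=` Sp.
Hypothesis profile_ratio : forall x0, a <= x0 <= b -> v2 x0 = beta ->
  exists ub K M, [/\ m <= ub, forall x, a <= x <= b -> 0 < K x <= M &
    forall x, a <= x <= b -> beta - v2 x = K x * (v x - ub)].
Implicit Types (x y p : R).

Lemma curvature_trichotomy : [\/ exists2 x0, a <= x0 <= b & v2 x0 = beta,
  forall x, a <= x <= b -> v2 x < beta | forall x, a <= x <= b -> beta < v2 x].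
Proof.
have [hx|nx] := pselect (exists2 x0, a <= x0 <= b & v2 x0 = beta); first by constructor 1.
pose f x := v2 x - beta.
have cf : continuous f by apply: ctD; [exact: Dv_cont dv2|apply: ctN; exact: ctC].
have sgn x : a <= x <= b -> 0 < f a * f x.
  move=> xab; have aab : a <= a <= b by rewrite lexx ltW.
  have n0 y : a <= y <= b -> f y != 0.
    by move=> yab; apply/eqP => fy; apply: nx; exists y => //; rewrite /f in fy; lra.
  rewrite lt_neqAle eq_sym mulf_neq0 ?n0//= leNgt; apply/negP => neg.
  have ax : a < x.
    rewrite lt_neqAle; case/andP: xab => -> _; rewrite andbT; apply/eqP => E.
    by move: neg; rewrite -E ltNge -expr2 sqr_ge0.
  have [z /andP[az zx] fz] := IVT_zero ax cf neg.
  have zab : a <= z <= b by case/andP: xab => _ xb; lra.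
  by have := n0 z zab; rewrite fz eqxx.
have [fa|fa] := ltP (f a) 0.
  by constructor 2 => x /sgn; rewrite nmulr_rgt0// /f; lra.
constructor 3 => x /sgn; have [->|fa'] := eqVneq (f a) 0; first by rewrite mul0r ltxx.
by rewrite pmulr_rgt0 ?lt_neqAle 1?eq_sym ?fa'// /f; lra.
Qed.

(** There [beta - u''] has the sign of [m - ub]. *)
Lemma min_curvature x0 p : a <= x0 <= b -> v2 x0 = beta -> a <= p <= b -> v p = m ->
  beta <= v2 p.
Proof.
move=> x0ab x0b pab vp; have [ub [K [M [mub HK HE]]]] := profile_ratio x0ab x0b.
have [K0 _] := andP (HK p pab).
have : K p * (v p - ub) <= 0 by rewrite pmulr_rle0// vp; lra.
by rewrite -HE//; lra.
Qed.

Definition mset := [set p | [/\ a < p < b, v p = m & v2 p < beta]].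

Lemma eigs_finite_of_value x0 : a <= x0 <= b -> v2 x0 = beta -> finite_set eigs.
Proof.
move=> x0ab x0b; have [ub [K [M [mub HK HE]]]] := profile_ratio x0ab x0b.
have M0 : 0 < M by have /andP[K0 /(lt_le_trans K0)] := HK x0 x0ab.
apply: (eigs_finite_in_range ab alpha0 dv dv2 vm M0 mub) => x xab; rewrite HE//;
  have /andP[K0 KM] := HK x xab.
  by rewrite -mulrA -expr2 mulr_ge0 ?sqr_ge0// ltW.
have s0 := sqr_ge0 (v x - ub).
have : K x * (K x * (v x - ub) ^+ 2) <= M * (K x * (v x - ub) ^+ 2).
  by apply: ler_wpM2r => //; rewrite mulr_ge0// ltW.
by rewrite (_ : (K x * (v x - ub)) ^+ 2 = K x * (K x * (v x - ub) ^+ 2)); [lra|ring].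
Qed.

Lemma card_le_of_lists (A B : set R) : finite_set B ->
  (forall s : seq R, uniq s -> (forall x, x \in s -> A x) ->
    exists t : seq R, [/\ uniq t, size t = size s & forall x, x \in t -> B x]) ->
  (A #<= B)%card.
Proof.
move=> /finite_seqP[l BE] H.
have Af : finite_set A.
  apply: (@finite_bounded_lists _ _ (size l)) => s us sA.
  have [t [ut <- tB]] := H s us sA; apply: uniq_leq_size => // x /tB.
  by rewrite BE.
have [s us sE] : exists2 s : seq R, uniq s & A = [set` s].
  have /finite_seqP[s ->] := Af; exists (undup s); first exact: undup_uniq.
  by apply/seteqP; split=> x /=; rewrite mem_undup.
have [t [ut ts tB]] := H s us (fun x xs => eq_ind_r (fun S : set R => S x) xs sE).
pose g y := nth 0 s (index y t).
have As : A `<=` g @` [set` t].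
  rewrite sE => x /= xs; exists (nth 0 t (index x s)).
    by rewrite /= mem_nth// ts index_mem.
  by rewrite /g index_uniq ?ts ?index_mem// nth_index.
apply: card_le_trans (subset_card_le As) _.
apply: card_le_trans (card_image_le _ _) _.
exact: subset_card_le.
Qed.

(** Eigenvalues are needed only if [beta] exceeds the curvature everywhere: in
    the two other cases no minimum is counted. *)
Lemma spectrum_finite_count :
  (forall p, a <= p <= b -> v p = m -> v1 p = 0 -> beta <= 9 / 8 * v2 p) ->
  (mset #<= Sp)%card /\ finite_set Sp.
Proof.
move=> crit.
have empty : (forall p, a < p < b -> v p = m -> beta <= v2 p) -> mset = set0.
  move=> H; apply/seteqP; split=> // p [pab vp]; have := H p pab vp; lra.
case: curvature_trichotomy => [[x0 x0ab x0b]|lt|gt].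
- split; last exact: sub_finite_set Sp_eigs (eigs_finite_of_value x0ab x0b).
  rewrite empty ?card_ge0// => p /andP[ap pb]; apply: min_curvature x0ab x0b _ => //.
  by rewrite !ltW.
- have fin := eigs_finite_above alpha ab dv dv1 dv2 cv3 vm lt crit.
  have finS := sub_finite_set Sp_eigs fin; split=> //.
  apply: card_le_of_lists => // s us sm.
  have [t [ut ts tE]] := eigs_of_zeros ab alpha0 dv dv2 vm
    (zeros_near_minima ab alpha0 dv dv1 dv2 cv3 vm us sm).
  by exists t; split=> // x /tE; exact: eigs_Sp.
- rewrite empty; last by move=> p /andP[ap pb] _; rewrite ltW// gt// !ltW.
  split; first exact: card_ge0.
  by apply: sub_finite_set Sp_eigs _; rewrite (eigs_below_curvature alpha ab vm gt).
Qed.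

(** A critical minimum has nonnegative curvature, so [beta > 9/8 u''] is not
    compatible with [beta] being a value of the curvature or below it. *)
Lemma spectrum_infinite p : a <= p <= b -> v p = m -> v1 p = 0 -> 9 / 8 * v2 p < beta ->
  infinite_set Sp.
Proof.
move=> pab vp v1p crit; have v2p := critical_min_curvature ab dv dv1 dv2 vm pab vp v1p.
have lt : forall x, a <= x <= b -> v2 x < beta.
  case: curvature_trichotomy => [[x0 x0ab x0b]|//|gt].
    by have := min_curvature x0ab x0b pab vp; lra.
  by have := gt p pab; lra.
move=> /finite_seqP[l SpE].
have [t [ut ts tE]] := eigs_of_zeros ab alpha0 dv dv2 vm
  (zeros_near_critical_minimum ab alpha0 dv dv1 dv2 cv3 vm (size l).+1 pab vp v1p crit).
have : (size t <= size l)%N.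
  apply: uniq_leq_size => // x /tE /(eigs_Sp lt); by rewrite SpE.
by rewrite ts ltnn.
Qed.

End Counting.

(** * Smooth representatives of Sobolev profiles *)

Section SmoothRepresentative.
Context {R : realType}.
Variables (a b : R).
Hypothesis ab : a < b.
Local Notation mu := (@lebesgue_measure R).
Implicit Types (f p q : R -> R) (x y : R).

Lemma primitive_prim f p q : primitive_of a b f p -> continuous q ->
  (forall x, x \in `[a, b] -> p x = q x) ->
  forall x, x \in `[a, b] -> f x = f a + prim a q x.
Proof.
move=> fp cq pq x xab; rewrite fp// prim_Rint//; last by case/andP: xab.
congr (_ + _); apply: eq_Rintegral => t; rewrite inE/= => tx; apply: pq.
by move: tx xab; rewrite !in_itv/= => /andP[-> tx] /andP[_]; exact: le_trans.
Qed.

Lemma Dv_prim k q : continuous q -> Dv (fun x => k + prim a q x) q.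
Proof. by move=> cq x; apply: (der_eq (derD (derC k x) (prim_Dv a cq x))); ring. Qed.

(** The third derivative of a function in [H^4] is an indefinite integral, hence
    continuous; freezing it outside of the interval and integrating it three times
    gives a function on the whole line, which avoids one-sided derivatives. *)
Lemma sobolev4_smooth (u : R -> R) : sobolev a b 4 u ->
  exists v v1 v2 v3 : R -> R, [/\ Dv v v1, Dv v1 v2, Dv v2 v3, continuous v3 &
    forall x, x \in `[a, b] -> u x = v x].
Proof.
move=> [g [p1 [up1 [p2 [p12 [p3 [p23 [p4 [p34 [Lg _]]]]]]]]]].
have gi := L2_intg Lg.
pose v3 x := p3 a + indef a b p4 x.
have cv3 : continuous v3 by apply: ctD; [exact: ctC|exact: ct_indef].
have E3 x : x \in `[a, b] -> p3 x = v3 x by move=> xab; rewrite p34// /v3 indefE.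
pose v2 x := p2 a + prim a v3 x; have d2 : Dv v2 v3 by exact: Dv_prim.
have E2 x : x \in `[a, b] -> p2 x = v2 x by exact: primitive_prim p23 cv3 E3 x.
pose v1 x := p1 a + prim a v2 x; have d1 : Dv v1 v2 by apply: Dv_prim; exact: Dv_cont d2.
have E1 x : x \in `[a, b] -> p1 x = v1 x by exact: primitive_prim p12 (Dv_cont d2) E2 x.
pose v x := u a + prim a v1 x; have d0 : Dv v v1 by apply: Dv_prim; exact: Dv_cont d1.
by exists v, v1, v2, v3; split; [exact: d0|exact: d1|exact: d2|exact: cv3|
  exact: primitive_prim up1 (Dv_cont d1) E1].
Qed.

Lemma punctured_proper x : x \in `[a, b] -> ProperFilter (within `[a, b] x^').
Proof.
rewrite in_itv/= => xab; apply: Build_ProperFilter_ex.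
move=> P; rewrite /within /dnbhs /within /= => /nbhs_dist[e e0 He].
have [y [yab yx ye]] : exists y, [/\ a <= y <= b, y - x != 0 & `|y - x| < e].
  exact: punctured_point.
by exists y; apply: He; rewrite // -subr_eq0.
Qed.

(** By the mean value theorem, with one-sided limits at the end points. *)
Lemma cderivE f f' (f1 : R -> R) x : Dv f f1 -> continuous f1 ->
  (forall y, y \in `[a, b] -> f' y = f y) -> x \in `[a, b] -> cderiv a b f' x = f1 x.
Proof.
move=> df cf1 ff xab; have PF := punctured_proper xab.
apply: cvg_lim => //; apply/cvgrPdist_lt => e e0.
have [d d0 Hd] := nbhs_dist ((cvgrPdist_lt _ _).1 (cf1 x) e e0).
apply/nbhs_normP; exists d => //= y; rewrite /ball_/= => xy yx yab.
rewrite !ff//.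
have q (s t : R) : s < t -> exists2 c, s < c < t & (f t - f s) / (t - s) = f1 c.
  move=> st; have [c sct E] := Dv_mvt st df; exists c => //.
  by rewrite E mulfK// subr_eq0 gt_eqF.
have [c cx ->] : exists2 c, `|c - x| < d & (f y - f x) / (y - x) = f1 c.
  case: (ltgtP x y) => [lt|lt|E]; last by rewrite E eqxx in yx.
    have [c cxy E] := q _ _ lt; exists c => //.
    by move: xy; rewrite ltr0_norm ?gtr0_norm; lra.
  have [c cxy E] := q _ _ lt; exists c.
    by move: xy; rewrite gtr0_norm ?ltr0_norm; lra.
  by rewrite -E -[f y - f x]opprB -[y - x]opprB invrN mulrNN.
by apply: Hd.
Qed.

End SmoothRepresentative.

(** * Both ends of the range *)

Section SignedProfile.
Context {R : realType}.
Variables (a b alpha : R) (u v v1 v2 v3 : R -> R) (s beta m : R).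
Hypotheses (ab : a < b) (alpha0 : 0 < alpha).
Hypotheses (dv : Dv v v1) (dv1 : Dv v1 v2) (dv2 : Dv v2 v3) (cv3 : continuous v3).
Hypothesis uv : forall x, x \in `[a, b] -> u x = v x.
Hypotheses (s2 : s * s = 1) (vm : forall x, a <= x <= b -> m <= s * v x).
Local Notation du := (cderiv a b u).
Local Notation d2u := (cderiv a b du).
Local Notation vs := (fun x => s * v x).
Local Notation vs1 := (fun x => s * v1 x).
Local Notation vs2 := (fun x => s * v2 x).
Local Notation vs3 := (fun x => s * v3 x).
Local Notation eigs := (eigs a b m alpha beta vs vs2).
Local Notation U := (profU a b v).
Local Notation P := (profP a b (s * beta) v2).
Local Notation I f := (\int[@lebesgue_measure R]_(t in `[a, b]) f t).
Implicit Types (x y p c : R).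

Lemma duE x : x \in `[a, b] -> du x = v1 x.
Proof. exact: (cderivE ab dv (Dv_cont dv1) uv). Qed.

Lemma d2uE x : x \in `[a, b] -> d2u x = v2 x.
Proof. exact: (cderivE ab dv1 (Dv_cont dv2) duE). Qed.

Lemma Dv_scale f (g : R -> R) : Dv f g -> Dv (fun x => s * f x) (fun x => s * g x).
Proof. by move=> df x; apply: (der_eq (derM (derC s x) (df x))); ring. Qed.

Let s0 : s != 0. Proof. by apply/eqP => E; move: s2; rewrite E mul0r => /eqP; rewrite eq_sym oner_eq0. Qed.
Let cU : continuous U. Proof. by apply: ct_clampC; exact: Dv_cont dv. Qed.
Let cP : continuous P.
Proof. by apply: ctD; [exact: ctC|apply: ctN; apply: ct_clampC; exact: Dv_cont dv2]. Qed.
Let UE x : x \in `[a, b] -> u x = U x.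
Proof. by move=> xab; rewrite uv// /profU clamp_id. Qed.
Let PE x : x \in `[a, b] -> s * beta - d2u x = P x.
Proof. by move=> xab; rewrite d2uE// /profP clamp_id. Qed.
Let w c x := U x - s * c.
Let wE c x : w c x = s * (profU a b vs x - c).
Proof. by rewrite /w /profU mulrBr mulrA s2 mul1r. Qed.
Let PsE x : P x = s * profP a b beta vs2 x.
Proof. by rewrite /profP mulrBr [s * (s * _)]mulrA s2 mul1r. Qed.
Let mU x : m <= profU a b vs x. Proof. by apply: vm; exact: clamp_itv. Qed.
Let w0 c x : c < m -> w c x != 0.
Proof. by move=> cm; rewrite wE mulf_neq0// (Uc_neq0 mU). Qed.

Let cUs : continuous (profU a b vs).
Proof. exact: (ct_clampC (a:=a) (b:=b) (Dv_cont (Dv_scale dv))). Qed.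

Let cPs : continuous (profP a b beta vs2).
Proof.
have cv := ct_clampC (a:=a) (b:=b) (Dv_cont (Dv_scale dv2)).
by apply: ctD; [exact: ctC|exact: ctN].
Qed.

Let ct_pots c : c < m -> continuous (pot alpha (profU a b vs) (profP a b beta vs2) c).
Proof. by move=> cm; exact: (ct_pot cUs cPs mU cm). Qed.

Lemma shot_homogeneous c F (F1 : R -> R) : c < m ->
  shot a (b + 1) alpha (profU a b vs) (profP a b beta vs2) c F F1 ->
  exists F2, homogeneous a b (rayV alpha P (w c)) F F1 F2.
Proof.
move=> cm [[dF dF1] Fa F1a]; have cF := Dv_cont dF.
exists (fun x => rayV alpha P (w c) x * F (clamp a (b + 1) x)).
have cw : continuous (fun x => (w c x)^-1).
  by apply: ctV => [|x]; [apply: ctD => //; apply: ctN; exact: ctC|exact: w0].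
have V x : rayV alpha P (w c) x = pot alpha (profU a b vs) (profP a b beta vs2) c x.
  by rewrite /rayV /pot PsE wE -mulf_div divff// mul1r.
split=> //.
- by move=> x; rewrite V.
- apply: ctM; last exact: ct_clampC.
  by apply: ctD; [exact: ctC|apply: ctN; exact: ctM].
- move=> x; rewrite in_itv/= => /andP[ax xb]; rewrite clamp_id// ax/=.
  by apply: le_trans xb _; rewrite lerDl.
Qed.

(** The eigenvalues below the range of [u] if [s = 1], and the opposites of those
    above it if [s = - 1]. *)
Definition spectrum_part : set R :=
  [set c | c < m /\ real_sigma_d a b u alpha (s * beta) (s * c)].

Lemma spectrum_part_eigs : spectrum_part `<=` eigs.
Proof.
move=> c [cm [[phi [Xp p0 Tp]] _ _]]; split=> //.
have cpot := @ct_pots c cm.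
have aB : a < b + 1 by apply: lt_trans ab _; rewrite ltrDl.
have [F [F1 [sF Fa F1a]]] := ivp aB 0 1 cpot.
have sh : shot a (b + 1) alpha (profU a b vs) (profP a b beta vs2) c F F1 by [].
have [F2 hF] := shot_homogeneous cm sh.
exists F, F1; split=> //.
exact: (eigenvalue_shot ab cU cP UE PE (fun x => erefl) (fun x => w0 x cm) hF Xp p0 Tp).
Qed.

(** When the curvature stays below [beta], the pairing that decides about
    algebraic simplicity is definite. *)
Lemma eigs_spectrum_part : (forall x, a <= x <= b -> s * v2 x < beta) -> eigs `<=` spectrum_part.
Proof.
move=> lt c [cm [F [F1 [sF Fb]]]]; split=> //.
have [F2 hF] := shot_homogeneous cm sF.
have [[dF dF1] Fa F1a] := sF; have cF := Dv_cont dF.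
have cpot := @ct_pots c cm.
have simple x : a <= x <= b -> F x = 0 -> F1 x = 0 -> False.
  move=> xab Fx F1x; have xaB : a <= x <= b + 1.
    by case/andP: xab => -> xb; apply: le_trans xb _; rewrite lerDl.
  have [|_] := solution_simple_zero cpot _ xaB Fx F1x; first by split.
  by rewrite F1a => /eqP; rewrite oner_eq0.
have bab : a <= b <= b by rewrite lexx ltW.
apply: (discrete_spectrum_of_shot ab alpha0 cU cP UE PE (fun x => erefl) (fun x => w0 x cm) hF Fb).
  by apply/eqP => F1b; exact: simple bab Fb F1b.
have cw : continuous (fun x => (w c x)^-1).
  by apply: ctV => [|x]; [apply: ctD => //; apply: ctN; exact: ctC|exact: w0].
pose Q x := profP a b beta vs2 x * (F x / w c x) ^+ 2.
have cQ : continuous Q by apply: ctM => //; apply: ctX; exact: ctM.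
have P0 x : a <= x <= b -> 0 < profP a b beta vs2 x.
  by move=> xab; rewrite /profP clamp_id// subr_gt0 lt.
have Q0 x : a <= x <= b -> 0 <= Q x by move=> xab; rewrite mulr_ge0 ?sqr_ge0// ltW// P0.
rewrite (_ : (fun x => _) = fun x => s * Q x); last first.
  by apply/funext => x; rewrite PsE -mulrA.
rewrite I_cont//; last by apply: ctM => //; exact: ctC.
rewrite primZ// mulf_neq0//; apply/eqP => Q1.
have F0 x : a <= x <= b -> F x = 0.
  move=> xab; have : Q x = 0 by apply: (prim_eq0 ab cQ Q0 _ xab); rewrite Q1.
  move/eqP; rewrite mulf_eq0 gt_eqF ?P0//= sqrf_eq0 mulf_eq0 invr_eq0 (negbTE (w0 x cm)) orbF.
  by move/eqP.
have mab : a < (a + b) / 2 < b by have ab' := ab; lra.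
apply: (simple ((a + b) / 2)).
- by case/andP: mab => /ltW-> /ltW->.
- by apply: F0; case/andP: mab => /ltW-> /ltW->.
- apply: (deriv_flat dF _ mab) => x /andP[ax xb].
  by apply: F0; rewrite !ltW.
Qed.

Hypothesis ratio : forall beta0, Ran a b d2u beta0 -> exists2 ubeta, Ran a b u ubeta &
  exists K : R -> R, [/\ forall y, y \in `[a, b] -> 0 < K y,
    exists M, forall y, y \in `[a, b] -> K y <= M &
    forall y, y \in `[a, b] -> beta0 - d2u y = K y * (u y - ubeta)].

Lemma signed_ratio x0 : a <= x0 <= b -> s * v2 x0 = beta ->
  exists ub K M, [/\ m <= ub, forall x, a <= x <= b -> 0 < K x <= M &
    forall x, a <= x <= b -> beta - s * v2 x = K x * (s * v x - ub)].
Proof.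
move=> x0ab x0b; have x0in : x0 \in `[a, b] by rewrite in_itv.
have [|ub [x1 x1ab <-] [K [K0 [M KM] KE]]] := ratio (beta0 := s * beta).
  by exists x0 => //; rewrite d2uE// -x0b mulrA s2 mul1r.
exists (s * v x1), K, M; split.
- by apply: vm; move: x1ab; rewrite /= in_itv.
- by move=> x xab; rewrite K0 ?in_itv// KM ?in_itv.
- move=> x xab; have := KE x; rewrite in_itv/= => /(_ xab).
  rewrite d2uE ?in_itv// !uv ?in_itv// => E.
  have -> : beta - s * v2 x = s * (s * beta - v2 x).
    by rewrite mulrBr mulrA s2 mul1r.
  by rewrite E; ring.
Qed.

Local Notation S := [set c | real_sigma_d a b u alpha (s * beta) c /\ s * c < m].

Let ss x : s * (s * x) = x. Proof. by rewrite mulrA s2 mul1r. Qed.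

Lemma S_image : S = [set s * c | c in spectrum_part].
Proof.
apply/seteqP; split=> [c [Sc cm]|_ [c [cm Sc] <-]].
  by exists (s * c); [split; rewrite ?ss|rewrite ss].
by split; rewrite ?ss.
Qed.

Lemma signed_finite_count :
  (forall p, p \in `[a, b] -> s * u p = m -> du p = 0 -> beta <= 9 / 8 * (s * d2u p)) ->
  ([set p | [/\ p \in `]a, b[, s * u p = m & s * d2u p < beta]] #<= S)%card /\ finite_set S.
Proof.
move=> crit.
have [||h1 h2] := spectrum_finite_count ab alpha0 (Dv_scale dv) (Dv_scale dv1) (Dv_scale dv2) _ vm
  spectrum_part_eigs eigs_spectrum_part signed_ratio.
- by apply: ctM => //; exact: ctC.
- move=> p pab; have pin : p \in `[a, b] by rewrite in_itv.
  move=> vp /eqP; rewrite mulf_eq0 (negbTE s0)/= => /eqP v1p.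
  by rewrite -d2uE//; apply: crit; rewrite ?uv ?duE.
split; last by rewrite S_image; exact: finite_image.
have -> : [set p | [/\ p \in `]a, b[, s * u p = m & s * d2u p < beta]] = mset a b m beta vs vs2.
  apply/seteqP; split=> p /= [pab up d2p]; have pin : p \in `[a, b].
  - by move: pab; rewrite !in_itv/= => /andP[/ltW-> /ltW->].
  - by move: pab up d2p; rewrite in_itv/= uv// d2uE.
  - by rewrite in_itv/=; case/andP: pab => /ltW-> /ltW->.
  - by rewrite in_itv/= uv// d2uE.
apply: card_le_trans h1 _.
have sp : spectrum_part `<=` [set s * c | c in S].
  by move=> c [cm Sc]; exists (s * c); rewrite /= ?ss.
exact: card_le_trans (subset_card_le sp) (card_image_le _ _).
Qed.

Lemma signed_infinite p : p \in `[a, b] -> s * u p = m -> du p = 0 ->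
  9 / 8 * (s * d2u p) < beta -> infinite_set (real_sigma_d a b u alpha (s * beta)).
Proof.
move=> pin up dup d2p fin.
have cs3 : continuous vs3 by apply: ctM => //; exact: ctC.
apply: (spectrum_infinite ab alpha0 (Dv_scale dv) (Dv_scale dv1) (Dv_scale dv2) cs3 vm
  eigs_spectrum_part signed_ratio (p := p)).
- by move: pin; rewrite in_itv.
- by rewrite -uv.
- by rewrite -duE// dup mulr0.
- by rewrite -d2uE.
apply: (@sub_finite_set _ _ [set s * c | c in real_sigma_d a b u alpha (s * beta)]).
  by move=> c [_ Sc]; exists (s * c); rewrite ?ss.
exact: finite_image.
Qed.

End SignedProfile.

Section Infimum.
Context {R : realType}.
Implicit Types (A : set R) (f : R -> R) (x k : R).

Lemma le_scale_ereal_inf A f k x : 0 < k ->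
  (x%:E <= k%:E * ereal_inf [set (f y)%:E | y in A])%E <-> forall y, A y -> x <= k * f y.
Proof.
move=> k0; rewrite -lee_pdivrMl//; split=> H.
  move=> y Ay; have := le_trans H (ereal_inf_lbound (ex_intro2 _ _ y Ay erefl)).
  by rewrite lee_pdivrMl// -EFinM lee_fin.
apply: le_ereal_inf_tmp => _ [y Ay <-].
by rewrite lee_pdivrMl// -EFinM lee_fin; exact: H.
Qed.

Lemma scale_ereal_sup_le A f k x : 0 < k ->
  (k%:E * ereal_sup [set (f y)%:E | y in A] <= x%:E)%E <-> forall y, A y -> k * f y <= x.
Proof.
move=> k0; rewrite -lee_pdivlMl//; split=> H.
  move=> y Ay; have := le_trans (ereal_sup_ubound (ex_intro2 _ _ y Ay erefl)) H.
  by rewrite lee_pdivlMl// -EFinM lee_fin.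
apply: ge_ereal_sup => _ [y Ay <-].
by rewrite lee_pdivlMl// -EFinM lee_fin; exact: H.
Qed.

End Infimum.

(** * The number of real discrete eigenvalues *)

Theorem theorem2p13 (R : realType) (y1 y2 : R) (u : R -> R) (alpha : R)
    (hy : y1 < y2) (hu : class_Kplus y1 y2 u) (halpha : 0 < alpha) :
  [/\ forall beta : R, 0 < beta ->
        (beta%:E <= (9 / 8)%:E * kappa_plus y1 y2 u)%E ->
        let S := real_sigma_d y1 y2 u alpha beta `&` [set c | c < umin y1 y2 u] in
        (m_set_pos y1 y2 u beta #<= S)%card /\ finite_set S,
      forall beta : R, beta < 0 ->
        ((9 / 8)%:E * kappa_minus y1 y2 u <= beta%:E)%E ->
        let S := real_sigma_d y1 y2 u alpha beta `&` [set c | umax y1 y2 u < c] in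
        (m_set_neg y1 y2 u beta #<= S)%card /\ finite_set S
    & forall beta : R,
        ~ (((9 / 8)%:E * kappa_minus y1 y2 u <= beta%:E)%E /\
           (beta%:E <= (9 / 8)%:E * kappa_plus y1 y2 u)%E) ->
        infinite_set (real_sigma_d y1 y2 u alpha beta)].
Proof.
have [Hu _ ratio] := hu.
have [v [v1 [v2 [v3 [dv dv1 dv2 cv3 uv]]]]] := sobolev4_smooth hy Hu.
have [B B0 HB] := cont_bounded y1 y2 (Dv_cont dv).
have uB x : x \in `[y1, y2] -> `|u x| <= B by move=> xy; rewrite uv//; exact: HB.
have min_le x : y1 <= x <= y2 -> umin y1 y2 u <= 1 * v x.
  move=> xy; rewrite mul1r -uv ?in_itv//; apply: ge_inf; last by exists x; rewrite /= ?in_itv.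
  by exists (- B) => _ [t ty <-]; have /ler_normlP[] := uB t ty; rewrite lerNl.
have max_ge x : y1 <= x <= y2 -> - umax y1 y2 u <= -1 * v x.
  move=> xy; rewrite mulN1r lerN2 -uv ?in_itv//; apply: ub_le_sup; last by exists x; rewrite /= ?in_itv.
  by exists B => _ [t ty <-]; have /ler_normlP[] := uB t ty.
have s1 : 1 * 1 = 1 :> R by rewrite mulr1.
have sN : -1 * -1 = 1 :> R by rewrite mulrNN mulr1.
have k0 : 0 < 9 / 8 :> R by [].
split.
- move=> beta _ /(le_scale_ereal_inf _ _ _ k0) crit S.
  have [|h1 h2] := signed_finite_count hy halpha dv dv1 dv2 cv3 uv s1 min_le ratio (beta := beta).
    by move=> p py; rewrite !mul1r => up dup; exact: crit.
  have SE : [set c | real_sigma_d y1 y2 u alpha (1 * beta) c /\ 1 * c < umin y1 y2 u] = S.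
    by apply/seteqP; split=> c /=; rewrite !mul1r.
  rewrite SE in h1 h2; split=> //; apply: card_le_trans (subset_card_le _) h1 => p /= [py up].
  by rewrite !mul1r subr_lt0.
- move=> beta _ /(scale_ereal_sup_le _ _ _ k0) crit S.
  have [|h1 h2] := signed_finite_count hy halpha dv dv1 dv2 cv3 uv sN max_ge ratio (beta := - beta).
    move=> p py; rewrite !mulN1r => /oppr_inj up dup.
    by rewrite mulrN lerN2; exact: crit.
  have SE : [set c | real_sigma_d y1 y2 u alpha (-1 * - beta) c /\ -1 * c < - umax y1 y2 u] = S.
    by apply/seteqP; split=> c /=; rewrite mulrNN mul1r mulN1r ltrN2.
  rewrite SE in h1 h2; split=> //; apply: card_le_trans (subset_card_le _) h1 => p /= [py up].
  by rewrite !mulN1r ltrN2 up subr_gt0.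
- move=> beta out.
  have [|nmin] := pselect (beta%:E <= (9 / 8)%:E * kappa_plus y1 y2 u)%E; last first.
    apply: contrapT => fin; apply: nmin; apply/(le_scale_ereal_inf _ _ _ k0) => p [py dup up].
    rewrite leNgt; apply/negP => lt; apply: fin; rewrite -[beta]mul1r.
    apply: (signed_infinite hy halpha dv dv1 dv2 cv3 uv s1 min_le ratio py) => //.
      by rewrite mul1r.
    by rewrite mul1r.
  move=> leK; apply: contrapT => fin; apply: out; split=> //.
  apply/(scale_ereal_sup_le _ _ _ k0) => p [py dup up].
  rewrite leNgt; apply/negP => lt; apply: fin; rewrite -[beta]mul1r -(mulrNN 1).
  apply: (signed_infinite hy halpha dv dv1 dv2 cv3 uv sN max_ge ratio py) => //.
    by rewrite mulN1r up.
  by rewrite mulN1r mulrN ltrN2.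
Qed.
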